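(* Let $F=\mathbf Q(i)$ and $\Delta_0(F)=\ker(\mathbf Z[\mathbf P^1(F)]\xrightarrow{\deg}\mathbf Z)$, which is canonically the rank-two Steinberg module $\mathrm{St}_F$. There is an exact sequence of left $G$-modules $$C_2^{\mathrm{id}}\xrightarrow{\partial_2}C_1^{\mathrm{id}}\xrightarrow{\partial_1}\Delta_0(F)\longrightarrow0,\qquad \partial_1[\alpha,\beta]=[\beta]-[\alpha],\quad \partial_2[\alpha,\beta,\gamma]=[\alpha,\beta]+[\beta,\gamma]+[\gamma,\alpha],$$ whose generators are the oriented Gaussian unimodular edges and whose relations are the boundaries of the Gaussian ideal triangles, and these edges and triangles are exactly the edges and triangular faces of the Gaussian Farey octahedra. Moreover, let $\Sigma$ be a valid marked Picard Farey symbol and let $H=H_\Sigma$ be the finite-index subgroup of $G$ it reconstructs. The data of $\Sigma$, namely its Gaussian-rational octahedral occurrences, the local groups $J_x$, and the ordered and cooriented source-to-target face transports, determine, without using the subdivision of each octahedron into its twelve Picard cells: 1. the $H$-orbits of oriented ideal edges and faces; 2. their setwise stabilizers $H_\sigma$ and orientation characters $\epsilon_\sigma$; 3. the transport elements $h_{jr}\in H$ and incidence signs $\eta_{jr}$ in every face boundary $\partial_2f_j=\sum_r\eta_{jr}h_{jr}e_{i(j,r)}$; 4. the finite induced-module presentation $$\bigoplus_{f\in\mathcal F_H}\mathrm{Ind}_{H_f}^H\mathbf Z_{\epsilon_f}\longrightarrow\bigoplus_{e\in\mathcal E_H}\mathrm{Ind}_{H_e}^H\mathbf Z_{\epsilon_e}\longrightarrow\mathrm{St}_F\longrightarrow0;$$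 5. for every left $\mathbf Z[H]$-module $V$, the relation map $$\delta_H:\bigoplus_{e\in\mathcal E_H}V^{H_e,\epsilon_e}\to\bigoplus_{f\in\mathcal F_H}V^{H_f,\epsilon_f},\qquad(\delta_Hv)_j=\sum_r\eta_{jr}h_{jr}v_{i(j,r)},$$ and hence $\mathrm{Symb}_H(V)=\mathrm{Hom}_{\mathbf Z[H]}(\Delta_0(F),V)=\ker\delta_H$. The construction is canonical up to the usual change of orbit representatives, which gives canonically isomorphic induced summands.
   Context: *Steinberg module and ideal cells.* $G=\mathrm{PSL}_2(\mathbf Z[i])$, $F=\mathbf Q(i)$. $\mathrm{St}_F=\widetilde H_0(\mathcal T_2(F);\mathbf Z)$, where $\mathcal T_2(F)$ is the Tits building of $F^2$, i.e. the discrete set $\mathbf P^1(F)$. An ordered pair $(\alpha,\beta)$ of distinct cusps in $\mathbf P^1(F)$ is a Gaussian unimodular edge if primitive lifts to $\mathbf Z[i]^2$ form a basis of $\mathbf Z[i]^2$; write $[\alpha,\beta]$ with $[\beta,\alpha]=-[\alpha,\beta]$. An oriented Gaussian ideal triangle is a cyclically ordered triple of cusps which, after unit changes of primitive lifts, is represented by $Fv_1,Fv_2,F(v_1+v_2)$ with $(v_1,v_2)$ a basis of $\mathbf Z[i]^2$. $C_1^{\mathrm{id}},C_2^{\mathrm{id}}$ are the abelian groups generated by these oriented edges and triangles, reversal of orientation negating the generator. For an oriented ideal cell $\sigma$ with underlying cell $\bar\sigma$, $H_\sigma=\{h\in H:h\bar\sigma=\bar\sigma\}$ and $h\sigma=\epsilon_\sigma(h)\sigma$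 defines $\epsilon_\sigma:H_\sigma\to\{\pm1\}$; $V^{H_\sigma,\epsilon_\sigma}=\{v\in V:hv=\epsilon_\sigma(h)v\ \forall h\in H_\sigma\}$. $\mathcal E_H=\{e_i\}$ and $\mathcal F_H=\{f_j\}$ are (finite) sets of oriented representatives of the $H$-orbits of underlying ideal edges and triangles; $\mathrm{Ind}_{H_\sigma}^H\mathbf Z_{\epsilon_\sigma}=\mathbf Z[H]\otimes_{\mathbf Z[H_\sigma]}\mathbf Z_{\epsilon_\sigma}$. *Octahedra.* $w=(1+i)/2$; $\mathcal O$ is the ideal octahedron in $\mathbf H^3$ with vertices $\infty,0,1,i,1+i,w$, $K=\mathrm{Stab}_G(\mathcal O)$ (order $12$); Gaussian Farey octahedra are the translates $g\mathcal O$, $g\in G$, which tessellate $\mathbf H^3$. Put $S=\begin{pmatrix}0&-1\\1&0\end{pmatrix}$, $R=\begin{pmatrix}0&i\\i&0\end{pmatrix}$, $X=\begin{pmatrix}1&-1\\1&0\end{pmatrix}$, $Y=\begin{pmatrix}-1&i\\i&0\end{pmatrix}$; $G=\langle S,R,X,Y\mid S^2=R^2=(RS)^2=X^3=(RX)^2=Y^3=(X^{-1}Y)^2=(SY)^2=1\rangle$ and $X,Y\in K$. Let $P_0$ be the convex hull of $0,\infty,(\tfrac12,0,\tfrac{\sqrt3}2),(\tfrac12,\tfrac12,\tfrac1{\sqrt2}),(0,\tfrac12,\tfrac{\sqrt3}2)$ (standard Picard cell); the twelve cells $kP_0$, $k\in K$, tile $\mathcal O$. Let $F_R,F_S$ be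 the faces of $\mathcal O$ with vertices $0,1,\infty$ and $i,0,\infty$. Faces of $\mathcal O$ carry outward coorientation and induced boundary orientation; $\overline{F'}$ is $F'$ with both reversed, so $qF_1=\overline{F'}$ ($q\in G$) means $q$ carries triangle $F_1$ to triangle $F'$ and $q\mathcal O$, $\mathcal O$ lie on opposite sides of $F'$. *Symbols.* A candidate marked Picard Farey symbol $\Sigma$ consists of: (i) a finite set of occurrences $x$, each with $g_x\in G$ and oriented octahedron $\mathcal O_x=g_x\mathcal O$ recorded by its ordered six Gaussian-rational vertices; (ii) $\widehat J_x\le\mathrm{Stab}_G(\mathcal O_x)$, $J_x=g_x^{-1}\widehat J_xg_x\le K$; (iii) for each $J_x$-orbit of outward-cooriented faces, with representative $F_1$ (in normalized coordinates, a face of $\mathcal O$), a paired outward-cooriented face $F'$ of an occurrence $y$ and $q\in G$ with $qF_1=\overline{F'}$ and $qJ_{x,F_1}q^{-1}=J_{y,F'}$, where $J_{x,F_1}$ is the setwise stabilizer of $F_1$ in $J_x$; (iv) involutivity (the reverse pairing is $(F',F_1,q^{-1})$), data being taken up to $(F_1,F',q)\mapsto(jF_1,j'F',j'qj^{-1})$ for $j\in J_x,j'\in J_y$, and connectedness of the graph of occurrences and paired face orbits; (v) a distinguished cell $c_0\in\bigsqcup_xJ_x\backslash K$. The induced maps on $\mathscr C_\Sigma=\bigsqcup_xJ_x\backslash K$ are $J_xk\mapsto J_xkX$, $J_xk\mapsto J_xkY$, and, for $\tau=R$ (resp. $S$), with $k$ chosen in its coset so that $kF_R$ (resp. $kF_S$)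 is a stored face representative with datum $(kF_R,F',q)$ (resp. $(kF_S,F',q)$) and target $y$, $J_xk\mapsto J_y(qk\tau^{-1})$. $\Sigma$ is valid if these are total permutations satisfying the eight relators as a right action and acting transitively; then $H_\Sigma=\mathrm{Stab}_G(c_0)$. *)

(* Defs.v *)
From HB Require Import structures.
From mathcomp Require Import all_boot all_order all_algebra.
From mathcomp Require Import finmap.
From mathcomp Require Import complex.
From mathcomp Require Import freeg.
From mathcomp Require Import boolp.

Set Implicit Arguments.
Unset Strict Implicit.
Unset Printing Implicit Defensive.

Import Order.TTheory GRing.Theory Num.Theory.

Local Open Scope ring_scope.
Local Open Scope quotient_scope.

Declare Scope gset_scope.
Delimit Scope gset_scope with GS.
Local Open Scope gset_scope.

Record subgroup (Gam : groupType) := Subgroup {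
  sg_mem :> Gam -> Prop;
  sg_one : sg_mem 1%g;
  sg_mul : forall g h, sg_mem g -> sg_mem h -> sg_mem (g * h)%g;
  sg_inv : forall g, sg_mem g -> sg_mem (g^-1)%g }.

Section SubgroupType.
Variables (Gam : groupType) (H : subgroup Gam).

Definition sg_pred : {pred Gam} := fun g => `[< H g >].

Lemma sg_predP g : reflect (H g) (g \in sg_pred).
Proof. exact: asboolP. Qed.

Fact sg_pred_closed : group_closed sg_pred.
Proof.
split; first by apply/sg_predP; exact: sg_one.
move=> g h /sg_predP Hg /sg_predP Hh; apply/sg_predP.
exact: sg_mul Hg (sg_inv Hh).
Qed.

Record sg_type := SgElt { sg_val : Gam; sg_valP : sg_val \in sg_pred }.
HB.instance Definition _ := [isSub for sg_val].
HB.instance Definition _ := [Choice of sg_type by <:].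
HB.instance Definition _ :=
  SubChoice_isSubGroup.Build Gam sg_pred sg_type sg_pred_closed.

End SubgroupType.

Record gset (Gam : groupType) := GSet {
  gset_sort :> choiceType;
  gset_act : Gam -> gset_sort -> gset_sort;
  gset_act1 : forall x, gset_act 1%g x = x;
  gset_actM : forall g h x, gset_act (g * h)%g x = gset_act g (gset_act h x) }.

Notation "g • x" := (gset_act g x) (at level 38, right associativity)
  : gset_scope.

Record gmodule (Gam : groupType) := GModule {
  gmod_sort :> zmodType;
  gmod_act : Gam -> gmod_sort -> gmod_sort;
  gmod_act1 : forall v, gmod_act 1%g v = v;
  gmod_actM : forall g h v, gmod_act (g * h)%g v = gmod_act g (gmod_act h v);
  gmod_actD : forall g u v, gmod_act g (u + v) = gmod_act g u + gmod_act g v }.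

Notation "g ⊙ v" := (gmod_act g v) (at level 38, right associativity)
  : gset_scope.

Definition is_ghom (Gam : groupType) (M N : gmodule Gam) (f : M -> N) :=
  (forall u v, f (u + v) = f u + f v) /\ (forall g v, f (g ⊙ v) = g ⊙ f v).

Definition exact_at (U V W : zmodType) (f : U -> V) (g : V -> W) :=
  forall v, g v = 0 <-> exists u, f u = v.

Definition surjective (A B : Type) (f : A -> B) := forall b, exists a, f a = b.

Section Restriction.
Variables (Gam : groupType) (H : subgroup Gam) (M : gmodule Gam).

Definition gres_act (h : sg_type H) (v : M) : M := val h ⊙ v.

Fact gres_act1 v : gres_act 1%g v = v.
Proof. exact: gmod_act1. Qed.

Fact gres_actM g h v : gres_act (g * h)%g v = gres_act g (gres_act h v).
Proof. exact: gmod_actM. Qed.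

Fact gres_actD g u v : gres_act g (u + v) = gres_act g u + gres_act g v.
Proof. exact: gmod_actD. Qed.

Definition gres : gmodule (sg_type H) := GModule gres_act1 gres_actM gres_actD.

End Restriction.

Section FsetGSet.
Variables (Gam : groupType) (T : gset Gam).

Definition fset_act (g : Gam) (A : {fset T}) : {fset T} :=
  [fset g • x | x in A]%fset.

Fact fset_act1 A : fset_act 1%g A = A.
Proof.
apply/fsetP=> x; apply/imfsetP/idP => [[y yA ->]|xA] /=.
  by rewrite gset_act1.
by exists x; rewrite ?gset_act1.
Qed.

Fact fset_actM g h A : fset_act (g * h)%g A = fset_act g (fset_act h A).
Proof.
apply/fsetP=> x; apply/imfsetP/imfsetP => [[y /= yA ->]|[y /= /imfsetP[z /= zA ->] ->]].
  by exists (h • y); rewrite ?gset_actM //=; apply/imfsetP; exists y.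
by exists z; rewrite ?gset_actM.
Qed.

Definition fset_gset : gset Gam := GSet fset_act1 fset_actM.

End FsetGSet.

Section FreeModule.
Variables (Gam : groupType) (T : gset Gam).

Definition fg_act (g : Gam) : {freeg T / int} -> {freeg T / int} :=
  fglift (fun t : T => << g • t >> : {freeg T / int}).

Fact fg_actU g k t : fg_act g << k *g t >> = << k *g g • t >>.
Proof.
rewrite /fg_act liftU; apply/eqP/freeg_eqP => z.
by rewrite coeffZ !coeffU mul1r.
Qed.

Fact fg_actD g u v : fg_act g (u + v) = fg_act g u + fg_act g v.
Proof.
have HB x y : fg_act g (x - y) = fg_act g x - fg_act g y.
  by rewrite /fg_act (lift_is_additive (fun t : T => << g • t >>)).
have H0 : fg_act g 0 = 0 by have := HB 0 0; rewrite subrr => ->; rewrite subrr.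
have HN w : fg_act g (- w) = - fg_act g w by rewrite -[- w]sub0r HB H0 sub0r.
by rewrite -[v in LHS]opprK HB HN opprK.
Qed.

Fact fg_act_sum g (s : seq T) (F : T -> {freeg T / int}) :
  fg_act g (\sum_(x <- s) F x) = \sum_(x <- s) fg_act g (F x).
Proof.
have H0 : fg_act g 0 = 0.
  by apply: (addrI (fg_act g 0)); rewrite -fg_actD !addr0.
by apply: (big_morph (fg_act g) (fg_actD g) H0).
Qed.

Fact fg_act1 v : fg_act 1%g v = v.
Proof.
rewrite -{1}(freeg_sumE v) fg_act_sum -[RHS]freeg_sumE.
by apply: eq_bigr => x _; rewrite fg_actU gset_act1.
Qed.

Fact fg_actM g h v : fg_act (g * h)%g v = fg_act g (fg_act h v).
Proof.
rewrite -(freeg_sumE v) !fg_act_sum.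
by apply: eq_bigr => x _; rewrite !fg_actU gset_actM.
Qed.

Definition free_gmod : gmodule Gam := GModule fg_act1 fg_actM fg_actD.

Definition fgen (t : T) : free_gmod := << t >>.

End FreeModule.

Record submodule (Gam : groupType) (M : gmodule Gam) := Submodule {
  sm_mem :> M -> Prop;
  sm_0 : sm_mem 0;
  sm_B : forall u v, sm_mem u -> sm_mem v -> sm_mem (u - v);
  sm_act : forall g v, sm_mem v -> sm_mem (g ⊙ v) }.

Section SubQuotient.
Variables (Gam : groupType) (M : gmodule Gam) (N : submodule M).

Definition sm_pred : {pred M} := fun v => `[< N v >].

Lemma sm_predP v : reflect (N v) (v \in sm_pred).
Proof. exact: asboolP. Qed.

Fact sm_pred_closed : zmod_closed sm_pred.
Proof.
split; first by apply/sm_predP; exact: sm_0.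
by move=> u v /sm_predP Nu /sm_predP Nv; apply/sm_predP; exact: sm_B.
Qed.

HB.instance Definition _ := GRing.isZmodClosed.Build M sm_pred sm_pred_closed.

Record sub_type := SubElt { sub_val : M; sub_valP : sub_val \in sm_pred }.
HB.instance Definition _ := [isSub for sub_val].
HB.instance Definition _ := [Choice of sub_type by <:].
HB.instance Definition _ := [SubChoice_isSubZmodule of sub_type by <:].

Fact sub_act_proof g (v : sub_type) : g ⊙ val v \in sm_pred.
Proof. by apply/sm_predP/sm_act/sm_predP; exact: valP. Qed.

Definition sub_act g (v : sub_type) : sub_type := Sub (g ⊙ val v) (sub_act_proof g v).

Fact sub_act1 v : sub_act 1%g v = v.
Proof. by apply: val_inj; rewrite SubK gmod_act1. Qed.

Fact sub_actM g h v : sub_act (g * h)%g v = sub_act g (sub_act h v).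
Proof. by apply: val_inj; rewrite !SubK gmod_actM. Qed.

Fact sub_actD g u v : sub_act g (u + v) = sub_act g u + sub_act g v.
Proof.
have E w z : sub_val (w + z) = sub_val w + sub_val z by exact: (raddfD val).
apply: val_inj; change (g ⊙ sub_val (u + v) = sub_val (sub_act g u + sub_act g v)).
by rewrite !E gmod_actD.
Qed.

Definition sub_gmod : gmodule Gam := GModule sub_act1 sub_actM sub_actD.

Definition quo_type := Quotient.quot sm_pred.
HB.instance Definition _ := GRing.Zmodule.on quo_type.

Definition quo_pi (v : M) : quo_type := \pi_(Quotient.quot sm_pred) v.

Lemma quo_piP u v : quo_pi u = quo_pi v <-> N (u - v).
Proof.
split=> [/eqP|Nuv]; last apply/eqP.
  by rewrite -Quotient.idealrBE => /sm_predP.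
by rewrite -Quotient.idealrBE; apply/sm_predP.
Qed.

Lemma quo_piD u v : quo_pi (u + v) = quo_pi u + quo_pi v.
Proof. by rewrite /quo_pi raddfD. Qed.

Lemma quo_reprK q : quo_pi (repr q) = q.
Proof. exact: reprK. Qed.

Definition quo_act g (q : quo_type) : quo_type := quo_pi (g ⊙ repr q).

Lemma quo_act_pi g v : quo_act g (quo_pi v) = quo_pi (g ⊙ v).
Proof.
have gmB u w : g ⊙ (u - w) = g ⊙ u - g ⊙ w.
  by apply/eqP; rewrite eq_sym subr_eq -gmod_actD subrK.
by apply/quo_piP; rewrite -gmB; apply/sm_act/quo_piP; rewrite quo_reprK.
Qed.

Fact quo_act1 q : quo_act 1%g q = q.
Proof. by rewrite /quo_act gmod_act1 quo_reprK. Qed.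

Fact quo_actM g h q : quo_act (g * h)%g q = quo_act g (quo_act h q).
Proof. by rewrite {1 3}/quo_act quo_act_pi gmod_actM. Qed.

Fact quo_actD g p q : quo_act g (p + q) = quo_act g p + quo_act g q.
Proof.
rewrite -(quo_reprK p) -(quo_reprK q) -quo_piD !quo_act_pi -quo_piD.
by rewrite gmod_actD.
Qed.

Definition quo_gmod : gmodule Gam := GModule quo_act1 quo_actM quo_actD.

End SubQuotient.

Section Span.
Variables (Gam : groupType) (M : gmodule Gam) (S : M -> Prop).

Definition span_mem (v : M) :=
  forall N : submodule M, (forall s, S s -> N s) -> N v.

Fact span_0 : span_mem 0.
Proof. by move=> N _; exact: sm_0. Qed.

Fact span_B u v : span_mem u -> span_mem v -> span_mem (u - v).
Proof. by move=> Su Sv N SN; apply: sm_B; [exact: Su|exact: Sv]. Qed.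

Fact span_act g v : span_mem v -> span_mem (g ⊙ v).
Proof. by move=> Sv N SN; apply: sm_act; exact: Sv. Qed.

Definition gspan : submodule M := Submodule span_0 span_B span_act.

End Span.

Section DirectSum.
Variables (Gam : groupType) (I : finType) (M : I -> gmodule Gam).

Definition dsum_type := {dffun forall i : I, M i}.
HB.instance Definition _ := Choice.on dsum_type.

Definition dsum_zero : dsum_type := [ffun i => 0 : M i].
Definition dsum_opp (u : dsum_type) : dsum_type := [ffun i => - u i].
Definition dsum_add (u v : dsum_type) : dsum_type := [ffun i => u i + v i].

Fact dsum_addA : associative dsum_add.
Proof. by move=> u v w; apply/ffunP=> i; rewrite !ffunE addrA. Qed.
Fact dsum_addC : commutative dsum_add.
Proof. by move=> u v; apply/ffunP=> i; rewrite !ffunE addrC. Qed.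
Fact dsum_add0 : left_id dsum_zero dsum_add.
Proof. by move=> u; apply/ffunP=> i; rewrite !ffunE add0r. Qed.
Fact dsum_addN : left_inverse dsum_zero dsum_opp dsum_add.
Proof. by move=> u; apply/ffunP=> i; rewrite !ffunE addNr. Qed.

HB.instance Definition _ :=
  GRing.isZmodule.Build dsum_type dsum_addA dsum_addC dsum_add0 dsum_addN.

Definition dsum_act g (u : dsum_type) : dsum_type := [ffun i => g ⊙ u i].

Fact dsum_act1 u : dsum_act 1%g u = u.
Proof. by apply/ffunP=> i; rewrite !ffunE gmod_act1. Qed.
Fact dsum_actM g h u : dsum_act (g * h)%g u = dsum_act g (dsum_act h u).
Proof. by apply/ffunP=> i; rewrite !ffunE gmod_actM. Qed.
Fact dsum_actD g u v : dsum_act g (u + v) = dsum_act g u + dsum_act g v.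
Proof. by apply/ffunP=> i; rewrite !ffunE gmod_actD. Qed.

Definition dsum : gmodule Gam := GModule dsum_act1 dsum_actM dsum_actD.

Definition dsum_in (i : I) (v : M i) : dsum :=
  [ffun j => untag (0 : M j) (fun w : M j => w) (Tagged (fun k => M k) v)].

Lemma dsum_in_eq i (v : M i) : (dsum_in v : dsum_type) i = v.
Proof. by rewrite ffunE untagE. Qed.

Lemma dsum_in_neq i j (v : M i) : i != j -> (dsum_in v : dsum_type) j = 0.
Proof. by move=> ij; rewrite ffunE untag_dflt. Qed.

End DirectSum.

Section Induced.
Variable Gam : groupType.

Definition regular_gset : gset Gam :=
  @GSet Gam Gam (fun g h => (g * h)%g) (@mul1g Gam) (fun g h x => esym (mulgA g h x)).

Definition group_ring : gmodule Gam := free_gmod regular_gset.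

Definition zg (g : Gam) : group_ring := @fgen Gam regular_gset g.

Definition rmulZ (k : Gam) (a : group_ring) : group_ring :=
  fglift (fun h : Gam => << (h * k)%g >> : {freeg Gam / int}) a.

Definition tensor_act (g : Gam) (p : group_ring * int) : group_ring * int :=
  (g ⊙ p.1, p.2).

Fact tensor_act1 p : tensor_act 1%g p = p.
Proof. by case: p => a n; rewrite /tensor_act gmod_act1. Qed.

Fact tensor_actM g h p : tensor_act (g * h)%g p = tensor_act g (tensor_act h p).
Proof. by rewrite /tensor_act gmod_actM. Qed.

Definition tensor_gens : gset Gam :=
  @GSet Gam (group_ring * int)%type tensor_act tensor_act1 tensor_actM.

Definition tgen (a : group_ring) (n : int) : free_gmod tensor_gens :=
  @fgen Gam tensor_gens (a, n).

Variables (L : Gam -> Prop) (eps : Gam -> int).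

(* Z[Gam] (x)_{Z[L]} Z_eps: free abelian group on pairs (a, n), modulo
   biadditivity and the balancing relations (a k, n) = (a, eps(k) n), k in L. *)
Variant tensor_rel : free_gmod tensor_gens -> Prop :=
| tensor_addl (a b : group_ring) (n : int) :
    tensor_rel (tgen (a + b) n - tgen a n - tgen b n)
| tensor_addr (a : group_ring) (m n : int) :
    tensor_rel (tgen a (m + n) - tgen a m - tgen a n)
| tensor_bal (a : group_ring) (n : int) (k : Gam) : L k ->
    tensor_rel (tgen (rmulZ k a) n - tgen a (eps k * n)).

Definition induced : gmodule Gam := quo_gmod (gspan tensor_rel).

Definition tensor (a : group_ring) (n : int) : induced :=
  quo_pi (gspan tensor_rel) (tgen a n).

End Induced.

Arguments tensor {Gam L eps} a n.

Notation F := (rat[i]%C) (only parsing).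

Definition gaussint (z : F) : bool :=
  (complex.Re z \is a Num.int) && (complex.Im z \is a Num.int).

Lemma gaussintD x y : gaussint x -> gaussint y -> gaussint (x + y).
Proof.
by case: x y => [a b] [c d] /andP[/= ??] /andP[/= ??]; apply/andP; split; exact: rpredD.
Qed.

Lemma gaussintN x : gaussint x -> gaussint (- x).
Proof. by case: x => a b /andP[/= ??]; apply/andP; split; rewrite /= rpredN. Qed.

Lemma gaussintM x y : gaussint x -> gaussint y -> gaussint (x * y).
Proof.
case: x y => [a b] [c d] /andP[/= ??] /andP[/= ??]; apply/andP.
by split; [apply: rpredB|apply: rpredD]; apply: rpredM.
Qed.

Lemma gaussint0 : gaussint 0. Proof. by []. Qed.
Lemma gaussint1 : gaussint 1. Proof. by []. Qed.

Lemma gaussint_sum (I : Type) (s : seq I) (P : pred I) (f : I -> F) :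
  (forall i, P i -> gaussint (f i)) -> gaussint (\sum_(i <- s | P i) f i).
Proof. by move=> Hf; elim/big_ind: _ => //; exact: gaussintD. Qed.

Definition gaussmx m n (A : 'M[F]_(m, n)) : bool :=
  [forall i, forall j, gaussint (A i j)].

Lemma gaussmxP m n (A : 'M[F]_(m, n)) :
  reflect (forall i j, gaussint (A i j)) (gaussmx A).
Proof.
by apply: (iffP forallP) => [H i j|H i]; [move/forallP: (H i)|apply/forallP].
Qed.

Lemma gaussmxM m n p (A : 'M[F]_(m, n)) (B : 'M[F]_(n, p)) :
  gaussmx A -> gaussmx B -> gaussmx (A *m B).
Proof.
move=> /gaussmxP HA /gaussmxP HB; apply/gaussmxP => i j; rewrite mxE.
by apply: gaussint_sum => k _; apply: gaussintM.
Qed.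

Lemma gaussmxD m n (A B : 'M[F]_(m, n)) :
  gaussmx A -> gaussmx B -> gaussmx (A + B).
Proof.
move=> /gaussmxP HA /gaussmxP HB; apply/gaussmxP => i j; rewrite mxE.
exact: gaussintD.
Qed.

Definition in_SL2 (A : 'M[F]_2) : bool := gaussmx A && (\det A == 1).

Record SL2 := MkSL2 { SL2_val : 'M[F]_2; SL2_valP : in_SL2 SL2_val }.
HB.instance Definition _ := [isSub for SL2_val].
HB.instance Definition _ := [Choice of SL2 by <:].

Fact SL2_mul_proof (A B : SL2) : in_SL2 (val A *m val B).
Proof.
case/andP: (valP A) => gA /eqP dA; case/andP: (valP B) => gB /eqP dB.
by rewrite /in_SL2 gaussmxM //= det_mulmx dA dB mulr1.
Qed.

Fact SL2_one_proof : in_SL2 1%:M.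
Proof.
rewrite /in_SL2 det1 eqxx andbT; apply/gaussmxP => i j; rewrite mxE.
by case: (_ == _).
Qed.

Fact SL2_inv_proof (A : SL2) : in_SL2 (\adj (val A)).
Proof.
case/andP: (valP A) => gA /eqP dA; apply/andP; split.
  apply/gaussmxP => i j; rewrite mxE /cofactor; apply: gaussintM.
    by elim: (_ + _)%N => [|n IH]; rewrite ?expr0 // exprS mulN1r; exact: gaussintN.
  by rewrite det_mx11 !mxE; move/gaussmxP: gA; apply.
have /(congr1 determinant) := mul_mx_adj (val A).
by rewrite det_mulmx dA mul1r det1 => /eqP.
Qed.

Definition SL2_mul A B := MkSL2 (SL2_mul_proof A B).
Definition SL2_one := MkSL2 SL2_one_proof.
Definition SL2_inv A := MkSL2 (SL2_inv_proof A).

Fact SL2_mulA : associative SL2_mul.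
Proof. by move=> A B C; apply: val_inj; rewrite /= mulmxA. Qed.
Fact SL2_mul1 : left_id SL2_one SL2_mul.
Proof. by move=> A; apply: val_inj; rewrite /= mul1mx. Qed.
Fact SL2_1mul : right_id SL2_one SL2_mul.
Proof. by move=> A; apply: val_inj; rewrite /= mulmx1. Qed.
Fact SL2_mulV : left_inverse SL2_one SL2_inv SL2_mul.
Proof.
move=> A; apply: val_inj; rewrite /= mul_adj_mx.
by case/andP: (valP A) => _ /eqP ->.
Qed.
Fact SL2_Vmul : right_inverse SL2_one SL2_inv SL2_mul.
Proof.
move=> A; apply: val_inj; rewrite /= mul_mx_adj.
by case/andP: (valP A) => _ /eqP ->.
Qed.

HB.instance Definition _ :=
  isGroup.Build SL2 SL2_mulA SL2_mul1 SL2_1mul SL2_mulV SL2_Vmul.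

Definition pm_eq (A B : SL2) : bool :=
  (SL2_val A == SL2_val B) || (SL2_val A == - SL2_val B).

Fact pm_eq_equiv : equiv_class_of pm_eq.
Proof.
split=> [A|A B|B A C]; rewrite /pm_eq.
- by rewrite eqxx.
- by rewrite eq_sym; congr (_ || _); rewrite -eqr_oppLR eq_sym.
- by move=> /orP[] /eqP -> /orP[] /eqP ->; rewrite ?opprK eqxx ?orbT.
Qed.

Canonical pm_eq_equiv_rel := EquivRelPack pm_eq_equiv.
Canonical pm_eq_encModRel := defaultEncModRel pm_eq.

Definition PSL2 := {eq_quot pm_eq}.
HB.instance Definition _ := Choice.on PSL2.
HB.instance Definition _ : EqQuotient SL2 pm_eq PSL2 := EqQuotient.on PSL2.

Definition psl (A : SL2) : PSL2 := \pi_PSL2 A.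

Lemma pslP A B : psl A = psl B <-> pm_eq A B.
Proof. by split=> [/eqP|H]; last apply/eqP; rewrite eqmodE. Qed.

Lemma psl_reprK g : psl (repr g) = g.
Proof. exact: reprK. Qed.

Lemma psl_repr A : pm_eq (repr (psl A)) A.
Proof. by apply/pslP; exact: psl_reprK. Qed.

Definition PSL2_mul (g h : PSL2) : PSL2 := psl (repr g * repr h)%g.
Definition PSL2_one : PSL2 := psl 1%g.
Definition PSL2_inv (g : PSL2) : PSL2 := psl (repr g)^-1%g.

Lemma psl_mul A B : PSL2_mul (psl A) (psl B) = psl (A * B)%g.
Proof.
apply/pslP; rewrite /pm_eq /=.
case/orP: (psl_repr A) => /eqP ->; case/orP: (psl_repr B) => /eqP ->;
by rewrite ?(mulmxN, mulNmx) ?opprK eqxx ?orbT.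
Qed.

Lemma psl_inv A : PSL2_inv (psl A) = psl A^-1%g.
Proof.
have adjN (B : 'M[F]_2) : \adj (- B) = - \adj B.
  apply/matrixP => i j; rewrite !mxE /cofactor !det_mx11 !mxE.
  by rewrite mulrN.
apply/pslP; rewrite /pm_eq /=.
by case/orP: (psl_repr A) => /eqP ->; rewrite ?adjN eqxx ?orbT.
Qed.

Fact PSL2_mulA : associative PSL2_mul.
Proof.
move=> f g h; rewrite -(psl_reprK f) -(psl_reprK g) -(psl_reprK h) !psl_mul.
by rewrite mulgA.
Qed.
Fact PSL2_mul1 : left_id PSL2_one PSL2_mul.
Proof. by move=> f; rewrite -(psl_reprK f) psl_mul mul1g. Qed.
Fact PSL2_1mul : right_id PSL2_one PSL2_mul.
Proof. by move=> f; rewrite -(psl_reprK f) psl_mul mulg1. Qed.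
Fact PSL2_mulV : left_inverse PSL2_one PSL2_inv PSL2_mul.
Proof. by move=> f; rewrite -(psl_reprK f) psl_inv psl_mul mulVg. Qed.
Fact PSL2_Vmul : right_inverse PSL2_one PSL2_inv PSL2_mul.
Proof. by move=> f; rewrite -(psl_reprK f) psl_inv psl_mul mulgV. Qed.

HB.instance Definition _ :=
  isGroup.Build PSL2 PSL2_mulA PSL2_mul1 PSL2_1mul PSL2_mulV PSL2_Vmul.

Notation G := PSL2 (only parsing).

(* P^1(F) = F u {oo}; [None] is the cusp oo. *)
Definition cusp := option F.
HB.instance Definition _ := Choice.on cusp.

(* The line F v, for v <> 0. *)
Definition cuspv (v : 'cV[F]_2) : cusp :=
  if v 1 0 == 0 then None else Some (v 0 0 / v 1 0).

Definition hvec (a : cusp) : 'cV[F]_2 :=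
  \col_(i < 2) (if a is Some z then (if i == 0 then z else 1)
                else (if i == 0 then 1 else 0)).

Lemma cuspvZ c v : c != 0 -> cuspv (c *: v) = cuspv v.
Proof.
move=> c0; rewrite /cuspv !mxE mulf_eq0 (negPf c0) /=; case: eqP => // _.
by rewrite -mulf_div divff // mul1r.
Qed.

Lemma hvec_neq0 a : hvec a != 0.
Proof.
apply/eqP => /matrixP H.
by case: a H => [z|] H; [have /eqP := H 1 0|have /eqP := H 0 0]; rewrite !mxE;
  apply/negP/oner_neq0.
Qed.

Lemma hvecK a : cuspv (hvec a) = a.
Proof.
case: a => [z|]; rewrite /cuspv !mxE -[1 == 0 :> 'I_2]/false ?eqxx //.
by rewrite oner_eq0 divr1.
Qed.

Lemma cuspvK v : v != 0 -> exists2 c, c != 0 & v = c *: hvec (cuspv v).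
Proof.
move=> v0; rewrite /cuspv; case: (eqVneq (v 1 0) 0) => v1; last first.
  exists (v 1 0) => //; apply/matrixP => i j; rewrite !mxE ord1.
  case: (eqVneq i 0) => [->|i0]; first by rewrite mulrCA divff // mulr1.
  rewrite mulr1; congr (v _ 0); apply/val_inj => /=.
  by case: i i0 => [[|[|]]].
have i1 (i : 'I_2) : i != 0 -> i = 1.
  by case: i => [[|[|]]] //= ? _; apply: val_inj.
exists (v 0 0).
  apply: contra v0 => /eqP v00; apply/eqP/matrixP => i j; rewrite !mxE ord1.
  by case: (eqVneq i 0) => [->//|/i1->].
apply/matrixP => i j; rewrite !mxE ord1.
by case: (eqVneq i 0) => [->|/i1->]; rewrite ?mulr1 // mulr0.
Qed.

Lemma SL2_inj (A : SL2) (v : 'cV[F]_2) : v != 0 -> val A *m v != 0.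
Proof.
apply: contra => /eqP Av0.
have : val (A^-1 * A)%g *m v = 0 by rewrite /= -mulmxA Av0 mulmx0.
by rewrite mulVg mul1mx => ->.
Qed.

(* Linear fractional action: oo, z |-> (a z + b) / (c z + d). *)
Definition cusp_act (g : G) (a : cusp) : cusp := cuspv (val (repr g) *m hvec a).

Lemma cusp_act_psl A v : v != 0 -> cusp_act (psl A) (cuspv v) = cuspv (val A *m v).
Proof.
move=> v0; have [c c0 Ev] := cuspvK v0; rewrite /cusp_act [in RHS]Ev.
rewrite -scalemxAr cuspvZ //.
case/orP: (psl_repr A) => /eqP /= -> //.
by rewrite mulNmx -scaleN1r cuspvZ // oppr_eq0 oner_eq0.
Qed.

Fact cusp_act1 a : cusp_act 1%g a = a.
Proof.
rewrite -[in LHS](hvecK a) -[1%g]/(psl 1%g) cusp_act_psl ?hvec_neq0 //.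
by rewrite mul1mx hvecK.
Qed.

Fact cusp_actM g h a : cusp_act (g * h)%g a = cusp_act g (cusp_act h a).
Proof.
rewrite -(psl_reprK g) -(psl_reprK h) -[a]hvecK.
rewrite -[(_ * _)%g]/(PSL2_mul _ _) psl_mul !cusp_act_psl ?SL2_inj ?hvec_neq0 //.
by rewrite mulmxA.
Qed.

Definition P1 : gset G := GSet cusp_act1 cusp_actM.

Section ReducedH0.
Variables (Gam : groupType) (T : gset Gam).

Fact deg0_0 : deg (0 : free_gmod T) = 0.
Proof. exact: (raddf0 (@deg T)). Qed.
Fact deg0_B (u v : free_gmod T) : deg u = 0 -> deg v = 0 -> deg (u - v) = 0.
Proof. by move=> du dv; rewrite degB du dv subrr. Qed.
Fact deg0_act g (v : free_gmod T) : deg v = 0 -> deg (g ⊙ v) = 0.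
Proof.
move=> <-; rewrite -[in LHS](freeg_sumE v) -[in RHS](freeg_sumE v).
rewrite [gmod_act _ _]fg_act_sum !raddf_sum; apply: eq_bigr => x _ /=.
by rewrite fg_actU !degU.
Qed.

Definition deg0 : submodule (free_gmod T) := Submodule deg0_0 deg0_B deg0_act.

Fact vdiff_proof (a b : T) : (fgen b - fgen a) \in sm_pred deg0.
Proof. by apply/sm_predP; rewrite /= degB !degU subrr. Qed.

(* [b] - [a] in ker (deg : Z[T] -> Z) *)
Definition vdiff (a b : T) : sub_gmod deg0 := SubElt (vdiff_proof a b).

(* Reduced H_0 of a complex with vertices T and 1-simplices (a, b), E a b. *)
Definition reduced_H0 (E : T -> T -> Prop) : gmodule Gam :=
  quo_gmod (gspan (fun v : sub_gmod deg0 => exists a b, E a b /\ v = vdiff a b)).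

End ReducedH0.

Definition Delta0 : gmodule G := sub_gmod (deg0 P1).

Definition dcusp (a b : P1) : Delta0 := vdiff a b.

(* The Tits building of F^2 is the discrete set P^1(F): no 1-simplices. *)
Definition tits_edge (a b : P1) : Prop := False.

Definition St_F : gmodule G := reduced_H0 tits_edge.

Definition st_class (v : Delta0) : St_F := quo_pi _ v.

Definition gauss_basis (v w : 'cV[F]_2) : Prop :=
  [/\ gaussmx v, gaussmx w &
    forall u : 'cV[F]_2, gaussmx u ->
      exists! ab : F * F,
        [/\ gaussint ab.1, gaussint ab.2 & u = ab.1 *: v + ab.2 *: w]].

Definition gauss_primitive (v : 'cV[F]_2) : Prop :=
  gaussmx v /\
  forall (d : F) (u : 'cV[F]_2), gaussint d -> gaussmx u -> v = d *: u ->
    exists2 d' : F, gaussint d' & d' * d = 1.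

Definition gauss_edge (a b : P1) : Prop :=
  exists v w, [/\ gauss_primitive v, gauss_primitive w, gauss_basis v w,
                  cuspv v = a & cuspv w = b].

Definition gauss_tri (a b c : P1) : Prop :=
  exists v w, [/\ gauss_basis v w, cuspv v = a, cuspv w = b & cuspv (v + w) = c].

Lemma gauss_basis_sym v w : gauss_basis v w -> gauss_basis w v.
Proof.
case=> gv gw H; split=> // u gu; have [[a b] [[/= ga gb Eu] Hu]] := H u gu.
exists (b, a); split; first by split=> //=; rewrite addrC.
move=> [c d] [/= gc gd Ed]; have := Hu (d, c); rewrite /= addrC in Ed.
by move=> /(_ (And3 gd gc Ed)) [-> ->].
Qed.

Lemma gauss_basis_add v w : gauss_basis v w -> gauss_basis w (v + w).
Proof.
case=> gv gw H; split; [by []|exact: gaussmxD|] => u gu.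
have [[a b] [[/= ga gb Eu] Hu]] := H u gu.
exists (b - a, a); split.
  split=> //=; first by apply: gaussintD => //; exact: gaussintN.
  by rewrite Eu scalerBl scalerDr addrACA addNr addr0 addrC.
move=> [c d] [/= gc gd Ed]; have := Hu (d, c + d).
have E : u = d *: v + (c + d) *: w.
  by rewrite Ed scalerDr scalerDl addrCA.
by move=> /(_ (And3 gd (gaussintD gc gd) E)) [-> ->]; rewrite addrK.
Qed.

Lemma gauss_basis_prim v w : gauss_basis v w -> gauss_primitive v.
Proof.
case=> gv gw H; split=> // d u gd gu Ev.
have [[a b] [[/= ga gb Eu] _]] := H u gu.
have [p0 [_ U]] := H v gv; exists a => //.
have E1 : v = (a * d) *: v + (b * d) *: w.
  by rewrite {1}Ev {1}Eu scalerDr !scalerA ![d * _]mulrC.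
have /(U (a * d, b * d)) E2 : [/\ gaussint (a * d), gaussint (b * d) &
    v = (a * d) *: v + (b * d) *: w] by split=> //; exact: gaussintM.
have /(U (1, 0)) E3 : [/\ gaussint 1, gaussint 0 & v = 1 *: v + 0 *: w].
  by split=> //; rewrite scale1r scale0r addr0.
by move: E3; rewrite E2 => -[].
Qed.

Lemma gauss_basis_neq0 v w : gauss_basis v w -> v != 0.
Proof.
case=> gv gw H; apply/eqP => v0; have [p0 [_ U]] := H w gw.
have /(U (0, 1)) E2 : [/\ gaussint 0, gaussint 1 & w = 0 *: v + 1 *: w].
  by split=> //; rewrite scale1r scale0r add0r.
have /(U (1, 1)) : [/\ gaussint 1, gaussint 1 & w = 1 *: v + 1 *: w].
  by split=> //; rewrite v0 scaler0 scale1r add0r.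
by rewrite E2 => -[] /eqP; rewrite eq_sym oner_eq0.
Qed.

Lemma gauss_basis_SL2 (A : SL2) v w :
  gauss_basis v w -> gauss_basis (val A *m v) (val A *m w).
Proof.
case=> gv gw H.
have [/andP[gA _] /andP[gA' _]] := (valP A, valP (A^-1)%g).
have AK (u : 'cV[F]_2) : val A *m (val A^-1%g *m u) = u.
  by rewrite mulmxA (congr1 val (mulgV A) : val A *m val A^-1%g = 1%:M) mul1mx.
have AK' (u : 'cV[F]_2) : val A^-1%g *m (val A *m u) = u.
  by rewrite mulmxA (congr1 val (mulVg A) : val A^-1%g *m val A = 1%:M) mul1mx.
split; [exact: gaussmxM|exact: gaussmxM|] => u gu.
have [[a b] [[/= ga gb Eu] U]] := H _ (gaussmxM gA' gu).
exists (a, b); split.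
  by split=> //=; rewrite -(AK u) Eu mulmxDr -!scalemxAr.
move=> [c d] [/= gc gd Ed]; apply: U; split=> //=.
by rewrite Ed mulmxDr -!scalemxAr !AK'.
Qed.

Lemma gauss_edgeP a b :
  gauss_edge a b <-> exists v w, [/\ gauss_basis v w, cuspv v = a & cuspv w = b].
Proof.
split=> [[v [w [_ _ H Ea Eb]]]|[v [w [H Ea Eb]]]]; exists v, w; split=> //.
  exact: gauss_basis_prim H.
exact: gauss_basis_prim (gauss_basis_sym H).
Qed.

Lemma gauss_edge_act (g : G) a b : gauss_edge a b -> gauss_edge (g • a) (g • b).
Proof.
move=> /gauss_edgeP[v [w [H <- <-]]]; apply/gauss_edgeP.
exists (val (repr g) *m v), (val (repr g) *m w).
split; first exact: gauss_basis_SL2.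
  by rewrite -{2}(psl_reprK g) [RHS]cusp_act_psl // (gauss_basis_neq0 H).
rewrite -{2}(psl_reprK g) [RHS]cusp_act_psl //.
exact: gauss_basis_neq0 (gauss_basis_sym H).
Qed.

Lemma gauss_tri_act (g : G) a b c :
  gauss_tri a b c -> gauss_tri (g • a) (g • b) (g • c).
Proof.
move=> [v [w [H <- <- <-]]].
have nv := gauss_basis_neq0 H; have H' := gauss_basis_sym H.
have nw := gauss_basis_neq0 H'.
have nvw := gauss_basis_neq0 (gauss_basis_sym (gauss_basis_add H)).
exists (val (repr g) *m v), (val (repr g) *m w); rewrite -mulmxDr.
by split; [exact: gauss_basis_SL2|..];
  rewrite -{2}(psl_reprK g) [RHS]cusp_act_psl.
Qed.

Lemma gauss_tri_edges a b c :
  gauss_tri a b c -> [/\ gauss_edge a b, gauss_edge b c & gauss_edge c a].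
Proof.
move=> [v [w [H <- <- <-]]]; split; apply/gauss_edgeP.
- by exists v, w.
- by exists w, (v + w); split=> //; exact: gauss_basis_add.
- exists (v + w), v; split=> //; apply: gauss_basis_sym; rewrite addrC.
  exact/gauss_basis_add/gauss_basis_sym.
Qed.

(* Ordered pairs (alpha, beta): oriented ideal edges. *)
Record oedge := MkOedge { oe_val : P1 * P1;
  oe_valP : `[< gauss_edge oe_val.1 oe_val.2 >] }.
HB.instance Definition _ := [isSub for oe_val].
HB.instance Definition _ := [Choice of oedge by <:].

Fact oe_act_proof (g : G) (e : oedge) :
  `[< gauss_edge (g • (oe_val e).1) (g • (oe_val e).2) >].
Proof. exact/asboolP/gauss_edge_act/asboolP/oe_valP. Qed.

Definition oe_act (g : G) (e : oedge) : oedge :=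
  @MkOedge (g • (oe_val e).1, g • (oe_val e).2) (oe_act_proof g e).

Fact oe_act1 e : oe_act 1%g e = e.
Proof. by apply: val_inj; case: e => [[a b] H]; rewrite /= !cusp_act1. Qed.
Fact oe_actM g h e : oe_act (g * h)%g e = oe_act g (oe_act h e).
Proof. by apply: val_inj; rewrite /= !cusp_actM. Qed.

Definition oedge_gset : gset G := GSet oe_act1 oe_actM.

(* Ordered triples (alpha, beta, gamma), standing for their cyclic order. *)
Record otri := MkOtri { ot_val : P1 * P1 * P1;
  ot_valP : `[< gauss_tri ot_val.1.1 ot_val.1.2 ot_val.2 >] }.
HB.instance Definition _ := [isSub for ot_val].
HB.instance Definition _ := [Choice of otri by <:].

Fact ot_act_proof (g : G) (t : otri) :
  `[< gauss_tri (g • (ot_val t).1.1) (g • (ot_val t).1.2) (g • (ot_val t).2) >].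
Proof. exact/asboolP/gauss_tri_act/asboolP/ot_valP. Qed.

Definition ot_act (g : G) (t : otri) : otri :=
  @MkOtri (g • (ot_val t).1.1, g • (ot_val t).1.2, g • (ot_val t).2)
    (ot_act_proof g t).

Fact ot_act1 t : ot_act 1%g t = t.
Proof.
by apply: val_inj; case: t => [[[a b] c] H]; rewrite /= !cusp_act1.
Qed.
Fact ot_actM g h t : ot_act (g * h)%g t = ot_act g (ot_act h t).
Proof. by apply: val_inj; rewrite /= !cusp_actM. Qed.

Definition otri_gset : gset G := GSet ot_act1 ot_actM.

(* The r-th term of [alpha, beta] + [beta, gamma] + [gamma, alpha]. *)
Definition bedge_val (t : P1 * P1 * P1) (r : 'I_3) : P1 * P1 :=
  nth (t.1.1, t.1.2) [:: (t.1.1, t.1.2); (t.1.2, t.2); (t.2, t.1.1)] r.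

Fact bedge_proof (t : otri) r :
  `[< gauss_edge (bedge_val (ot_val t) r).1 (bedge_val (ot_val t) r).2 >].
Proof.
apply/asboolP; have /asboolP/gauss_tri_edges[] := ot_valP t.
by case: r => [[|[|[]]]].
Qed.

Definition bedge (t : otri) (r : 'I_3) : oedge := MkOedge (bedge_proof t r).

Definition wedge (a b : P1) : F :=
  hvec a 0 0 * hvec b 1 0 - hvec a 1 0 * hvec b 0 0.

(* Imaginary part of the cross-ratio taking a, b, c to 0, 1, oo: its sign is
   the side of the hyperbolic plane through a, b, c on which z lies. *)
Definition side (a b c z : P1) : rat :=
  complex.Im ((wedge z a * wedge b c) / (wedge z c * wedge b a)).

(* Triangular faces of the convex hull of V: triples spanning a plane with all
   other vertices strictly on one side.  The sign of [side] changes when two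
   of a, b, c are exchanged, so one sign suffices. *)
Definition is_face (V T : {fset P1}) : Prop :=
  (T `<=` V)%fset /\
  exists a b c, [/\ T = [fset a; b; c]%fset, #|` T|%fset = 3%N &
    forall z, z \in (V `\` T)%fset -> 0 < side a b c z].

Definition is_edge (V E : {fset P1}) : Prop :=
  #|` E|%fset = 2%N /\ exists2 T, is_face V T & (E `<=` T)%fset.

(* The polyhedra V and V' lie on opposite sides of their face T. *)
Definition opposite_sides (T V V' : {fset P1}) : Prop :=
  exists a b c, [/\ T = [fset a; b; c]%fset, #|` T|%fset = 3%N,
    forall z, z \in (V `\` T)%fset -> 0 < side a b c z &
    forall z, z \in (V' `\` T)%fset -> side a b c z < 0].

(* [oc_sgn s t] is the sign with s = +-t as oriented cells, and 0 if the
   underlying cells differ; [oc_of V] tells the cells of the polyhedron V. *)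
Record ocells := OCells {
  oc_gset :> gset G;
  oc_und : oc_gset -> {fset P1};
  oc_sgn : oc_gset -> oc_gset -> int;
  oc_of : {fset P1} -> {fset P1} -> Prop }.

Definition edge_und (e : oedge) : {fset P1} :=
  [fset (oe_val e).1; (oe_val e).2]%fset.

Definition edge_sgn (e e' : oedge) : int :=
  if oe_val e == oe_val e' then 1
  else if oe_val e == ((oe_val e').2, (oe_val e').1) then -1 else 0.

Definition edges : ocells := @OCells oedge_gset edge_und edge_sgn is_edge.

Definition tri_und (t : otri) : {fset P1} :=
  [fset (ot_val t).1.1; (ot_val t).1.2; (ot_val t).2]%fset.

Definition tri_sgn (t t' : otri) : int :=
  let: (a, b, c) := ot_val t' in
  if ot_val t \in [:: (a, b, c); (b, c, a); (c, a, b)] then 1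
  else if ot_val t \in [:: (b, a, c); (a, c, b); (c, b, a)] then -1 else 0.

Definition triangles : ocells := @OCells otri_gset tri_und tri_sgn is_face.

(* The group generated by the oriented cells, t = +-t' whenever t and t' are
   two orientations (or two writings) of the same cell. *)
Variant orient_rel (T : ocells) : free_gmod T -> Prop :=
| OrientRel (t t' : T) : oc_sgn t t' != 0 ->
    orient_rel (fgen t - fgen t' *~ oc_sgn t t').

Definition chains (T : ocells) : gmodule G := quo_gmod (gspan (@orient_rel T)).

Definition chain (T : ocells) (t : T) : chains T :=
  quo_pi (gspan (@orient_rel T)) (fgen t).

Notation C1_id := (chains edges) (only parsing).
Notation C2_id := (chains triangles) (only parsing).

Notation "g •• A" := (fset_act g A) (at level 38, right associativity)
  : gset_scope.

Definition ii : F := Complex 0 1.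

Definition octahedron : 6.-tuple P1 :=
  [tuple None; Some 0; Some 1; Some ii; Some (1 + ii); Some ((1 + ii) / 2%:R)].

Definition verts (O : 6.-tuple P1) : {fset P1} := [fset z | z in (O : seq P1)]%fset.

Notation Oct := (verts octahedron).

(* K = Stab_G(O) *)
Definition Kgrp (g : G) : Prop := g •• Oct = Oct.

Definition mx22 (a b c d : F) : 'M[F]_2 :=
  \matrix_(i < 2, j < 2)
    if i == 0 then (if j == 0 then a else b) else (if j == 0 then c else d).

Lemma mx22_SL2 a b c d :
  gaussint a -> gaussint b -> gaussint c -> gaussint d -> a * d - b * c = 1 ->
  in_SL2 (mx22 a b c d).
Proof.
move=> ga gb gc gd E; apply/andP; split.
  by apply/gaussmxP => i j; rewrite mxE; do 2!case: (_ == 0).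
rewrite (expand_det_row _ 0) big_ord_recl big_ord1 /cofactor !det_mx11 !mxE /=.
by rewrite !mul1r mulN1r mulrN E.
Qed.

Fact matS_proof : in_SL2 (mx22 0 (-1) 1 0).
Proof. by apply: mx22_SL2. Qed.
Fact matR_proof : in_SL2 (mx22 0 ii ii 0).
Proof. by apply: mx22_SL2. Qed.
Fact matX_proof : in_SL2 (mx22 1 (-1) 1 0).
Proof. by apply: mx22_SL2. Qed.
Fact matY_proof : in_SL2 (mx22 (-1) ii ii 0).
Proof. by apply: mx22_SL2. Qed.

Definition gS : G := psl (MkSL2 matS_proof).
Definition gR : G := psl (MkSL2 matR_proof).
Definition gX : G := psl (MkSL2 matX_proof).
Definition gY : G := psl (MkSL2 matY_proof).

Definition F_R : {fset P1} := [fset (Some 0 : P1); Some 1; None]%fset.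
Definition F_S : {fset P1} := [fset (Some ii : P1); Some 0; None]%fset.

(* The octahedral data of a symbol: no reference to the twelve Picard cells of
   an octahedron is made here.  For an occurrence x and a stored face F of the
   standard octahedron, representing a J_x-orbit of faces, the paired face is
   the face [oc_face x F] of the occurrence [oc_tgt x F], through the transport
   [oc_q x F]; these three maps are only relevant on stored faces. *)
Record octdata := OctData {
  occ : finType;
  oc_g : occ -> G;
  oc_oct : occ -> 6.-tuple P1;
  oc_Jhat : occ -> subgroup G;
  oc_stored : occ -> {fset {fset P1}};
  oc_tgt : occ -> {fset P1} -> occ;
  oc_face : occ -> {fset P1} -> {fset P1};
  oc_q : occ -> {fset P1} -> G }.

(* J_x = g_x^-1 Jhat_x g_x *)
Definition Jloc (D : octdata) (x : occ D) (j : G) : Prop :=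
  oc_Jhat x (oc_g x * j * (oc_g x)^-1)%g.
Arguments Jloc : clear implicits.
Arguments Jloc {D} x j.

(* q F1 = bar F' *)
Definition pairs_faces (q : G) (F1 F' : {fset P1}) : Prop :=
  q •• F1 = F' /\ opposite_sides F' (q •• Oct) Oct.

Definition occ_adj (D : octdata) : rel (occ D) := fun x y =>
  has (fun f => oc_tgt x f == y) (oc_stored x).

Record candidate (D : octdata) : Prop := Candidate {
  cand_oct : forall x : occ D,
    oc_oct x = map_tuple (gset_act (oc_g x)) octahedron;
  cand_Jhat : forall (x : occ D) j,
    oc_Jhat x j -> j •• verts (oc_oct x) = verts (oc_oct x);
  cand_stored : forall (x : occ D) f, f \in oc_stored x -> is_face Oct f;
  cand_orbits : forall (x : occ D) f, is_face Oct f ->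
    exists! f1, f1 \in oc_stored x /\ exists2 j, Jloc x j & j •• f1 = f;
  cand_face : forall (x : occ D) f, f \in oc_stored x ->
    is_face Oct (oc_face x f);
  cand_pair : forall (x : occ D) f, f \in oc_stored x ->
    pairs_faces (oc_q x f) f (oc_face x f);
  cand_stab : forall (x : occ D) f, f \in oc_stored x -> forall g : G,
    (Jloc x g /\ g •• f = f) <->
    let g' := (oc_q x f * g * (oc_q x f)^-1)%g in
    Jloc (oc_tgt x f) g' /\ g' •• oc_face x f = oc_face x f;
  cand_invol : forall (x : occ D) f, f \in oc_stored x ->
    let y := oc_tgt x f in
    exists j j', [/\ Jloc x j, Jloc y j' &
      let f' := j' •• oc_face x f in
      [/\ f' \in oc_stored y, oc_tgt y f' = x, oc_face y f' = j •• f &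
          oc_q y f' = (j * (oc_q x f)^-1 * j'^-1)%g]];
  cand_conn : forall x y : occ D, connect (@occ_adj D) x y }.

Definition coset_pred (L : G -> Prop) (k : G) : G -> Prop :=
  fun g => exists2 j, L j & g = (j * k)%g.

(* C_Sigma = disjoint union of the J_x \ K *)
Definition picard_cell (D : octdata) :=
  {c : occ D * (G -> Prop) |
    exists2 k, Kgrp k & c.2 = coset_pred (Jloc c.1) k}.

(* c = J_x k *)
Definition cell_at (D : octdata) (x : occ D) (k : G) (c : picard_cell D) : Prop :=
  Kgrp k /\ sval c = (x, coset_pred (Jloc x) k).

Record symbol := Symbol { sym_oct :> octdata; sym_mark : picard_cell sym_oct }.

Variant gen := genS | genR | genX | genY.

Definition gen_val (l : gen) : G :=
  match l with genS => gS | genR => gR | genX => gX | genY => gY end.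

Definition step_in (D : octdata) (t : G) (c c' : picard_cell D) : Prop :=
  exists x k, cell_at x k c /\ cell_at x (k * t)%g c'.

Definition step_across (D : octdata) (t : G) (f : {fset P1})
    (c c' : picard_cell D) : Prop :=
  exists x k, [/\ cell_at x k c, k •• f \in oc_stored x &
    cell_at (oc_tgt x (k •• f)) (oc_q x (k •• f) * k * t^-1)%g c'].

Definition step (D : octdata) (l : gen) : picard_cell D -> picard_cell D -> Prop :=
  match l with
  | genX => step_in gX
  | genY => step_in gY
  | genR => step_across gR F_R
  | genS => step_across gS F_S
  end.

(* Words in the generators; the boolean marks inverse letters. *)
Definition word := seq (gen * bool).

Definition letter_val (a : gen * bool) : G :=
  if a.2 then (gen_val a.1)^-1%g else gen_val a.1.

Definition word_val (w : word) : G := foldr (fun a g => letter_val a * g)%g 1%g w.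

Definition letter_act (D : octdata) (a : gen * bool) (c c' : picard_cell D) :=
  if a.2 then step a.1 c' c else step a.1 c c'.

(* c . w = c', letters acting from left to right (right action). *)
Fixpoint word_act (D : octdata) (w : word) (c c' : picard_cell D) : Prop :=
  if w is a :: w' then exists2 d, letter_act a c d & word_act w' d c'
  else c = c'.

Definition relators : seq word :=
  let s := (genS, false) in let r := (genR, false) in
  let x := (genX, false) in let y := (genY, false) in
  [:: [:: s; s]; [:: r; r]; [:: r; s; r; s]; [:: x; x; x]; [:: r; x; r; x];
      [:: y; y; y]; [:: (genX, true); y; (genX, true); y]; [:: s; y; s; y]].

Record valid (Sg : symbol) : Prop := Valid {
  valid_cand : candidate Sg;
  valid_total : forall l (c : picard_cell Sg), exists! c', step l c c';
  valid_bij : forall l (c' : picard_cell Sg), exists! c, step l c c';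
  valid_rel : forall n, (n < size relators)%N ->
    forall c : picard_cell Sg, word_act (nth [::] relators n) c c;
  valid_trans : forall c c' : picard_cell Sg, exists w, word_act w c c' }.

Section Reconstruction.
Variable Sg : symbol.

(* Stab_G(c_0), where g acts through any word representing it. *)
Definition stab_mark (g : G) : Prop :=
  exists2 w, word_val w = g & word_act w (sym_mark Sg) (sym_mark Sg).

Lemma word_val_cat w w' : word_val (w ++ w') = (word_val w * word_val w')%g.
Proof. by elim: w => [|a w IH] /=; rewrite ?mul1g // IH mulgA. Qed.

Lemma word_act_cat (D : octdata) w w' (c d e : picard_cell D) :
  word_act w c d -> word_act w' d e -> word_act (w ++ w') c e.
Proof.
by elim: w c => [|a w IH] c /= => [->//|[b cb bd] de]; exists b => //; exact: IH de.
Qed.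

Definition word_inv (w : word) : word := rev [seq (a.1, ~~ a.2) | a <- w].

Lemma word_inv_cons a w : word_inv (a :: w) = word_inv w ++ [:: (a.1, ~~ a.2)].
Proof. by rewrite /word_inv /= rev_cons cats1. Qed.

Lemma word_val_inv w : word_val (word_inv w) = (word_val w)^-1%g.
Proof.
elim: w => [|[l b] w IH]; first by rewrite /= invg1.
rewrite word_inv_cons word_val_cat IH /= mulg1 invgM; congr (_ * _)%g.
by case: b; rewrite /letter_val /= ?invgK.
Qed.

Lemma word_act_inv (D : octdata) w (c d : picard_cell D) :
  word_act w c d -> word_act (word_inv w) d c.
Proof.
elim: w c => [|[l b] w IH] c /= => [->//|[e ce ed]].
rewrite word_inv_cons; apply: word_act_cat (IH _ ed) _.
by exists c => //; move: ce; rewrite /letter_act; case: b.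
Qed.

Fact stab_mark1 : stab_mark 1%g.
Proof. by exists [::]. Qed.

Fact stab_markM g h : stab_mark g -> stab_mark h -> stab_mark (g * h)%g.
Proof.
move=> [w <- cw] [w' <- cw']; exists (w ++ w'); first exact: word_val_cat.
exact: word_act_cat cw cw'.
Qed.

Fact stab_markV g : stab_mark g -> stab_mark g^-1%g.
Proof.
move=> [w <- cw]; exists (word_inv w); first exact: word_val_inv.
exact: word_act_inv.
Qed.

Definition Hsym : subgroup G := Subgroup stab_mark1 stab_markM stab_markV.

(* The positions a such that the marked octahedron occurs as a O_x in the
   tessellation developed from the marking: for c_0 = J_x k one has
   a g_x = k^-1. *)
Definition base_position (x : occ Sg) (a : G) : Prop :=
  exists2 k, cell_at x k (sym_mark Sg) & a = (k^-1 * (oc_g x)^-1)%g.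

End Reconstruction.

Section Octahedral.
Variable D : octdata.

(* The face transport in recorded coordinates: it carries the face g_x f of
   O_x to the paired face g_y f' of O_y. *)
Definition transport (x : occ D) (f : {fset P1}) : G :=
  (oc_g (oc_tgt x f) * oc_q x f * (oc_g x)^-1)%g.

(* [transp x s t y u]: t carries the ideal cell s of O_x to the cell u of O_y
   and is a composite of elements of the local groups Jhat and of face
   transports across faces containing the cell. *)
Inductive transp (x : occ D) (s : {fset P1}) : G -> forall y : occ D, {fset P1} -> Prop :=
| TranspId : transp x s 1%g x s
| TranspLocal t y u j : transp x s t y u -> oc_Jhat y j ->
    transp x s (j * t)%g y (j •• u)
| TranspFace t y u f : transp x s t y u -> f \in oc_stored y ->
    (u `<=` oc_g y •• f)%fset ->
    transp x s (transport y f * t)%g (oc_tgt y f) (transport y f •• u).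

Variable base : occ D -> G -> Prop.

(* Developing the occurrences from the base positions by local groups and face
   transports: [placed x a] says that the occurrence x is developed as a O_x. *)
Inductive placed : occ D -> G -> Prop :=
| PlacedBase x a : base x a -> placed x a
| PlacedLocal x a j : placed x a -> oc_Jhat x j -> placed x (a * j)%g
| PlacedFace x a f : placed x a -> f \in oc_stored x ->
    placed (oc_tgt x f) (a * (transport x f)^-1)%g.

(* Developed representatives, one for each class of recorded cells under
   transport. *)
Record local_reps (T : ocells) (I : finType) := LocalReps {
  lr_occ : I -> occ D;
  lr_pos : I -> G;
  lr_cell : I -> T;
  lr_of : forall i, oc_of T (verts (oc_oct (lr_occ i))) (oc_und (lr_cell i));
  lr_placed : forall i, placed (lr_occ i) (lr_pos i);
  lr_unique : forall (y : occ D) (u : T), oc_of T (verts (oc_oct y)) (oc_und u) ->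
    exists! i, exists t,
      transp (lr_occ i) (oc_und (lr_cell i)) t y (oc_und u) }.

Definition lr_rep (T : ocells) (I : finType) (E : local_reps T I) (i : I) : T :=
  lr_pos E i • lr_cell E i.

End Octahedral.

Section GroupCells.
Variables (H : subgroup G) (T : ocells).

(* One oriented representative for each H-orbit of underlying cells. *)
Definition orbit_reps (I : finType) (sigma : I -> T) : Prop :=
  forall tau : T, exists! i, exists2 h, H h &
    h •• oc_und (sigma i) = oc_und tau.

Definition cstab (sigma : T) : sg_type H -> Prop :=
  fun h => val h •• oc_und sigma = oc_und sigma.

Definition ceps (sigma : T) : sg_type H -> int :=
  fun h => oc_sgn (val h • sigma) sigma.

(* Ind_{H_sigma}^H Z_{eps_sigma} *)
Definition Ind (sigma : T) : gmodule (sg_type H) :=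
  induced (cstab sigma) (ceps sigma).

Definition ind_sum (I : finType) (sigma : I -> T) : gmodule (sg_type H) :=
  dsum (fun i => Ind (sigma i)).

Definition ind_in (I : finType) (sigma : I -> T) (i : I) (v : Ind (sigma i)) :
    ind_sum sigma :=
  @dsum_in _ _ (fun i => Ind (sigma i)) i v.

(* v in V^{H_sigma, eps_sigma} *)
Definition twisted_inv (V : gmodule (sg_type H)) (sigma : T) (v : V) : Prop :=
  forall h, cstab sigma h -> h ⊙ v = v *~ ceps sigma h.

End GroupCells.

Arguments ind_in {H T I} sigma i v.

Section Incidence.
Variables (D : octdata) (base : occ D -> G -> Prop) (H : subgroup G).
Variables (I J : finType).
Variables (E : local_reps base edges I) (Fc : local_reps base triangles J).

(* Incidence data read off the transports from the recorded edge
   representatives to the boundary edges of the recorded faces. *)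
Record incidence := Incidence {
  inc_edge : J -> 'I_3 -> I;
  inc_h : J -> 'I_3 -> sg_type H;
  inc_sgn : J -> 'I_3 -> int;
  inc_ok : forall j r, let i := inc_edge j r in
    exists t, [/\
      transp (lr_occ E i) (edge_und (lr_cell E i)) t
             (lr_occ Fc j) (edge_und (bedge (lr_cell Fc j) r)),
      val (inc_h j r) = (lr_pos Fc j * t * (lr_pos E i)^-1)%g &
      inc_sgn j r = edge_sgn (bedge (lr_cell Fc j) r) (oe_act t (lr_cell E i))] }.

Variable inc : incidence.

Definition relation_map (V : gmodule (sg_type H)) (v : I -> V) (j : J) : V :=
  \sum_(r < 3) (inc_h inc j r ⊙ v (inc_edge inc j r)) *~ inc_sgn inc j r.

Definition edge_gen (i : I) (h : sg_type H) : ind_sum H (lr_rep E) :=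
  ind_in (lr_rep E) i (tensor (zg h) 1).

Definition face_gen (j : J) (h : sg_type H) : ind_sum H (lr_rep Fc) :=
  ind_in (lr_rep Fc) j (tensor (zg h) 1).

(* The maps of the induced presentation, on the generators h (x) 1. *)
Definition presentation_maps (D2 : ind_sum H (lr_rep Fc) -> ind_sum H (lr_rep E))
    (D1 : ind_sum H (lr_rep E) -> gres H St_F) : Prop :=
  [/\ is_ghom D2, is_ghom D1,
    forall j h, D2 (face_gen j h) =
      \sum_(r < 3) edge_gen (inc_edge inc j r) (h * inc_h inc j r)%g *~ inc_sgn inc j r &
    forall i h, D1 (edge_gen i h) =
      h ⊙ (st_class (dcusp (oe_val (lr_rep E i)).1 (oe_val (lr_rep E i)).2)
             : gres H St_F)].

End Incidence.

Section ChangeReps.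
Variables (H : subgroup G) (T : ocells) (I I' : finType).
Variables (sigma : I -> T) (sigma' : I' -> T).

(* If h sigma_i = s sigma'_{pi i} with s = +-1, the canonical isomorphism sends
   a (x) n to a h^-1 (x) s n; it does not depend on the choice of h. *)
Definition canonical_iso (pi : I -> I')
    (phi : forall i, Ind H (sigma i) -> Ind H (sigma' (pi i))) : Prop :=
  bijective pi /\
  forall i, [/\ is_ghom (phi i), bijective (phi i),
    exists h : sg_type H, val h •• oc_und (sigma i) = oc_und (sigma' (pi i)) &
    forall h : sg_type H, val h •• oc_und (sigma i) = oc_und (sigma' (pi i)) ->
    forall a n, phi i (tensor a n) =
      tensor (rmulZ h^-1%g a) (oc_sgn (val h • sigma i) (sigma' (pi i)) * n)].

Definition sum_iso (pi : I -> I')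
    (phi : forall i, Ind H (sigma i) -> Ind H (sigma' (pi i)))
    (u : ind_sum H sigma) : ind_sum H sigma' :=
  \sum_i ind_in sigma' (pi i) (phi i ((u : dsum_type _) i)).

End ChangeReps.

Section Determined.
Variable Sg : symbol.
Let D : octdata := Sg.
Let base := @base_position Sg.
Let H := Hsym Sg.

(* The developed positions of an occurrence form one coset H a. *)
Definition determines_group : Prop :=
  (forall x : occ D, exists a, placed base x a) /\
  (forall (x : occ D) a h, placed base x a -> (H h <-> placed base x (h * a)%g)).

Definition determines_orbits (T : ocells) : Prop :=
  [/\ forall tau : T, exists (x : occ D) (a : G) (s : T),
        [/\ placed base x a, oc_of T (verts (oc_oct x)) (oc_und s) & tau = a • s],
      forall (x y : occ D) (a b : G) (s u : T),
        placed base x a -> oc_of T (verts (oc_oct x)) (oc_und s) ->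
        placed base y b -> oc_of T (verts (oc_oct y)) (oc_und u) ->
        (exists2 h, H h & oc_sgn (h • a • s) (b • u) = 1) <->
        (exists2 t, transp x (oc_und s) t y (oc_und u) & oc_sgn (t • s) u = 1),
      exists I : finType, inhabited (local_reps base T I),
      forall (I : finType) (E : local_reps base T I), orbit_reps H (lr_rep E) &
      forall (I : finType) (sigma : I -> T), orbit_reps H sigma ->
        exists E : local_reps base T I, lr_rep E = sigma].

(* All elements of H carrying one developed cell to another. *)
Definition determines_transports (T : ocells) : Prop :=
  forall (x y : occ D) (a b : G) (s u : T),
    placed base x a -> oc_of T (verts (oc_oct x)) (oc_und s) ->
    placed base y b -> oc_of T (verts (oc_oct y)) (oc_und u) ->
    forall h : G,
      (H h /\ h •• a •• oc_und s = b •• oc_und u) <->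
      (exists2 t, transp x (oc_und s) t y (oc_und u) & h = (b * t * a^-1)%g).

Definition determines_stabilizers (T : ocells) : Prop :=
  forall (I : finType) (E : local_reps base T I) (i : I) (h : sg_type H),
    (cstab (lr_rep E i) h <->
      exists2 t, transp (lr_occ E i) (oc_und (lr_cell E i)) t
                        (lr_occ E i) (oc_und (lr_cell E i)) &
        val h = (lr_pos E i * t * (lr_pos E i)^-1)%g) /\
    (forall t, transp (lr_occ E i) (oc_und (lr_cell E i)) t
                      (lr_occ E i) (oc_und (lr_cell E i)) ->
        val h = (lr_pos E i * t * (lr_pos E i)^-1)%g ->
        ceps (lr_rep E i) h = oc_sgn (t • lr_cell E i) (lr_cell E i)).

(* d2 f_j = sum_r eta_jr h_jr e_i(j,r), term by term along the boundary. *)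
Definition determines_incidence (d2 : chains triangles -> chains edges) : Prop :=
  forall (I J : finType) (E : local_reps base edges I)
         (Fc : local_reps base triangles J),
    inhabited (incidence H E Fc) /\
    forall inc : incidence H E Fc,
      (forall j r, [/\ inc_sgn inc j r = 1 \/ inc_sgn inc j r = -1,
         chain (bedge (lr_rep Fc j) r : edges) =
           (val (inc_h inc j r) ⊙ chain (lr_rep E (inc_edge inc j r)))
             *~ inc_sgn inc j r &
         forall i, (exists t, transp (lr_occ E i) (edge_und (lr_cell E i)) t
             (lr_occ Fc j) (edge_und (bedge (lr_cell Fc j) r))) ->
           i = inc_edge inc j r]) /\
      (forall j, d2 (chain (lr_rep Fc j)) =
        \sum_(r < 3) (val (inc_h inc j r) ⊙ chain (lr_rep E (inc_edge inc j r)))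
             *~ inc_sgn inc j r).

Definition determines_presentation : Prop :=
  forall (I J : finType) (E : local_reps base edges I)
         (Fc : local_reps base triangles J) (inc : incidence H E Fc),
    exists D2 D1, [/\ presentation_maps inc D2 D1, exact_at D2 D1 & surjective D1].

(* V^{H_e,eps_e} and delta_H; Symb_H(V) = ker delta_H by Phi |-> (Phi (d1 e_i))_i. *)
Definition determines_symbols : Prop :=
  forall (I J : finType) (E : local_reps base edges I)
         (Fc : local_reps base triangles J) (inc : incidence H E Fc)
         (V : gmodule (sg_type H)),
    let d1e i : gres H Delta0 :=
      dcusp (oe_val (lr_rep E i)).1 (oe_val (lr_rep E i)).2 in
    [/\ forall v : I -> V, (forall i, twisted_inv (lr_rep E i) (v i)) ->
          forall j, twisted_inv (lr_rep Fc j) (relation_map inc v j),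
        forall Phi : gres H Delta0 -> V, is_ghom Phi ->
          (forall i, twisted_inv (lr_rep E i) (Phi (d1e i))) /\
          (forall j, relation_map inc (fun i => Phi (d1e i)) j = 0) &
        forall v : I -> V, (forall i, twisted_inv (lr_rep E i) (v i)) ->
          (forall j, relation_map inc v j = 0) ->
          exists! Phi : gres H Delta0 -> V,
            is_ghom Phi /\ forall i, Phi (d1e i) = v i].

Definition canonical_cells (T : ocells) : Prop :=
  forall (I I' : finType) (sigma : I -> T) (sigma' : I' -> T),
    orbit_reps H sigma -> orbit_reps H sigma' ->
    exists pi phi, @canonical_iso H T I I' sigma sigma' pi phi.

Definition canonical_presentation : Prop :=
  forall (I J I' J' : finType)
    (E : local_reps base edges I) (Fc : local_reps base triangles J)
    (E' : local_reps base edges I') (Fc' : local_reps base triangles J')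
    (inc : incidence H E Fc) (inc' : incidence H E' Fc')
    D2 D1 D2' D1' pi phi rho psi,
    presentation_maps inc D2 D1 -> presentation_maps inc' D2' D1' ->
    @canonical_iso H edges I I' (lr_rep E) (lr_rep E') pi phi ->
    @canonical_iso H triangles J J' (lr_rep Fc) (lr_rep Fc') rho psi ->
    (forall u, D1' (sum_iso phi u) = D1 u) /\
    (forall u, D2' (sum_iso psi u) = sum_iso phi (D2 u)).

End Determined.

(* Main.v *)
(* Every cusp a/c other than oo has a neighbour in the Farey graph of Z[i] with
   smaller |c|, and all such neighbours are joined through triangles at a/c whose
   third vertices also have smaller denominators: under a Moebius map taking a/c
   to oo, they are the Gaussian integers in an open unit disc, and these are
   connected by unit steps.  By descent, a flat cocycle on the edges is the
   coboundary of a function on the cusps.  With values in C_1 / im d_2 this gives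
   exactness; with values in a set acted upon by the presented group, transported
   along edges and triangles, it shows that the action descends to G, so that a
   valid symbol carries a map from G to its cells.  Its fibres are the cosets of
   H, and the octahedron at g is an occurrence placed at a position of one coset
   H a.  Any two octahedra containing an ideal edge or face are joined by crossing
   faces through it, hence the transports are exactly the elements of H between
   developed cells, and orbits, stabilisers, signs and incidences follow.  The
   chains are then the sums of the modules induced from orbit representatives. *)
Require Import Defs.
From mathcomp Require Import all_boot all_order all_algebra finmap complex freeg boolp.
From mathcomp Require Import ring lra zify.

Set Implicit Arguments.
Unset Strict Implicit.
Unset Printing Implicit Defensive.

Import Order.TTheory GRing.Theory Num.Theory.

Local Open Scope ring_scope.
Local Open Scope gset_scope.

(** * Gaussian integers *)

(** No presentation of G is taken for granted: a valid symbol only provides permutations satisfying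
    the eight relators, and that these relators suffice is proved along the way. This is why the
    cocycle lemma takes values in a bare type. A cusp determines an element of G only up to the
    stabiliser of oo, so a frame [sel al] is chosen at each cusp and values are read in that frame.
    The stabiliser, all z |-> z + k and z |-> -z + k, must therefore act first: through the words X
    S and Y R for the translations by 1 and i, and R S for z |-> -z. What remains is that the
    stabiliser of an oriented edge acts compatibly with S, and that each triangle (oo, 0, u), u a
    unit, closes up. The octahedral geometry enters as a finite computation: the faces are
    translates of [F_R] and [F_S] by words in X and Y, so that every change of octahedron is a
    product of elements of K and of R, S. Denominators can be lowered because the covering radius
    1/sqrt 2 of Z[i] is less than 1, which puts a lattice point in every open unit disc. *)

Definition nsq (z : F) : rat := complex.Re z ^+ 2 + complex.Im z ^+ 2.

Lemma nsqM x y : nsq (x * y) = nsq x * nsq y.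
Proof. by case: x y => [a b] [c d]; rewrite /nsq /=; ring. Qed.

Lemma nsqN x : nsq (- x) = nsq x.
Proof. by case: x => a b; rewrite /nsq /= !sqrrN. Qed.

Lemma nsq_ge0 z : 0 <= nsq z.
Proof. by rewrite addr_ge0 ?sqr_ge0. Qed.

Lemma nsq_eq0 z : (nsq z == 0) = (z == 0).
Proof.
case: z => a b; rewrite /nsq /= paddr_eq0 ?sqr_ge0 // !sqrf_eq0.
by rewrite eq_complex.
Qed.

Lemma gaussintP z :
  reflect (exists m n : int, z = Complex m%:~R n%:~R) (gaussint z).
Proof.
apply: (iffP andP) => [[/intrP[m Em] /intrP[n En]]|[m [n ->]]]; last first.
  by rewrite /= !intr_int.
by exists m, n; rewrite -Em -En; case: z {Em En}.
Qed.

Lemma gaussint_nsq z : gaussint z -> exists n : nat, nsq z = n%:R.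
Proof.
move=> /gaussintP[m [n ->]]; exists `|(m ^+ 2 + n ^+ 2)%R|%N.
rewrite -[RHS]/(Posz _)%:~R gez0_abs ?addr_ge0 ?sqr_ge0 //.
by rewrite rmorphD /= !rmorphXn.
Qed.

(** Rounding each coordinate leaves an error of at most 1/2, hence a norm of at most 1/2. *)
Lemma gauss_round z : exists2 k, gaussint k & nsq (z - k) < 1.
Proof.
have H (x : rat) : exists m : int, - (1 / 2) <= x - m%:~R <= 1 / 2.
  exists (Num.floor (x + 1 / 2)); have /andP[] := floor_itv (x + 1 / 2).
  rewrite intrD /=; lra.
case: z => a b; have [m Hm] := H a; have [n Hn] := H b.
exists (Complex m%:~R n%:~R); first by apply/gaussintP; exists m, n.
rewrite /nsq /=; nra.
Qed.

Lemma complex_eqE (R : Type) (a b c d : R) : a = c -> b = d -> Complex a b = Complex c d.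
Proof. by move=> -> ->. Qed.

Definition gunits : seq F := [:: 1; -1; ii; - ii].

Lemma gunitsP u : reflect (gaussint u /\ nsq u = 1) (u \in gunits).
Proof.
apply: (iffP idP).
  by rewrite !inE => /or4P[] /eqP ->.
move=> [/gaussintP[m [n ->]]]; rewrite /nsq /= => E.
have {}E : m ^+ 2 + n ^+ 2 = 1.
  by apply/eqP; rewrite -(eqr_int rat) rmorphD /= !rmorphXn /= E.
have : (m, n) \in ([:: (1, 0); (-1, 0); (0, 1); (0, -1)] : seq (int * int)).
  have m1 : -1 <= m <= 1 by nia.
  have n1 : -1 <= n <= 1 by nia.
  have : m = 0 \/ m = 1 \/ m = -1 by lia.
  have : n = 0 \/ n = 1 \/ n = -1 by lia.
  by case=> [|[]] ?; case=> [|[]] ?; subst m n; move: E.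
by rewrite !inE => /or4P[] /eqP [-> ->]; apply/or4P;
  [apply: Or41|apply: Or42|apply: Or43|apply: Or44].
Qed.

Lemma gunits_mul1 u v : gaussint u -> gaussint v -> u * v = 1 -> u \in gunits.
Proof.
move=> gu gv uv; apply/gunitsP; split=> //.
have [m Em] := gaussint_nsq gu; have [n En] := gaussint_nsq gv.
have /eqP : nsq u * nsq v = 1 by rewrite -nsqM uv; apply/eqP; vm_compute.
by rewrite Em En -natrM pnatr_eq1 muln_eq1 => /andP[/eqP ->].
Qed.

(* Lattice points in an open unit disc are connected by unit steps: if the
   opposite corners k, k' of a unit square are in it, so is one of the other
   two, by the British flag theorem. *)
Lemma gauss_disc z k k' : gaussint k -> gaussint k' ->
  nsq (z - k) < 1 -> nsq (z - k') < 1 ->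
  [\/ k = k', k' - k \in gunits | exists l, [/\ gaussint l, nsq (z - l) < 1,
      l - k \in gunits & k' - l \in gunits]].
Proof.
move=> /gaussintP[a [b ->]] /gaussintP[c [d ->]] H1 H2.
have [m Ec] : exists m, c = a + m by exists (c - a); ring.
have [n Ed] : exists n, d = b + n by exists (d - b); ring.
move: H2; rewrite {}Ec {}Ed {c d} => H2; move: H2.
rewrite !intrD; move: H1; case: z => x y; rewrite /nsq /= => H1 H2.
have U p q : (p : int) ^+ 2 + (q : int) ^+ 2 = 1 -> Complex (p%:~R) (q%:~R) \in gunits.
  move=> E; apply/gunitsP; split; first by apply/gaussintP; exists p, q.
  by rewrite /nsq /= -!rmorphXn -rmorphD /= E.
have U1 p q z : p ^+ 2 + q ^+ 2 = 1 -> z = Complex (p%:~R) (q%:~R) -> z \in gunits.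
  by move=> E ->; exact: U.
(* By the parallelogram law, |k - k'|^2 <= 2|z - k|^2 + 2|z - k'|^2 < 4. *)
have lt4 : m ^+ 2 + n ^+ 2 < 4.
  rewrite -(ltr_int rat) rmorphD /= !rmorphXn /=.
  move: H1 H2; move: (m%:~R) (n%:~R) (a%:~R) (b%:~R) => m' n' a' b'.
  have := sqr_ge0 ((x - a') + (x - (a' + m'))).
  have := sqr_ge0 ((y - b') + (y - (b' + n'))); nra.
have m1 : -1 <= m <= 1 by nia.
have n1 : -1 <= n <= 1 by nia.
have [E0|h0] := eqVneq (m ^+ 2 + n ^+ 2) 0.
  have [-> ->] : m = 0 /\ n = 0 by nia.
  by apply: Or31; rewrite !addr0.
have [E1|h1] := eqVneq (m ^+ 2 + n ^+ 2) 1.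
  apply: Or32; apply: (U1 m n) => //.
  by apply: complex_eqE; rewrite /=; ring.
apply: Or33.

(* Only opposite corners of a unit square are left. *)
have [em en] : m ^+ 2 = 1 /\ n ^+ 2 = 1 by nia.
have Q : ((x - (a%:~R + m%:~R)) ^+ 2 + (y - b%:~R) ^+ 2 < 1) \/
         ((x - a%:~R) ^+ 2 + (y - (b%:~R + n%:~R)) ^+ 2 < 1).
  move: H1 H2; move: (m%:~R) (n%:~R) (a%:~R) (b%:~R) => m' n' a' b' H1 H2.
  have [|h] := ltP ((x - (a' + m')) ^+ 2 + (y - b') ^+ 2) 1; first by left.
  right; nra.
case: Q => Q.
- exists (Complex (a%:~R + m%:~R) b%:~R); split=> //.
  + by apply/gaussintP; exists (a + m), b; rewrite intrD.
  + by apply: (U1 m 0); [rewrite em|apply: complex_eqE; rewrite /=; ring].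
  + by apply: (U1 0 n); [rewrite en|apply: complex_eqE; rewrite /=; ring].
- exists (Complex (a%:~R) (b%:~R + n%:~R)); split=> //.
  + by apply/gaussintP; exists a, (b + n); rewrite intrD.
  + by apply: (U1 0 n); [rewrite en|apply: complex_eqE; rewrite /=; ring].
  + by apply: (U1 m 0); [rewrite em|apply: complex_eqE; rewrite /=; ring].
Qed.

(** * Moebius maps *)

Definition sl (a b c d : F) : bool :=
  [&& gaussint a, gaussint b, gaussint c, gaussint d & a * d - b * c == 1].

Lemma slP a b c d : reflect
  [/\ gaussint a, gaussint b, gaussint c, gaussint d & a * d - b * c = 1]
  (sl a b c d).
Proof.
by apply: (iffP and5P) => [[? ? ? ? /eqP ?]|[? ? ? ? /eqP ?]].
Qed.

Lemma sl_in a b c d : sl a b c d -> in_SL2 (mx22 a b c d).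
Proof. by move=> /slP[*]; apply: mx22_SL2. Qed.

(* Locked, since failed conversions between Moebius maps are expensive. *)
Fact mo_key : unit. Proof. exact: tt. Qed.

Definition mo : F -> F -> F -> F -> G := locked_with mo_key (fun a b c d =>
  if (insub (mx22 a b c d) : option SL2) is Some A then psl A else 1%g).

Lemma moE a b c d : mo a b c d =
  if (insub (mx22 a b c d) : option SL2) is Some A then psl A else 1%g.
Proof. by rewrite /mo locked_withE. Qed.

Lemma mo_eq a b c d a' b' c' d' : a = a' -> b = b' -> c = c' -> d = d' ->
  mo a b c d = mo a' b' c' d'.
Proof. by move=> -> -> -> ->. Qed.

Lemma mo_psl a b c d (p : in_SL2 (mx22 a b c d)) : mo a b c d = psl (MkSL2 p).
Proof. by rewrite moE insubT. Qed.

Lemma mx22M a b c d a' b' c' d' :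
  mx22 a b c d *m mx22 a' b' c' d' =
  mx22 (a * a' + b * c') (a * b' + b * d') (c * a' + d * c') (c * b' + d * d').
Proof.
apply/matrixP => i j; rewrite !mxE big_ord_recl big_ord1 !mxE /=.
by case: i => [[|[|[]]]] //= ?; case: j => [[|[|[]]]] //= ?.
Qed.

Lemma mx22N a b c d : mx22 (- a) (- b) (- c) (- d) = - mx22 a b c d.
Proof. by apply/matrixP => i j; rewrite !mxE; do 2!case: (_ == _). Qed.

Lemma mx22P (A : 'M[F]_2) : A = mx22 (A 0 0) (A 0 1) (A 1 0) (A 1 1).
Proof.
have i1 (i : 'I_2) : i != 0 -> i = 1.
  by case: i => [[|[|]]] //= ? _; apply: val_inj.
apply/matrixP => i j; rewrite mxE.
by case: (eqVneq i 0) => [->|/i1->]; case: (eqVneq j 0) => [->|/i1->].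
Qed.

Lemma moM a b c d a' b' c' d' : sl a b c d -> sl a' b' c' d' ->
  (mo a b c d * mo a' b' c' d')%g =
  mo (a * a' + b * c') (a * b' + b * d') (c * a' + d * c') (c * b' + d * d').
Proof.
move=> /sl_in p /sl_in q.
rewrite (mo_psl p) (mo_psl q) [LHS]psl_mul.
have r : in_SL2 (mx22 (a * a' + b * c') (a * b' + b * d') (c * a' + d * c') (c * b' + d * d')).
  by rewrite -mx22M; exact: SL2_mul_proof (MkSL2 p) (MkSL2 q).
by rewrite (mo_psl r); congr psl; apply: val_inj; rewrite /= mx22M.
Qed.

Lemma moN a b c d : mo (- a) (- b) (- c) (- d) = mo a b c d.
Proof.
have inN (A : 'M[F]_2) : in_SL2 (- A) = in_SL2 A.
  have H (B : 'M[F]_2) : in_SL2 B -> in_SL2 (- B).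
    case/andP=> /gaussmxP g /eqP dt; apply/andP; split.
      by apply/gaussmxP => i j; rewrite mxE gaussintN.
    by rewrite -scaleN1r detZ dt mulr1 expr2 mulrNN mulr1.
  by apply/idP/idP => [/H|/H]; rewrite ?opprK.
rewrite !moE; case: insubP => [u pu Eu|np]; case: insubP => [v pv Ev|np'] //.
- by apply/pslP; rewrite /pm_eq Eu Ev mx22N eqxx orbT.
- by move: pu np'; rewrite mx22N inN => ->.
- by move: pv np; rewrite mx22N inN => ->.
Qed.

Lemma moP g : exists a b c d, sl a b c d /\ g = mo a b c d.
Proof.
rewrite -(psl_reprK g); case: (repr g) => A pA.
exists (A 0 0), (A 0 1), (A 1 0), (A 1 1).
have pA' := pA; rewrite (mx22P A) in pA'; split.
  case/andP: pA => /gaussmxP gA /eqP dA; apply/slP; split=> //.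
  move: dA; rewrite (expand_det_row _ 0) big_ord_recl big_ord1 /cofactor.
  rewrite !det_mx11 !mxE /= expr0 expr1 mul1r mulN1r mulrN => <-.
  by congr (A _ _ * A _ _ - A _ _ * A _ _); apply/val_inj.
by rewrite (mo_psl pA'); congr psl; apply: val_inj; rewrite /= -mx22P.
Qed.

Lemma mo1 : mo 1 0 0 1 = 1%g.
Proof.
have p : in_SL2 (mx22 1 0 0 1) by apply: sl_in.
rewrite (mo_psl p); congr psl; apply: val_inj; rewrite /=.
by apply/matrixP => -[[|[|[]]]] //= ? -[[|[|[]]]] //= ?; rewrite !mxE.
Qed.

Lemma sl_inv a b c d : sl a b c d -> sl d (- b) (- c) a.
Proof.
move=> /slP[? ? ? ? E]; apply/slP; split=> //; rewrite ?gaussintN //.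
by rewrite -E; ring.
Qed.

Lemma moV a b c d : sl a b c d -> ((mo a b c d)^-1)%g = mo d (- b) (- c) a.
Proof.
move=> s; have s' := sl_inv s; apply: (mulgI (mo a b c d)); rewrite mulgV moM // -mo1.
case/slP: s => _ _ _ _ E; apply: mo_eq.
- by rewrite -E; ring.
- by ring.
- by ring.
- by rewrite -E; ring.
Qed.

(** The point with homogeneous coordinates x, y, meaningful when they are not both 0 ([nz]). *)
Definition cu (x y : F) : P1 := if y == 0 then None else Some (x / y).

Lemma cuspv_cu (v : 'cV[F]_2) : cuspv v = cu (v 0 0) (v 1 0).
Proof. by []. Qed.

Lemma cu_oo : None = cu 1 0 :> P1. Proof. by rewrite /cu eqxx. Qed.
Lemma cu_Some z : Some z = cu z 1 :> P1. Proof. by rewrite /cu oner_eq0 divr1. Qed.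

Definition nz (x y : F) := (x != 0) || (y != 0).

Lemma cuP x y x' y' : nz x y -> nz x' y' ->
  cu x y = cu x' y' <-> x * y' = x' * y.
Proof.
rewrite /cu /nz; have [->|y0] := eqVneq y 0; have [->|y'0] := eqVneq y' 0.
- by rewrite !mulr0.
- rewrite orbF mulr0 => x0 _; split=> // /eqP.
  by rewrite mulf_eq0 (negPf x0) (negPf y'0).
- rewrite orbF mulr0 => _ x0; split=> // /eqP.
  by rewrite eq_sym mulf_eq0 (negPf x0) (negPf y0).
- move=> _ _; split=> [[]/eqP|E]; first by rewrite eqr_div // => /eqP.
  by congr Some; apply/eqP; rewrite eqr_div //; apply/eqP.
Qed.

Lemma mo_cu a b c d x y : sl a b c d -> nz x y ->
  mo a b c d • cu x y = cu (a * x + b * y) (c * x + d * y).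
Proof.
move=> /sl_in p nxy; rewrite (mo_psl p).
pose v : 'cV[F]_2 := \col_(i < 2) if i == 0 then x else y.
have -> : cu x y = cuspv v by rewrite cuspv_cu !mxE.
rewrite [LHS]cusp_act_psl; last first.
  apply/eqP => /matrixP E; move: nxy; have := E 0 0; have := E 1 0.
  by rewrite !mxE /= => -> ->; rewrite /nz eqxx.
by rewrite cuspv_cu !mxE !big_ord_recl !big_ord0 /= !mxE /= !addr0.
Qed.

Lemma sl_nz1 a b c d : sl a b c d -> nz a c.
Proof.
move=> /slP[_ _ _ _]; rewrite /nz; case: eqP => //= ->; case: eqP => //= -> /eqP.
by rewrite mul0r mulr0 subr0 eq_sym oner_eq0.
Qed.

Lemma sl_nz2 a b c d : sl a b c d -> nz b d.
Proof.
move=> /slP[_ _ _ _]; rewrite /nz; case: eqP => //= ->; case: eqP => //= -> /eqP.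
by rewrite mul0r mulr0 subr0 eq_sym oner_eq0.
Qed.

Lemma sl_nz a b c d x y : sl a b c d -> nz x y -> nz (a * x + b * y) (c * x + d * y).
Proof.
move=> /slP[_ _ _ _ E]; apply: contraTT; rewrite /nz !negb_or !negbK.
move=> /andP[/eqP E1 /eqP E2].
have -> : x = 0.
  transitivity ((a * d - b * c) * x); first by rewrite E mul1r.
  by transitivity (d * (a * x + b * y) - b * (c * x + d * y)); [ring|rewrite E1 E2; ring].
have -> : y = 0.
  transitivity ((a * d - b * c) * y); first by rewrite E mul1r.
  by transitivity (a * (c * x + d * y) - c * (a * x + b * y)); [ring|rewrite E1 E2; ring].
by rewrite eqxx.
Qed.

Lemma nz10 : nz 1 0. Proof. by rewrite /nz oner_eq0. Qed.
Lemma nzx1 x : nz x 1. Proof. by rewrite /nz oner_eq0 orbT. Qed.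

Lemma mo_oo a b c d : sl a b c d -> mo a b c d • (None : P1) = cu a c.
Proof. by move=> s; rewrite cu_oo mo_cu ?nz10 // !mulr1 !mulr0 !addr0. Qed.

Lemma mo_Some a b c d z : sl a b c d ->
  mo a b c d • (Some z : P1) = cu (a * z + b) (c * z + d).
Proof. by move=> s; rewrite cu_Some mo_cu ?nzx1 // !mulr1. Qed.

Lemma mo_0 a b c d : sl a b c d -> mo a b c d • (Some 0 : P1) = cu b d.
Proof. by move=> s; rewrite mo_Some // !mulr0 !add0r. Qed.

Lemma gSE : gS = mo 0 (-1) 1 0. Proof. by rewrite (mo_psl matS_proof). Qed.
Lemma gRE : gR = mo 0 ii ii 0. Proof. by rewrite (mo_psl matR_proof). Qed.
Lemma gXE : gX = mo 1 (-1) 1 0. Proof. by rewrite (mo_psl matX_proof). Qed.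
Lemma gYE : gY = mo (-1) ii ii 0. Proof. by rewrite (mo_psl matY_proof). Qed.

Definition Tr (k : F) : G := mo 1 k 0 1.
(** The half-turn z |-> -z, the only nontrivial element fixing both 0 and oo. *)
Definition gd : G := mo ii 0 0 (- ii).

Lemma slS : sl 0 (-1) 1 0. Proof. by []. Qed.
Lemma sld : sl ii 0 0 (- ii). Proof. by []. Qed.
Lemma slT k : gaussint k -> sl 1 k 0 1.
Proof. by move=> gk; apply/slP; split=> //; rewrite mulr0 subr0 mulr1. Qed.

Lemma TrD k l : gaussint k -> gaussint l -> (Tr k * Tr l)%g = Tr (k + l).
Proof. by move=> gk gl; rewrite /Tr moM ?slT //; apply: mo_eq; ring. Qed.

Lemma Tr0 : Tr 0 = 1%g. Proof. exact: mo1. Qed.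

Lemma TrV k : gaussint k -> ((Tr k)^-1)%g = Tr (- k).
Proof. by move=> gk; rewrite /Tr moV ?slT // oppr0. Qed.

Lemma Tr_oo k : gaussint k -> Tr k • (None : P1) = None.
Proof. by move=> gk; rewrite /Tr mo_oo ?slT // -cu_oo. Qed.

Lemma Tr_Some k z : gaussint k -> Tr k • (Some z : P1) = Some (z + k).
Proof. by move=> gk; rewrite /Tr mo_Some ?slT // cu_Some; congr cu; ring. Qed.

Lemma gd_oo : gd • (None : P1) = None.
Proof. by rewrite /gd mo_oo ?sld // /cu eqxx. Qed.

Lemma gd_Some z : gd • (Some z : P1) = Some (- z).
Proof.
rewrite /gd mo_Some ?sld // cu_Some; apply/cuP; rewrite ?nzx1 //; last by ring.
by rewrite /nz mul0r add0r orbC oppr_eq0.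
Qed.

Lemma TrE k : Tr k = mo 1 k 0 1. Proof. by []. Qed.
Lemma gdE : gd = mo ii 0 0 (- ii). Proof. by []. Qed.

(** Fixing oo forces c = 0, so a and d are inverse units. The values +-1 give translations and +-i
    give z |-> -z + k, as a unit acts through its square. *)
Lemma stab_oo g : g • (None : P1) = None ->
  exists2 k, gaussint k & g = Tr k \/ g = (Tr k * gd)%g.
Proof.
have [a [b [c [d [s ->]]]]] := moP g.
rewrite mo_oo // cu_oo => /cuP; rewrite (sl_nz1 s) nz10 => /(_ isT isT).
rewrite mulr0 mul1r => c0; subst c.
case/slP: (s) => ga gb _ gd0 E; have {}E : a * d = 1 by rewrite -E mulr0 subr0.
have := gunits_mul1 ga gd0 E; rewrite !inE => /or4P[] /eqP Ea; subst a.
- exists b => //; left; rewrite TrE.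
  by apply: mo_eq => //; rewrite -E mul1r.
- exists (- b); first exact: gaussintN.
  have {}E : d = -1 by rewrite -E; ring.
  by left; subst d; rewrite -moN TrE; apply: mo_eq; ring.
- have Ed : d = - ii.
    have -> : d = - ii * (ii * d); last by rewrite E mulr1.
    by rewrite mulrA (_ : - ii * ii = 1) ?mul1r //; apply/eqP; vm_compute.
  exists (b * ii); first by rewrite gaussintM.
  right; rewrite TrE gdE moM ?slT ?sld ?gaussintM //; subst d; apply: mo_eq; try ring.
  by rewrite mulrN -mulrA (_ : ii * ii = -1) ?mulrN1 ?opprK ?mul1r ?mulr0 ?add0r //; apply/eqP; vm_compute.
- have Ed : d = ii.
    have -> : d = ii * (- ii * d); last by rewrite E mulr1.
    by rewrite mulrA (_ : ii * - ii = 1) ?mul1r //; apply/eqP; vm_compute.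
  exists (- (b * ii)); first by rewrite gaussintN ?gaussintM.
  right; rewrite -moN TrE gdE moM ?slT ?sld ?gaussintN ?gaussintM //; subst d.
  apply: mo_eq; try ring.
  by rewrite mulrNN -mulrA (_ : ii * ii = -1) ?mulrN1 ?mulr0 ?add0r //; apply/eqP; vm_compute.
Qed.

(** * Descent on denominators *)

Lemma gactK (Gam : groupType) (T : gset Gam) (g : Gam) (x : T) : g^-1%g • g • x = x.
Proof. by rewrite -gset_actM mulVg gset_act1. Qed.

Lemma gactVK (Gam : groupType) (T : gset Gam) (g : Gam) (x : T) : g • g^-1%g • x = x.
Proof. by rewrite -gset_actM mulgV gset_act1. Qed.

Lemma gact_inj (Gam : groupType) (T : gset Gam) (g : Gam) (x y : T) :
  g • x = g • y -> x = y.
Proof. by move=> E; rewrite -[x](gactK g) E gactK. Qed.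

(** Cramer's rule. The inverse [e] of the determinant is kept, so that any unit is allowed as
    determinant. *)
Lemma gauss_basis_det (v w : 'cV[F]_2) e : gaussmx v -> gaussmx w ->
  gaussint e -> e * (v 0 0 * w 1 0 - w 0 0 * v 1 0) = 1 -> gauss_basis v w.
Proof.
move=> gv gw ge E; split=> // u gu; move/gaussmxP: (gu) => gu'.
move/gaussmxP: (gv) => gv'; move/gaussmxP: (gw) => gw'.
have i1 (i : 'I_2) : i != 0 -> i = 1.
  by case: i => [[|[|]]] //= ? _; apply: val_inj.
exists (e * (u 0 0 * w 1 0 - w 0 0 * u 1 0), e * (v 0 0 * u 1 0 - u 0 0 * v 1 0)).
split=> [|[x y] [/= _ _ Eu]].
  split; rewrite /= ?(gaussintM, gaussintD, gaussintN) //.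
  apply/matrixP => i j; rewrite !mxE ord1; case: (eqVneq i 0) => [->|/i1 ->].
    by rewrite -[LHS]mul1r -E; ring.
  by rewrite -[LHS]mul1r -E; ring.
have E0 : u 0 0 = x * v 0 0 + y * w 0 0 by rewrite Eu !mxE.
have E1 : u 1 0 = x * v 1 0 + y * w 1 0 by rewrite Eu !mxE.
congr pair; rewrite E0 E1.
  by rewrite -[RHS]mul1r -E; ring.
by rewrite -[RHS]mul1r -E; ring.
Qed.

(** Expanding the two standard vectors in v, w gives a coefficient matrix whose determinant is
    inverse to that of (v, w). *)
Lemma det_gauss_basis (v w : 'cV[F]_2) : gauss_basis v w ->
  exists2 e, gaussint e & e * (v 0 0 * w 1 0 - w 0 0 * v 1 0) = 1.
Proof.
case=> gv gw H.
have gdelta i : gaussmx (delta_mx i 0 : 'cV[F]_2).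
  by apply/gaussmxP => k l; rewrite mxE; case: (_ && _).
have [[x y] [[/= gx gy E0] _]] := H _ (gdelta 0).
have [[x' y'] [[/= gx' gy' E1] _]] := H _ (gdelta 1).
exists (x * y' - x' * y); first by rewrite gaussintD ?gaussintN ?gaussintM.
move/matrixP: E0 => E0; move/matrixP: E1 => E1.
have := E0 0 0; have := E0 1 0; have := E1 0 0; have := E1 1 0.
rewrite !mxE /= => h1 h2 h3 h4.
transitivity ((x * v 0 0 + y * w 0 0) * (x' * v 1 0 + y' * w 1 0) -
  (x * v 1 0 + y * w 1 0) * (x' * v 0 0 + y' * w 0 0)); first by ring.
by rewrite -h1 -h2 -h3 -h4 mulr1 mulr0 subr0.
Qed.

Definition cvec (x y : F) : 'cV[F]_2 := \col_(i < 2) if i == 0 then x else y.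

Lemma cuspv_cvec x y : cuspv (cvec x y) = cu x y.
Proof. by rewrite cuspv_cu !mxE. Qed.

Lemma cvec_gauss x y : gaussint x -> gaussint y -> gaussmx (cvec x y).
Proof. by move=> gx gy; apply/gaussmxP => i j; rewrite mxE; case: (_ == _). Qed.

Lemma cuZ k x y : k != 0 -> cu (k * x) (k * y) = cu x y.
Proof.
move=> k0; rewrite /cu mulf_eq0 (negPf k0) /=; case: eqP => // _.
by rewrite -mulf_div divff // mul1r.
Qed.

Lemma gauss_edge_sl a b c d : sl a b c d -> gauss_edge (cu a c) (cu b d).
Proof.
move=> /slP[? ? ? ? E]; apply/gauss_edgeP; exists (cvec a c), (cvec b d).
rewrite !cuspv_cvec; split=> //; apply: (@gauss_basis_det _ _ 1) => //;
  rewrite ?cvec_gauss // !mxE /= mul1r -E; ring.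
Qed.

Lemma gunits_inv u : u \in gunits -> exists2 u', u' \in gunits & u * u' = 1.
Proof.
rewrite inE => /orP[/eqP ->|]; first by exists 1; rewrite ?mulr1.
rewrite inE => /orP[/eqP ->|]; first by exists (-1); rewrite ?mulrNN ?mulr1.
rewrite inE => /orP[/eqP ->|].
  by exists (- ii); [rewrite !inE eqxx !orbT|apply/eqP; vm_compute].
rewrite inE => /eqP ->.
by exists ii; [rewrite !inE eqxx !orbT|apply/eqP; vm_compute].
Qed.

Lemma gunits_gauss u : u \in gunits -> gaussint u.
Proof. by case/gunitsP. Qed.

Lemma gunits_neq0 u : u \in gunits -> u != 0.
Proof.
by move=> /gunits_inv[u' _]; apply: contra_eqN => /eqP ->; rewrite mul0r eq_sym oner_eq0.
Qed.

(** Scaling w by the inverse e of the determinant makes the determinant 1, while v + w becomes, up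
    to the factor e, the vector e v + (e w). This is the origin of the unit u in the third vertex of
    a triangle. *)
Lemma gauss_basis_sl v w : gauss_basis v w -> exists a b c d u,
  [/\ sl a b c d, u \in gunits, cuspv v = cu a c, cuspv w = cu b d &
      cuspv (v + w) = cu (a * u + b) (c * u + d)].
Proof.
move=> H; have [e ge E] := det_gauss_basis H; case: H => /gaussmxP gv /gaussmxP gw _.
have ue : e \in gunits by apply: (gunits_mul1 _ _ E); rewrite ?(gaussintD, gaussintN, gaussintM).
have e0 := gunits_neq0 ue.
exists (v 0 0), (e * w 0 0), (v 1 0), (e * w 1 0), e; split=> //.
- by apply/slP; split; rewrite ?gaussintM // -E; ring.
- by rewrite cuspv_cu cuZ.
- by rewrite cuspv_cu !mxE !(mulrC _ e) -!mulrDr cuZ.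
Qed.

Lemma gauss_edge_cu al be : gauss_edge al be <->
  exists a b c d, [/\ sl a b c d, al = cu a c & be = cu b d].
Proof.
split=> [/gauss_edgeP[v [w [/gauss_basis_sl]]]|[a [b [c [d [s -> ->]]]]]].
  by move=> [a [b [c [d [_ [s _ -> -> _]]]]]] <- <-; exists a, b, c, d.
exact: gauss_edge_sl.
Qed.

Lemma gauss_tri_sl a b c d u : sl a b c d -> u \in gunits ->
  gauss_tri (cu a c) (cu b d) (cu (a * u + b) (c * u + d)).
Proof.
move=> /slP[? ? ? ? E] uu; have u0 := gunits_neq0 uu; have gu := gunits_gauss uu.
have [u' uu' Eu] := gunits_inv uu; have gu' := gunits_gauss uu'.
exists (cvec (u * a) (u * c)), (cvec b d); split; rewrite ?cuspv_cvec ?cuZ //.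
  apply: (@gauss_basis_det _ _ u'); rewrite ?cvec_gauss ?gaussintM // !mxE /=.
  by rewrite -[RHS](mulr1 1) -{1}Eu -E; ring.
by rewrite cuspv_cu !mxE /= ![u * _]mulrC.
Qed.

Lemma gauss_triP al be ga : gauss_tri al be ga <->
  exists a b c d u, [/\ sl a b c d, u \in gunits, al = cu a c, be = cu b d &
    ga = cu (a * u + b) (c * u + d)].
Proof.
split=> [[v [w [/gauss_basis_sl H <- <- <-]]]|[a [b [c [d [u [s uu -> -> ->]]]]]]] //.
exact: gauss_tri_sl.
Qed.

Lemma gauss_edge_sym al be : gauss_edge al be -> gauss_edge be al.
Proof.
by move=> /gauss_edgeP[v [w [H Ev Ew]]]; apply/gauss_edgeP; exists w, v;
  split=> //; exact: gauss_basis_sym.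
Qed.

Lemma cusp_fraction (al : P1) : exists x y, [/\ gaussint x, gaussint y, nz x y & al = cu x y].
Proof.
case: al => [[p q]|]; last by exists 1, 0; rewrite nz10 -cu_oo.
have gi (m n : int) : gaussint (Complex m%:~R n%:~R) by apply/gaussintP; exists m, n.
pose x : F := Complex (numq p * denq q)%:~R (numq q * denq p)%:~R.
pose y : F := Complex (denq p * denq q)%:~R 0.
have y0 : y != 0.
  by rewrite eq_complex /= intr_eq0 mulf_eq0 !denq_eq0.
exists x, y; split; [exact: gi|exact: (gi _ 0)|by rewrite /nz y0 orbT|].
rewrite cu_Some; apply/cuP; rewrite /nz ?oner_eq0 ?y0 ?orbT //.
rewrite mulr1 /x /y; apply: complex_eqE.
  by rewrite !intrM numqE mulr0 subr0; ring.
by rewrite !intrM numqE mulr0 add0r; ring.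
Qed.

(** The Euclidean algorithm, with norms of denominators decreasing. The predicate P lets one descent
    serve both for transitivity on the cusps and for generation of G by S, R, X, Y. *)
Lemma cusp_gen (P : G -> Prop) : P 1%g ->
  (forall g k, P g -> gaussint k -> P (Tr k * g)%g) ->
  (forall g, P g -> P (gS * g)%g) ->
  forall al : P1, exists2 g, P g & g • (None : P1) = al.
Proof.
move=> P1 PT PS al; have [x [y [gx gy nxy ->]]] := cusp_fraction al.
have [n] := gaussint_nsq gy; move: n x y gx gy nxy {al}.
apply: (ltn_ind (P := fun n => forall x y, gaussint x -> gaussint y -> nz x y ->
  nsq y = n%:R -> exists2 g, P g & g • (None : Defs.P1) = cu x y)) => n IH x y gx gy nxy En.
have [y0|y0] := eqVneq y 0.
  exists 1%g; rewrite ?gset_act1 //; rewrite y0 in nxy *.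
  by rewrite /cu eqxx.
have [k gk Hk] := gauss_round (x / y).
pose r := x - k * y; have gr : gaussint r by rewrite gaussintD // gaussintN // gaussintM.
have Hr : nsq r < nsq y.
  have -> : r = (x / y - k) * y by rewrite mulrBl divfK.
  by rewrite nsqM gtr_pMl // lt_def nsq_eq0 y0 nsq_ge0.
have [m Em] := gaussint_nsq gr.
have mn : (m < n)%N by rewrite -(ltr_nat rat) -Em -En.
have nyr : nz y (- r) by rewrite /nz y0.
have [g Pg Eg] := IH m mn y (- r) gy (gaussintN gr) nyr (etrans (nsqN r) Em).
(* Here g oo = y/(-r), which S sends to r/y = x/y - k. *)
exists (Tr k * (gS * g))%g; first by apply: PT => //; exact: PS.
rewrite !gset_actM Eg gSE mo_cu ?slS // TrE mo_cu ?slT //; last first.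
  by rewrite /nz; apply/orP; right; rewrite mul1r mul0r addr0.
by congr cu; rewrite /r; ring.
Qed.

Lemma cusp_trans (al : P1) : exists a b c d, sl a b c d /\ al = cu a c.
Proof.
have [||| g _ <-] := @cusp_gen (fun=> True) _ _ _ al => //.
by have [a [b [c [d [s ->]]]]] := moP g; exists a, b, c, d; rewrite mo_oo.
Qed.

Lemma stab_oo_0 g : g • (None : P1) = None ->
  exists2 k, gaussint k & g • (Some 0 : P1) = Some k.
Proof.
move=> /stab_oo[k gk [->|->]]; exists k; rewrite ?gset_actM ?gd_Some ?oppr0 //;
  by rewrite Tr_Some // add0r.
Qed.

(** Two frames with the same first vertex differ by an element of the stabiliser of oo, which sends
    0 to a Gaussian integer. *)
Lemma neighbors a b c d be : sl a b c d -> gauss_edge (cu a c) be ->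
  exists2 k, gaussint k & be = cu (a * k + b) (c * k + d).
Proof.
move=> s /gauss_edge_cu[a' [b' [c' [d' [s' E ->]]]]].
have [g Eg] : exists g, mo a' b' c' d' = (mo a b c d * g)%g.
  by exists ((mo a b c d)^-1 * mo a' b' c' d')%g; rewrite mulVKg.
have goo : g • (None : P1) = None.
  have : mo a' b' c' d' • (None : P1) = mo a b c d • (None : P1) by rewrite !mo_oo.
  by rewrite Eg gset_actM => /gact_inj.
have [k gk Ek] := stab_oo_0 goo; exists k => //.
by rewrite -mo_Some // -(mo_0 s') Eg gset_actM Ek.
Qed.

Lemma sl_shift a b c d k : sl a b c d -> gaussint k -> sl a (a * k + b) c (c * k + d).
Proof.
by move=> /slP[? ? ? ? E] gk; apply/slP; split; rewrite ?(gaussintD, gaussintM) // -E; ring.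
Qed.

Lemma sl_swap a b c d : sl a b c d -> sl b (- a) d (- c).
Proof. by move=> /slP[? ? ? ? E]; apply/slP; split; rewrite ?gaussintN // -E; ring. Qed.

(** Determinant 1 makes the denominator z divide that of any other such fraction for the same cusp:
    z' = z (t x' - y z'). Both divide each other, hence so do their norms, which are natural
    numbers. *)
Lemma sl_den_unique a b c d a' b' c' d' : sl a b c d -> sl a' b' c' d' ->
  cu a c = cu a' c' -> nsq c = nsq c'.
Proof.
move=> s s' /cuP; rewrite (sl_nz1 s) (sl_nz1 s') => /(_ isT isT) E.
have div x y z t x' y' z' t' : sl x y z t -> sl x' y' z' t' -> x * z' = x' * z ->
    exists2 m : nat, nsq z' = nsq z * m%:R & True.
  move=> /slP[gx gy gz gt D] /slP[gx' gy' gz' gt' D'] E'.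
  have [m Em] := gaussint_nsq (gaussintD (gaussintM gt gx') (gaussintN (gaussintM gy gz'))).
  exists m => //; rewrite -Em -nsqM; congr nsq.
  rewrite -[LHS]mul1r -D; transitivity (t * (x * z') - y * z * z'); first by ring.
  by rewrite E'; ring.
have [m Em _] := div _ _ _ _ _ _ _ _ s s' E.
have [m' Em' _] := div _ _ _ _ _ _ _ _ s' s (esym E).
have [n En] : exists n : nat, nsq c = n%:R by case/slP: s => *; apply: gaussint_nsq.
have [n' En'] : exists n : nat, nsq c' = n%:R by case/slP: s' => *; apply: gaussint_nsq.
move: Em Em'; rewrite En En' -!natrM => /eqP; rewrite eqr_nat => /eqP h /eqP.
rewrite eqr_nat => /eqP h'; congr (_%:R); apply/eqP.
by rewrite eqn_dvd; apply/andP; split; apply/dvdnP; [exists m|exists m']; rewrite mulnC.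
Qed.

Lemma den_exists (al : P1) : exists n : nat, forall a b c d, sl a b c d ->
  al = cu a c -> nsq c = n%:R.
Proof.
have [a [b [c [d [s ->]]]]] := cusp_trans al.
have [n En] : exists n : nat, nsq c = n%:R by case/slP: (s) => *; apply: gaussint_nsq.
by exists n => a' b' c' d' s' E; rewrite -En; apply/esym/(sl_den_unique s s').
Qed.

(** The norm of the denominator of a cusp in lowest terms, 0 exactly at oo: the measure of the
    descent. *)
Definition dn (al : P1) : nat := sval (cid (den_exists al)).

Lemma dnE a b c d : sl a b c d -> nsq c = (dn (cu a c))%:R.
Proof. by move=> s; rewrite /dn; case: cid => n /= /(_ a b c d s); apply. Qed.

Lemma dnE2 a b c d : sl a b c d -> nsq d = (dn (cu b d))%:R.
Proof. by move=> /sl_swap/dnE. Qed.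

Lemma dn_eq0 al : dn al = 0%N <-> al = None.
Proof.
have [a [b [c [d [s ->]]]]] := cusp_trans al; split=> [E|E].
  have /eqP := dnE s; rewrite E nsq_eq0 => /eqP c0.
  by rewrite /cu c0 eqxx.
have := dnE s; move: E; rewrite /cu; case: eqP => // -> _ /esym/eqP.
by rewrite -(_ : 0 = nsq 0) ?pnatr_eq0 => [/eqP|]; last by apply/eqP; vm_compute.
Qed.

(** In the frame of the cusp its neighbours are the Gaussian integers k, and -d/c is the preimage of
    oo; the new denominator is ck + d = -c (-d/c - k). *)
Lemma dn_neighbor a b c d k : sl a b c d -> gaussint k -> c != 0 ->
  (dn (cu (a * k + b)%R (c * k + d)%R) < dn (cu a c))%N = (nsq (- d / c - k) < 1).
Proof.
move=> s gk c0; rewrite -(ltr_nat rat) -(dnE s) -(dnE2 (sl_shift s gk)).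
have -> : nsq (c * k + d) = nsq (- d / c - k) * nsq c.
  by rewrite -nsqM -nsqN; congr nsq; rewrite mulrBl divfK //; ring.
by rewrite gtr_pMl // lt_def nsq_eq0 c0 nsq_ge0.
Qed.

Lemma parent_exists al : al <> None -> exists be, gauss_edge be al /\ (dn be < dn al)%N.
Proof.
have [a [b [c [d [s ->]]]]] := cusp_trans al => al0.
have c0 : c != 0 by apply: contra_notN al0 => /eqP ->; rewrite /cu eqxx.
have [k gk Hk] := gauss_round (- d / c).
exists (cu (a * k + b) (c * k + d)); rewrite dn_neighbor //; split=> //.
exact/gauss_edge_sym/gauss_edge_sl/sl_shift.
Qed.

Lemma cusp_connected (P : P1 -> Prop) : P None ->
  (forall al be, gauss_edge al be -> P al -> P be) -> forall al, P al.
Proof.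
move=> P0 Pe al; have [n] := ubnP (dn al); elim: n al => // n IH al lt_n.
have [->//|/eqP al0] := eqVneq al None.
have [be [e lt]] := parent_exists al0; apply: (Pe _ _ e); apply: IH.
exact: leq_trans lt lt_n.
Qed.

(* For units e, the triangles with edge v, w have third vertex ev + w; for a
   suitable e its denominator is smaller when those of v and w have equal norm. *)
Lemma common_smaller a b c d : sl a b c d -> nsq c = nsq d ->
  exists2 u, u \in gunits & nsq (c * u + d) < nsq c.
Proof.
move=> s E; have c0 : c != 0.
  apply/eqP => c0; case/slP: s => _ _ _ _; have : nsq d == 0.
    by rewrite -E c0; apply/eqP; vm_compute.
  rewrite nsq_eq0 c0 => /eqP ->; rewrite !mulr0 subr0 => /eqP.
  by rewrite eq_sym oner_eq0.
have nc : 0 < nsq c by rewrite lt_def nsq_eq0 c0 nsq_ge0.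
have Ez : nsq (d / c) = 1.
  apply: (mulIf (lt0r_neq0 nc)); rewrite -nsqM divfK // mul1r -E //.
suff [u uu Hu] : exists2 u, u \in gunits & nsq (u + d / c) < 1.
  exists u => //; have -> : c * u + d = (u + d / c) * c by rewrite mulrDl divfK // mulrC.
  by rewrite nsqM gtr_pMl.
move: Ez; case: (d / c) => x y; rewrite /nsq /= => Ez.
(* For z = d/c of norm 1 one has |e + z|^2 = 2 + 2<e, z>, so a unit e works once <e, z> < -1/2. One
   of the four does, since some coordinate of z has absolute value at least 1/sqrt 2. *)
have H (e : F) : e \in gunits -> complex.Re e * x + complex.Im e * y < - (1 / 2) ->
    exists2 u, u \in gunits & nsq (u + Complex x y) < 1.
  move=> ue h; exists e => //; case/gunitsP: ue => _.
  case: e h => p q; rewrite /nsq /= => h1 h2; nra.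
have [h|h] := ltP x (- (1 / 2)); first by apply: (H 1); rewrite ?inE //=; lra.
have [h1|h1] := ltP (- x) (- (1 / 2)).
  by apply: (H (-1)); rewrite ?inE //=; lra.
have [h2|h2] := ltP y (- (1 / 2)); first by apply: (H ii); rewrite ?inE //=; lra.
apply: (H (- ii)); rewrite ?inE ?eqxx ?orbT //=; nra.
Qed.

(** * Sections of a flat transport over the Farey graph *)

Section FlatSection.
Variables (X : Type) (f : P1 -> P1 -> X -> X) (x0 : X).
Hypothesis fK : forall al be x, gauss_edge al be -> f be al (f al be x) = x.
Hypothesis f3 : forall al be ga x, gauss_tri al be ga ->
  f ga al (f be ga (f al be x)) = x.

(** A chosen neighbour of smaller denominator; the value at oo is a default. *)
Let par (al : P1) : P1 :=
  if pselect (al <> None) is left h then sval (cid (parent_exists h)) else None.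

Let parP al : al <> None -> gauss_edge (par al) al /\ (dn (par al) < dn al)%N.
Proof. by rewrite /par; case: pselect => // h _; case: cid. Qed.

(** Transport of [x0] along the chain of parents. The recursion is on fuel, and any fuel of at least
    [dn al] gives the same value. *)
Fixpoint develop (n : nat) (al : P1) : X :=
  if n is n'.+1 then if al is None then x0 else f (par al) al (develop n' (par al)) else x0.

Let develop_oo n : develop n None = x0. Proof. by case: n. Qed.

Let develop_fuel n m al : (dn al <= n)%N -> (dn al <= m)%N -> develop n al = develop m al.
Proof.
elim: n m al => [|n IH] [|m] al; rewrite ?leqn0.
- by [].
- by move=> /eqP/dn_eq0 -> _; rewrite !develop_oo.
- by move=> _ /eqP/dn_eq0 ->; rewrite !develop_oo.
case: al => [z|] // h1 h2 /=; congr f.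
have [_ lt] := @parP (Some z) ltac:(by []).
by apply: IH; rewrite -ltnS; apply: leq_trans lt _.
Qed.

Let sec al := develop (dn al) al.

Let secE al : al <> None -> sec al = f (par al) al (sec (par al)).
Proof.
move=> al0; have [_ lt] := parP al0; rewrite /sec.
case E : (dn al) lt => [|n] // lt; case: (al) al0 lt => [z|] // _ lt /=.
by congr f; apply: develop_fuel.
Qed.

Let flat_upto n := forall al be, gauss_edge al be -> (dn al < n)%N -> (dn be < n)%N ->
  sec be = f al be (sec al).

(* Two neighbours with smaller denominators are the images of two lattice
   points in an open unit disc. *)
Let flat_indep n al be be' : flat_upto n -> dn al = n ->
  gauss_edge al be -> gauss_edge al be' -> (dn be < n)%N -> (dn be' < n)%N ->
  f be al (sec be) = f be' al (sec be').
Proof.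
have [a [b [c [d [s ->]]]]] := cusp_trans al => Hn En.
subst n => e e' lt lt'.
have c0 : c != 0.
  apply/eqP => c0; have E0 : cu a c = None by rewrite /cu c0 eqxx.
  by move: lt; rewrite E0 (proj2 (dn_eq0 None)).
have step k l : gaussint k -> gaussint l -> l - k \in gunits ->
    nsq (- d / c - k) < 1 -> nsq (- d / c - l) < 1 ->
    let bk := cu (a * k + b) (c * k + d) in let bl := cu (a * l + b) (c * l + d) in
    f bk (cu a c) (sec bk) = f bl (cu a c) (sec bl).
  move=> gk gl u hk hl bk bl; have sk := sl_shift s gk.
  have t : gauss_tri (cu a c) bk bl.
    have -> : bl = cu (a * (l - k) + (a * k + b)) (c * (l - k) + (c * k + d)).
      by congr cu; ring.
    exact: gauss_tri_sl.
  have [e1 e2 e3] := gauss_tri_edges t.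
  have E := f3 (f bk (cu a c) (sec bk)) t.
  by rewrite -[LHS]E fK ?(Hn _ _ e2) ?dn_neighbor //; exact: gauss_edge_sym.
move: lt lt'; have [k gk ->] := neighbors s e; have [l gl ->] := neighbors s e'.
rewrite !dn_neighbor // => hk hl.
have [->//|u|[m [gm hm u1 u2]]] := gauss_disc gk gl hk hl.
  exact: step.
by rewrite (step k m) // (step m l).
Qed.

(** Induction on a bound n for [dn]. An edge into a cusp at level n from a lower one is compared
    with the edge from the chosen parent by [flat_indep]. An edge between two cusps at level n is a
    side of a triangle whose third vertex is lower, and the triangle relation reduces it to the two
    other sides. *)
Lemma flat_section : exists s : P1 -> X, s None = x0 /\
  forall al be, gauss_edge al be -> s be = f al be (s al).
Proof.
exists sec; split; first by rewrite /sec develop_oo.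
suff H n : flat_upto n.
  by move=> al be e; apply: (H (maxn (dn al) (dn be)).+1 _ _ e);
    rewrite ltnS ?leq_maxl ?leq_maxr.
elim: n => [//|n IH].
have up al be : gauss_edge al be -> (dn al < n)%N -> dn be = n -> sec be = f al be (sec al).
  move=> e lt En; have be0 : be <> None by move=> /dn_eq0 be0; rewrite -En be0 in lt.
  have [e' lt'] := parP be0; rewrite secE //; rewrite En in lt'.
  by apply: (flat_indep IH En) => //; apply: gauss_edge_sym.
move=> al be e; rewrite !ltnS => la lb.
have [lta|] := ltnP (dn al) n; have [ltb|] := ltnP (dn be) n.
- exact: IH.
- by move=> h; apply: up => //; apply/eqP; rewrite eqn_leq lb.
- move=> h; rewrite (up be al) //; last by apply/eqP; rewrite eqn_leq la.
    by rewrite fK //; apply: gauss_edge_sym.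
  exact: gauss_edge_sym.
move=> hb ha; have Ea : dn al = n by apply/eqP; rewrite eqn_leq la.
have Eb : dn be = n by apply/eqP; rewrite eqn_leq lb.
have [a [b [c [d [s Eal Ebe]]]]] := proj1 (gauss_edge_cu al be) e.
have [u uu Hu] : exists2 u, u \in gunits & nsq (c * u + d) < nsq c.
  by apply: (common_smaller s); rewrite (dnE s) (dnE2 s) -Eal -Ebe Ea Eb.
have t := gauss_tri_sl s uu; rewrite -Eal -Ebe in t.
have Eg := dnE2 (sl_shift s (gunits_gauss uu)).
move: Hu; rewrite Eg (dnE s) -Eal Ea ltr_nat; move: (cu _ _) t => ga t ltg.
have [_ e2 e3] := gauss_tri_edges t.
have e3' := gauss_edge_sym e3; have e2' := gauss_edge_sym e2.
have := f3 (sec al) t => /(congr1 (f al ga)); rewrite fK // [in RHS](up ga al) // fK //.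
by move=> /(congr1 (f ga be)); rewrite fK // -(up ga be) // => <-.
Qed.

End FlatSection.

(** * The presentation of G *)

Ltac vmeq := apply/eqP; vm_compute; reflexivity.
Ltac mocalc :=
  rewrite ?gSE ?gRE ?gXE ?gYE ?gdE ?TrE; rewrite !moM;
  [> first [by apply: mo_eq; vmeq | by rewrite -moN; apply: mo_eq; vmeq]
   | vm_compute; reflexivity ..].

Lemma gSS : (gS * gS = 1)%g.
Proof. by rewrite gSE moM // -moN -mo1; apply: mo_eq; vmeq. Qed.
Lemma gRR : (gR * gR = 1)%g.
Proof. by rewrite gRE moM // -moN -mo1; apply: mo_eq; vmeq. Qed.
Lemma gRS : (gR * gS = gd)%g.
Proof. by rewrite gRE gSE moM //; apply: mo_eq; vmeq. Qed.
Lemma gSR : (gS * gR = gd)%g.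
Proof. by rewrite gRE gSE moM // -moN; apply: mo_eq; vmeq. Qed.
Lemma gdd : (gd * gd = 1)%g.
Proof. by rewrite -{1}gRS -gSR mulgA -(mulgA gR) gSS mulg1 gRR. Qed.
Lemma gdS : (gd * gS = gR)%g.
Proof. by rewrite -gRS -mulgA gSS mulg1. Qed.
Lemma gSd : (gS * gd = gR)%g.
Proof. by rewrite -gSR mulgA gSS mul1g. Qed.
(** This and the next identity give the translations by 1 and i as X S and Y R, the words through
    which the presented group moves along the stabiliser of oo. *)
Lemma gT1S : (Tr 1%R * gS = gX)%g.
Proof. by rewrite gSE gXE TrE moM //; apply: mo_eq; vmeq. Qed.
Lemma gTiR : (Tr ii * gR = gY)%g.
Proof. by rewrite gRE gYE TrE moM //; apply: mo_eq; vmeq. Qed.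
Lemma gSV : (gS^-1 = gS)%g.
Proof. by apply: (mulgI gS); rewrite mulgV gSS. Qed.
Lemma gRV : (gR^-1 = gR)%g.
Proof. by apply: (mulgI gR); rewrite mulgV gRR. Qed.

Lemma gdT k : gaussint k -> (gd * Tr k = Tr (- k) * gd)%g.
Proof.
move=> gk; have gk' := gaussintN gk.
rewrite TrE gdE !moM ?slT ?sld //; apply: mo_eq; by ring.
Qed.

Lemma gS_0 : gS • (Some 0 : P1) = None.
Proof. by rewrite gSE mo_0 // /cu eqxx. Qed.
Lemma gS_oo : gS • (None : P1) = Some 0.
Proof. by rewrite gSE mo_oo // cu_Some. Qed.

Lemma gS_Some z : z != 0 -> gS • (Some z : P1) = Some (- z^-1).
Proof.
move=> z0; rewrite gSE mo_Some // mul0r add0r mul1r addr0 /cu (negPf z0).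
by rewrite mulNr mul1r.
Qed.

(** * Integer powers of a bijection *)

Section IterZ.
Variables (C : Type) (h hi : C -> C).
Hypotheses (hK : cancel h hi) (hiK : cancel hi h).

Definition iterz (m : int) (c : C) : C :=
  match m with Posz n => iter n h c | Negz n => iter n.+1 hi c end.

Lemma iterzS m c : iterz (m + 1) c = h (iterz m c).
Proof.
case: m => [n|[|n]].
- by rewrite -PoszD addn1.
- by rewrite (_ : Negz 0 + 1 = 0) //= hiK.
- have -> : Negz n.+1 + 1 = Negz n by rewrite !NegzE; lia.
  by rewrite /= hiK.
Qed.

Lemma iterzD m n c : iterz (m + n) c = iterz n (iterz m c).
Proof.
elim/int_rect: n => [|n IH|n IH]; first by rewrite addr0.
  by rewrite intS addrCA addrC iterzS IH -iterzS addrC.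
apply: (can_inj hK); rewrite -!iterzS -addrA.
by rewrite (_ : - n.+1%:Z + 1 = - n%:Z) ?IH // intS; ring.
Qed.

Lemma iterz_comm (e : C -> C) m c : (forall c, e (h c) = h (e c)) ->
  e (iterz m c) = iterz m (e c).
Proof.
move=> eh; have eN n b : e (iter n hi b) = iter n hi (e b).
  by elim: n => //= n IH; apply: (can_inj hK); rewrite -eh !hiK IH.
case: m => [n|n] /=; first by elim: n => //= n IH; rewrite eh IH.
exact: (eN n.+1).
Qed.

Lemma iterz_anti (e : C -> C) m c : (forall c, e (h c) = hi (e c)) ->
  e (iterz m c) = iterz (- m) (e c).
Proof.
move=> eh; have eP n b : e (iter n h b) = iter n hi (e b).
  by elim: n => //= n IH; rewrite eh IH.
have eN n b : e (iter n hi b) = iter n h (e b).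
  by elim: n => //= n IH; apply: (can_inj hiK); rewrite -eh hiK hK IH.
case: m => [[|n]|n] //=; last by rewrite (eN n.+1).
by rewrite (eP n.+1).
Qed.

End IterZ.

Lemma grp_cancel (Gam : groupType) (g h k : Gam) :
  ((g^-1 * h) * (h^-1 * k) = g^-1 * k)%g.
Proof. by rewrite -mulgA mulVKg. Qed.

Section Presentation.
Variables (C : Type) (s r x y : C -> C).
Hypotheses (ss : forall c, s (s c) = c) (rr : forall c, r (r c) = c).
Hypothesis rsrs : forall c, s (r (s (r c))) = c.
Hypothesis xxx : forall c, x (x (x c)) = c.
Hypothesis rxrx : forall c, x (r (x (r c))) = c.
Hypothesis yyy : forall c, y (y (y c)) = c.
Hypothesis xyxy : forall c, y (x (x (y (x (x c))))) = c.
Hypothesis sysy : forall c, y (s (y (s c))) = c.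

(** In a right action the first letter of a word is applied first: [d], [t1], [ti] are the actions
    of R S = [gd], X S = [Tr 1] and Y R = [Tr ii]; primes denote inverses. *)
Let d c := s (r c).
Let t1 c := s (x c).
Let t1' c := x (x (s c)).
Let ti c := r (y c).
Let ti' c := y (y (r c)).

Let rs c : r (s c) = s (r c).
Proof. by have /(congr1 s) := rsrs c; rewrite ss => /(congr1 r); rewrite rr. Qed.

Let sys c : s (y c) = y (y (s c)).
Proof. by have /(congr1 y) := sysy (s c); rewrite ss => /(congr1 y); rewrite yyy. Qed.

Let rxr c : r (x c) = x (x (r c)).
Proof. by have /(congr1 x) := rxrx (r c); rewrite rr => /(congr1 x); rewrite xxx. Qed.

Let yyx c : y (y (x c)) = x (x (y c)).
Proof. by have /(congr1 y) := xyxy (x c); rewrite xxx => /(congr1 y); rewrite yyy. Qed.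

Let t1K : cancel t1 t1'. Proof. by move=> c; rewrite /t1 /t1' ss xxx. Qed.
Let t1'K : cancel t1' t1. Proof. by move=> c; rewrite /t1 /t1' xxx ss. Qed.
Let tiK : cancel ti ti'. Proof. by move=> c; rewrite /ti /ti' rr yyy. Qed.
Let ti'K : cancel ti' ti. Proof. by move=> c; rewrite /ti /ti' yyy rr. Qed.

Let dt1 c : d (t1 c) = t1' (d c).
Proof. by rewrite /d /t1 /t1' ss rs ss rxr. Qed.

Let dti c : d (ti c) = ti' (d c).
Proof. by rewrite /d /ti /ti' rr rs rr sys. Qed.

(** The commutation of the two translations is where the relator (X^-1 Y)^2 enters. *)
Let tt c : ti (t1 c) = t1 (ti c).
Proof.
have ys b : y (s b) = s (y (y b)) by rewrite !sys yyy.
have xr b : x (r b) = r (x (x b)) by rewrite !rxr xxx.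
by rewrite /ti /t1 ys xr rs yyx.
Qed.

Definition Tact (k : F) (c : C) : C :=
  iterz ti ti' (numq (complex.Im k)) (iterz t1 t1' (numq (complex.Re k)) c).

Let numqi (m : int) : numq m%:~R = m. Proof. exact: numq_int. Qed.

Lemma TactD k l c : gaussint k -> gaussint l -> Tact (k + l) c = Tact l (Tact k c).
Proof.
move=> /gaussintP[m [n ->]] /gaussintP[m' [n' ->]]; rewrite /Tact /=.
rewrite -!rmorphD /= !numqi !iterzD //; congr iterz; symmetry.
by apply: iterz_comm => // b; symmetry; apply: iterz_comm => // b'; rewrite tt.
Qed.

Lemma Tactd k c : gaussint k -> s (r (Tact k c)) = Tact (- k) (s (r c)).
Proof.
move=> /gaussintP[m [n ->]]; rewrite /Tact /= -!rmorphN /= !numqi.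
by rewrite -![s (r _)]/(d _) (iterz_anti tiK ti'K _ _ dti) (iterz_anti t1K t1'K _ _ dt1).
Qed.

(* An element z |-> +-z + k of the stabiliser of oo is read off its values at 0, 1. *)
Definition bact (g : G) (c : C) : C :=
  if g • (Some 0 : P1) is Some k then
    if g • (Some 1 : P1) == Some (k + 1) then Tact k c else d (Tact k c)
  else c.

Lemma bactT k c : gaussint k -> bact (Tr k) c = Tact k c.
Proof. by move=> gk; rewrite /bact !Tr_Some // add0r addrC eqxx. Qed.

Lemma bactTd k c : gaussint k -> bact (Tr k * gd)%g c = s (r (Tact k c)).
Proof.
move=> gk; rewrite /bact !gset_actM !gd_Some !Tr_Some // oppr0 add0r.
rewrite (inj_eq Some_inj) addrC (inj_eq (addrI k)).
by rewrite (_ : (- 1 == 1 :> F) = false) //; vm_compute.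
Qed.

Lemma bact1 c : bact 1%g c = c.
Proof. by rewrite -Tr0 bactT. Qed.

Lemma bactd c : bact gd c = s (r c).
Proof. by rewrite -[gd]mul1g -Tr0 bactTd. Qed.

(** The stabiliser of oo is Z[i] extended by [gd], which inverts translations by conjugation. The
    relations needed are that the translations commute, [Tactd], and that [gd] acts as an
    involution. *)
Lemma bactM g h c : g • (None : P1) = None -> h • (None : P1) = None ->
  bact (g * h)%g c = bact h (bact g c).
Proof.
move=> /stab_oo[k gk Eg] /stab_oo[l gl Eh].
have gNl := gaussintN gl; have gkl := gaussintD gk gl; have gkNl := gaussintD gk gNl.
case: Eg => ->; case: Eh => ->.
- by rewrite TrD // !bactT // TactD.
- by rewrite mulgA TrD // !bactTd // bactT // TactD.
- rewrite -mulgA gdT // mulgA TrD // !bactTd // bactT // TactD //.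
  by rewrite Tactd // opprK.
- rewrite -!mulgA (mulgA gd) gdT // -mulgA gdd mulg1 TrD // !bactTd // bactT // TactD //.
  by rewrite Tactd // [s (r (s _))]rsrs.
Qed.

End Presentation.

(** * From an action of the stabiliser of a cusp to a function on the whole group *)

Section Cover.
Variables (Gam : groupType) (T : gset Gam) (oo o : T) (gs gz : Gam).
Variables (C : Type) (s : C -> C) (act : Gam -> C -> C).
Hypotheses (gs_oo : gs • oo = o) (gs_o : gs • o = oo) (gsgs : (gs * gs = 1)%g).
Hypothesis trans : forall al : T, exists g : Gam, g • oo = al.
Hypothesis act1 : forall c, act 1%g c = c.
Hypothesis actM : forall g h c, g • oo = oo -> h • oo = oo ->
  act (g * h)%g c = act h (act g c).
Hypothesis stab_edge : forall g, g • oo = oo -> g • o = o -> g = 1%g \/ g = gz.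
Hypotheses (gz_oo : gz • oo = oo) (gzgz : (gz * gz = 1)%g) (gzs : (gz * gs = gs * gz)%g).
Hypotheses (ss : forall c, s (s c) = c) (zs : forall c, act gz (s c) = s (act gz c)).

Let stabB (g h : Gam) : g • oo = h • oo -> (h^-1 * g)%g • oo = oo.
Proof. by rewrite gset_actM => ->; rewrite gactK. Qed.

Let act_comp g h k c : g • oo = h • oo -> h • oo = k • oo ->
  act (h^-1 * k)%g (act (g^-1 * h)%g c) = act (g^-1 * k)%g c.
Proof.
by move=> E E'; rewrite -(actM _ (stabB (esym E)) (stabB (esym E'))) grp_cancel.
Qed.

Let actzz c : act gz (act gz c) = c.
Proof. by rewrite -actM // gzgz act1. Qed.

(** The chosen frame at each cusp. A value attached to a cusp is meant as the state in this
    frame. *)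
Let sel al : Gam := sval (cid (trans al)).
Let selP al : sel al • oo = al. Proof. exact: svalP (cid (trans al)). Qed.

(** Transport along the edge from g oo to g o: change from the chosen frame to g, apply s to reach
    the frame g gs at the other end, then pass to the chosen frame there. *)
Let fg (g : Gam) (c : C) : C :=
  act ((g * gs)^-1 * sel (g • o))%g (s (act ((sel (g • oo))^-1 * g)%g c)).

Let gs0 g : (g * gs)%g • oo = g • o. Proof. by rewrite gset_actM gs_oo. Qed.
Let gs1 g : (g * gs)%g • o = g • oo. Proof. by rewrite gset_actM gs_o. Qed.

(** Two frames of one ordered edge differ at most by [gz]. It enters the first change of frame,
    passes through s by [zs], and cancels against the second change since [gz] commutes with gs and
    has order 2. *)
Let fg_eq g g' c : g • oo = g' • oo -> g • o = g' • o -> fg g c = fg g' c.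
Proof.
move=> E1 E2.
have F1 : (g'^-1 * g)%g • oo = oo by exact: stabB.
have F2 : (g'^-1 * g)%g • o = o by rewrite gset_actM E2 gactK.
have [E|E] := stab_edge F1 F2.
  by rewrite (_ : g = g') // -(mulVKg g' g) E mulg1.
have Eg : g = (g' * gz)%g by rewrite -E mulVKg.
have E3 : g' • oo = sel (g' • oo) • oo by rewrite selP.
have E4 : sel (g' • o) • oo = (g' * gs)%g • oo by rewrite selP gs0.
rewrite /fg E1 E2 Eg mulgA (actM _ (stabB E3) gz_oo) -zs.
have -> : ((g' * gz * gs)^-1 = gz^-1 * (g' * gs)^-1)%g.
  by rewrite -mulgA gzs mulgA invgM.
have -> : (gz^-1 = gz)%g by apply: (mulgI gz); rewrite mulgV gzgz.
by rewrite -[(gz * _ * _)%g]mulgA (actM _ gz_oo (stabB E4)) actzz.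
Qed.

(** The transport made a function of the endpoints; the identity on non-edges is a default. *)
Definition transp_edge (al be : T) (c : C) : C :=
  if pselect (exists g : Gam, g • oo = al /\ g • o = be) is left h
  then fg (sval (cid h)) c else c.

Let tE g c : transp_edge (g • oo) (g • o) c = fg g c.
Proof.
rewrite /transp_edge; case: pselect => [h|[]]; last by exists g.
by case: cid => g' [E1 E2] /=; apply: fg_eq.
Qed.

(** The state in the frame g of a value stored at the cusp g oo. Through it, [tN] turns edge
    transport into plain application of s. *)
Let N (g : Gam) (c : C) : C := act ((sel (g • oo))^-1 * g)%g c.

Let NM g k c : k • oo = oo -> N (g * k)%g c = act k (N g c).
Proof.
move=> ek; rewrite /N gset_actM ek -actM ?mulgA //.
by apply: stabB; rewrite selP.
Qed.

Let N_inj g : injective (N g).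
Proof.
move=> c c' /(congr1 (act (g^-1 * sel (g • oo))%g)).
by rewrite /N !act_comp ?selP // mulVg !act1.
Qed.

Let N_surj g c : exists c', N g c' = c.
Proof.
exists (act (g^-1 * sel (g • oo))%g c).
by rewrite /N !act_comp ?selP // mulVg !act1.
Qed.

Let tN g c : N (g * gs)%g (transp_edge (g • oo) (g • o) c) = s (N g c).
Proof. by rewrite tE /N /fg gs0 act_comp ?selP ?gs0 // mulVg act1. Qed.

Lemma transp_edgeK g c :
  transp_edge (g • o) (g • oo) (transp_edge (g • oo) (g • o) c) = c.
Proof.
apply: (@N_inj g); have := tN (g * gs)%g (transp_edge (g • oo) (g • o) c).
by rewrite gs0 gs1 -mulgA gsgs mulg1 tN ss.
Qed.

(** Following frames around the triangle leads from g to g h with h fixing oo. The loop closes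
    because the word gs k gs l gs acts as h does, which is the hypothesis [Ec]. *)
Lemma transp_edge3 g k l h c : k • oo = oo -> l • oo = oo -> h • oo = oo ->
  (gs * k * gs * l * gs = h)%g ->
  (forall c, s (act l (s (act k (s c)))) = act h c) ->
  let ga := (g * gs * k)%g • o in
  transp_edge ga (g • oo) (transp_edge (g • o) ga (transp_edge (g • oo) (g • o) c)) = c.
Proof.
move=> ek el eh Eh Ec ga.
have E1 : (g * gs * k)%g • oo = g • o by rewrite gset_actM ek gs0.
have E2 : (g * gs * k * gs * l)%g • oo = ga by rewrite gset_actM el gs0.
have Eg : (g * gs * k * gs * l * gs = g * h)%g by rewrite -Eh !mulgA.
have E3 : (g * gs * k * gs * l)%g • o = g • oo.
  by rewrite -gs0 Eg gset_actM eh.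
set c1 := transp_edge (g • oo) (g • o) c.
set c2 := transp_edge (g • o) ga c1; set c3 := transp_edge ga (g • oo) c2.
have F1 : N (g * gs)%g c1 = s (N g c) by exact: tN.
have F2 : N (g * gs * k * gs)%g c2 = s (act k (s (N g c))).
  by have := tN (g * gs * k)%g c1; rewrite E1 (NM _ _ ek) F1.
have F3 : N (g * h)%g c3 = s (act l (s (act k (s (N g c))))).
  by have := tN (g * gs * k * gs * l)%g c2; rewrite Eg E2 E3 (NM _ _ el) F2.
by apply: (@N_inj (g * h)%g); rewrite F3 Ec NM.
Qed.

(** Reading the value of a section at g oo in the frame g defines phi g. The starting value is the
    one whose state in the frame 1 is [c0]. *)
Lemma cover_section (c0 : C) :
  (forall x, exists sg : T -> C, sg oo = x /\
     forall g, sg (g • o) = transp_edge (g • oo) (g • o) (sg (g • oo))) ->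
  exists phi : Gam -> C, [/\ phi 1%g = c0,
    forall g k, k • oo = oo -> phi (g * k)%g = act k (phi g) &
    forall g, phi (g * gs)%g = s (phi g)].
Proof.
have [x0 Ex0] := N_surj 1%g c0 => /(_ x0) [sg [sg0 sgE]].
exists (fun g => N g (sg (g • oo))); split.
- by rewrite gset_act1 sg0.
- by move=> g k ek; rewrite NM // gset_actM ek.
- by move=> g; rewrite gs0 sgE tN.
Qed.

End Cover.

Section PresentationAction.
Variables (C : Type) (s r x y : C -> C).
Hypotheses (ss : forall c, s (s c) = c) (rr : forall c, r (r c) = c).
Hypothesis rsrs : forall c, s (r (s (r c))) = c.
Hypothesis xxx : forall c, x (x (x c)) = c.
Hypothesis rxrx : forall c, x (r (x (r c))) = c.
Hypothesis yyy : forall c, y (y (y c)) = c.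
Hypothesis xyxy : forall c, y (x (x (y (x (x c))))) = c.
Hypothesis sysy : forall c, y (s (y (s c))) = c.

Let act := bact s r x y.

Let stab_edge g : g • (None : P1) = None -> g • (Some 0 : P1) = Some 0 -> g = 1%g \/ g = gd.
Proof.
move=> /stab_oo[k gk [->|->]]; rewrite ?gset_actM ?gd_Some Tr_Some ?oppr0 ?add0r // => -[->].
  by left; rewrite Tr0.
by right; rewrite Tr0 mul1g.
Qed.

Let rs c : r (s c) = s (r c).
Proof. by have /(congr1 s) := rsrs c; rewrite ss => /(congr1 r); rewrite rr. Qed.

(* The third vertex u of the triangle (oo, 0, u), for a unit u, is S T(-u') 0. *)
Let triangle_word (u u' : F) : u \in gunits -> u * u' = 1 ->
  exists h, [/\ h • (None : P1) = None, (gS * Tr (- u') * gS * Tr (- u) * gS = h)%g &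
    forall c, s (act (Tr (- u)) (s (act (Tr (- u')) (s c)))) = act h c].
Proof.
have sys c : s (y c) = y (y (s c)).
  by have /(congr1 y) := sysy (s c); rewrite ss => /(congr1 y); rewrite yyy.
have ys c : y (s c) = s (y (y c)) by rewrite !sys yyy.
have T1 c : act (Tr 1) c = s (x c) by rewrite /act bactT.
have TN1 c : act (Tr (-1)) c = x (x (s c)) by rewrite /act bactT.
have Ti c : act (Tr ii) c = r (y c) by rewrite /act bactT.
have TNi c : act (Tr (- ii)) c = y (y (r c)) by rewrite /act bactT.
move=> uu E; have uu' : u' = u^-1.
  by apply: (mulfI (gunits_neq0 uu)); rewrite E mulfV // gunits_neq0.
have Tid c : act (Tr ii * gd)%g c = s (y c) by rewrite /act bactTd // -bactT // [bact _ _ _ _ _ _]Ti rr.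
have TNid c : act (Tr (- ii) * gd)%g c = s (r (y (y (r c)))).
  by rewrite /act bactTd // -bactT // [bact _ _ _ _ _ _]TNi.
have slN1 : sl 1 (-1) 0 1 by []. have sl1 : sl 1 1 0 1 by [].
have sli : sl 1 ii 0 1 by []. have slNi : sl 1 (- ii) 0 1 by [].
(* The word S T(-u') S T(-u) S is z |-> u^2 z + u, a translation for u = +-1 and z |-> -z + u for u
   = +-i; this gives the four witnesses. *)
move: uu; rewrite !inE => /or4P[] /eqP Eu; subst u; rewrite {}uu' {E}.
- rewrite invr1; exists (Tr 1); split; first exact: Tr_oo.
    by mocalc.
  by move=> c; rewrite T1 !TN1 !ss xxx.
- rewrite invrN1 opprK; exists (Tr (- 1)); split; first exact: Tr_oo.
    by mocalc.
  by move=> c; rewrite TN1 !T1 !ss.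
- have -> : ii^-1 = - ii by vmeq.
  rewrite opprK; exists (Tr ii * gd)%g; split.
    by rewrite gset_actM gd_oo Tr_oo.
    by mocalc.
  by move=> c; rewrite Tid Ti TNi rs !rr [y (s c)]ys ss yyy.
- have -> : (- ii)^-1 = ii by vmeq.
  rewrite opprK; exists (Tr (- ii) * gd)%g; split.
    by rewrite gset_actM gd_oo Tr_oo.
    by mocalc.
  by move=> c; rewrite TNid Ti TNi [y (s (y _))]ys yyy rs ss rs ys rs.
Qed.

(* The Bianchi-Farey complex is simply connected, hence every right action of
   the presented group descends to PSL_2(Z[i]). *)
Theorem presentation_action (c0 : C) : exists phi : G -> C,
  phi 1%g = c0 /\ forall g,
  [/\ phi (g * gS)%g = s (phi g), phi (g * gR)%g = r (phi g),
      phi (g * gX)%g = x (phi g) & phi (g * gY)%g = y (phi g)].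
Proof.
have trans (al : P1) : exists g : G, g • (None : P1) = al.
  by have [g _ E] := @cusp_gen (fun=> True) I (fun _ _ _ _ => I) (fun _ _ => I) al; exists g.
have actM g h c : g • (None : P1) = None -> h • (None : P1) = None ->
    act (g * h)%g c = act h (act g c) by exact: bactM.
have act1 c : act 1%g c = c by exact: bact1.
have actd c : act gd c = s (r c) by exact: bactd.
have zs c : act gd (s c) = s (act gd c) by rewrite !actd rs.
have gzs : (gd * gS = gS * gd)%g by rewrite gdS gSd.
have trK := transp_edgeK gS_oo gS_0 gSS trans act1 actM stab_edge gd_oo gdd gzs ss zs.
have tr3 := transp_edge3 gS_oo trans act1 actM stab_edge gd_oo gdd gzs zs.
have [x1|phi [phi1 phiB phiS]] :=
  @cover_section _ _ _ _ _ _ _ _ _ gS_oo trans act1 actM stab_edge gd_oo gdd gzs zs c0.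
  have [al be c|al be ga c|sg [sg0 sgE]] := flat_section (f := transp_edge (Some 0 : P1) gS s act trans) x1.
  - move=> /gauss_edge_cu[a [b [a' [b' [sl -> ->]]]]].
    by have := trK (mo a b a' b') c; rewrite mo_oo // mo_0.
  - move=> /gauss_triP[a [b [a' [b' [u [sl uu -> -> ->]]]]]].
    have [u' uu' E] := gunits_inv uu; have gu := gunits_gauss uu; have gu' := gunits_gauss uu'.
    have [h [eh Eh Ec]] := triangle_word uu E.
    have := tr3 (mo a b a' b') _ _ h c (Tr_oo (gaussintN gu')) (Tr_oo (gaussintN gu)) eh Eh Ec.
    rewrite !gset_actM Tr_Some ?gaussintN // add0r gS_Some ?oppr_eq0 ?gunits_neq0 //.
    rewrite invrN opprK (_ : u'^-1 = u) ?mo_oo ?mo_0 ?mo_Some //.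
    by apply: (mulIf (gunits_neq0 uu')); rewrite mulVf ?gunits_neq0.
  exists sg; split=> // g; apply: sgE.
  by apply: gauss_edge_act; rewrite cu_oo cu_Some; apply: (@gauss_edge_sl 1 0 0 1).
have phiR g : phi (g * gR)%g = r (phi g).
  by rewrite -gdS mulgA phiS phiB ?gd_oo // actd ss.
exists phi; split=> // g; split=> //.
  rewrite -gT1S mulgA phiS phiB ?Tr_oo //.
  by rewrite /act bactT // -[RHS]ss.
rewrite -gTiR mulgA phiR phiB ?Tr_oo //.
by rewrite /act bactT // -[RHS]rr.
Qed.

End PresentationAction.

(** * Cells of the octahedron *)

Section FsetAct.
Variables (Gam : groupType) (T : gset Gam).
Implicit Types (g : Gam) (A B : {fset T}) (x y z : T).
Local Notation "g •• A" := (fset_act g A) : gset_scope.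

Lemma fset_actK g A : g^-1%g •• g •• A = A.
Proof. by rewrite -fset_actM mulVg fset_act1. Qed.

Lemma fset_actVK g A : g •• g^-1%g •• A = A.
Proof. by rewrite -fset_actM mulgV fset_act1. Qed.

Lemma mem_fset_act g A x : x \in A -> g • x \in g •• A.
Proof. by move=> xA; apply/imfsetP; exists x. Qed.

Lemma in_fset_act g A x : (x \in g •• A) = (g^-1%g • x \in A).
Proof.
apply/idP/idP => [/imfsetP[y /= yA ->]|/(mem_fset_act g)]; first by rewrite gactK.
by rewrite gactVK.
Qed.

Lemma fset_act_inj g A B : g •• A = g •• B -> A = B.
Proof. by move=> E; rewrite -[A](fset_actK g) E fset_actK. Qed.

Lemma fset_act_sub g A B : (g •• A `<=` g •• B)%fset = (A `<=` B)%fset.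
Proof.
apply/fsubsetP/fsubsetP => H x xA; last first.
  by rewrite in_fset_act; apply: H; rewrite -in_fset_act.
by have := H (g • x); rewrite !in_fset_act gactK; apply.
Qed.

Lemma card_fset_act g A : #|` g •• A|%fset = #|` A|%fset.
Proof. by rewrite card_imfset //; apply: gact_inj. Qed.

Lemma fset_act_pair g (x y : T) : g •• [fset x; y]%fset = [fset g • x; g • y]%fset.
Proof. exact: imfset_fset2. Qed.

Lemma fset_act_triple g (x y z : T) :
  g •• [fset x; y; z]%fset = [fset g • x; g • y; g • z]%fset.
Proof. by rewrite [LHS]imfsetU [X in (X `|` _)%fset]imfset_fset2 imfset_fset1. Qed.

Lemma fset_act_setD g A B : g •• (A `\` B)%fset = ((g •• A) `\` (g •• B))%fset.
Proof. by apply/fsetP => x; rewrite !(in_fset_act, inE). Qed.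

End FsetAct.

(** Homogeneous coordinates free of matrices, so that the sign of [side] can be evaluated by
    [vm_compute]. *)
Definition nume (z : P1) : F := if z is Some x then x else 1.
Definition deno (z : P1) : F := if z is Some x then 1 else 0.

Lemma wedgeE a b : wedge a b = nume a * deno b - deno a * nume b.
Proof. by rewrite /wedge !mxE; case: a => [?|]; case: b => [?|]. Qed.

Lemma nume_deno_nz z : nz (nume z) (deno z).
Proof. by case: z => [z|]; [exact: nzx1|exact: nz10]. Qed.

Lemma cu_nume z : cu (nume z) (deno z) = z.
Proof. by case: z => [z|]; rewrite /nume /deno -?cu_Some -?cu_oo. Qed.

Lemma cu_scale x y : nz x y ->
  exists2 t, t != 0 & x = t * nume (cu x y) /\ y = t * deno (cu x y).
Proof.
rewrite /nz /cu; have [->|y0] := eqVneq y 0.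
  by rewrite orbF => x0; exists x; rewrite //= mulr1 mulr0.
by move=> _; exists y; rewrite //= mulr1 mulrC divfK.
Qed.

Lemma wedge_det (p q p' q' x y x' y' : F) :
  (p * q' - q * p') * (x * y' - y * x') =
  (p * x + q * y) * (p' * x' + q' * y') - (p' * x + q' * y) * (p * x' + q * y').
Proof. by ring. Qed.

Lemma wedge_scale (X Y X' Y' t t' x y x' y' : F) :
  X = t * x -> Y = t * y -> X' = t' * x' -> Y' = t' * y' ->
  X * Y' - Y * X' = t * t' * (x * y' - y * x').
Proof. by move=> -> -> -> ->; ring. Qed.

(** A matrix of determinant 1 preserves the wedge of two lifts; [t] records how far the image of a
    normalised lift is from being normalised. *)
Lemma wedge_act g : exists t : P1 -> F, (forall z, t z != 0) /\
  forall a b, wedge a b = t a * t b * wedge (g • a) (g • b).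
Proof.
have [p [q [p' [q' [s ->]]]]] := moP g.
have H z : exists t, t != 0 /\
    p * nume z + q * deno z = t * nume (mo p q p' q' • z) /\
    p' * nume z + q' * deno z = t * deno (mo p q p' q' • z).
  have := cu_scale (sl_nz s (nume_deno_nz z)).
  rewrite -mo_cu ?nume_deno_nz // cu_nume => -[t t0 E]; by exists t.
have [t Ht] := choice H; exists t; split=> [z|a b]; first by case: (Ht z).
have [_ [Ea1 Ea2]] := Ht a; have [_ [Eb1 Eb2]] := Ht b.
rewrite !wedgeE; case/slP: s => _ _ _ _ E.
by rewrite -(wedge_scale Ea1 Ea2 Eb1 Eb2) -(wedge_det _ _ _ _ _ _ _ _) E mul1r.
Qed.

Lemma cross_ratio_scale (z a b c w1 w2 w3 w4 : F) :
  z != 0 -> a != 0 -> b != 0 -> c != 0 ->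
  (z * a * w1) * (b * c * w2) / ((z * c * w3) * (b * a * w4)) = w1 * w2 / (w3 * w4).
Proof.
move=> z0 a0 b0 c0; have T : z * a * b * c != 0 by rewrite !mulf_neq0.
by rewrite -[RHS]mul1r -(divff T) mulf_div; congr (_ / _); ring.
Qed.

(** Each cusp occurs once in the numerator and once in the denominator of the cross-ratio, so the
    scaling factors cancel. *)
Lemma side_act g a b c z : side (g • a) (g • b) (g • c) (g • z) = side a b c z.
Proof.
have [t [t0 H]] := wedge_act g; rewrite /side; congr (complex.Im _).
rewrite (H z a) (H b c) (H z c) (H b a).
exact/esym/cross_ratio_scale.
Qed.

Lemma is_face_act g V A : is_face V A -> is_face (g •• V) (g •• A).
Proof.
move=> [sub [a [b [c [E n H]]]]]; split; first by rewrite fset_act_sub.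
exists (g • a), (g • b), (g • c); split.
- by rewrite E fset_act_triple.
- by rewrite card_fset_act.
- move=> z; rewrite -fset_act_setD in_fset_act => /H.
  by rewrite -(side_act g) gactVK.
Qed.

Lemma is_faceE g V A : is_face (g •• V) (g •• A) <-> is_face V A.
Proof.
by split=> [/(is_face_act g^-1%g)|]; [rewrite !fset_actK|apply: is_face_act].
Qed.

Lemma is_edge_act g V A : is_edge V A -> is_edge (g •• V) (g •• A).
Proof.
move=> [n [T f s]]; split; first by rewrite card_fset_act.
by exists (g •• T); [exact: is_face_act|rewrite fset_act_sub].
Qed.

Lemma is_edgeE g V A : is_edge (g •• V) (g •• A) <-> is_edge V A.
Proof.
by split=> [/(is_edge_act g^-1%g)|]; [rewrite !fset_actK|apply: is_edge_act].
Qed.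

(* Inverses are not needed, as X and Y have order 3. *)
Inductive Kxy : G -> Prop :=
| Kxy1 : Kxy 1%g
| KxyX k : Kxy k -> Kxy (k * gX)%g
| KxyY k : Kxy k -> Kxy (k * gY)%g.

Lemma KxyM k k' : Kxy k -> Kxy k' -> Kxy (k * k')%g.
Proof.
move=> Kk; elim=> [|k1 _ IH|k1 _ IH]; rewrite ?mulg1 // mulgA.
  exact: KxyX.
exact: KxyY.
Qed.

Lemma gXXX : (gX * gX * gX = 1)%g.
Proof. by rewrite -mo1; mocalc. Qed.
Lemma gYYY : (gY * gY * gY = 1)%g.
Proof. by rewrite -mo1; mocalc. Qed.
Lemma gXV : (gX^-1 = gX * gX)%g.
Proof. by apply: (mulgI gX); rewrite mulgV mulgA gXXX. Qed.
Lemma gYV : (gY^-1 = gY * gY)%g.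
Proof. by apply: (mulgI gY); rewrite mulgV mulgA gYYY. Qed.

Lemma Kxy_X : Kxy gX. Proof. by rewrite -[gX]mul1g; apply/KxyX/Kxy1. Qed.
Lemma Kxy_Y : Kxy gY. Proof. by rewrite -[gY]mul1g; apply/KxyY/Kxy1. Qed.

Lemma KxyV k : Kxy k -> Kxy k^-1%g.
Proof.
elim=> [|k1 _ IH|k1 _ IH]; rewrite ?invg1 ?invgM ?gXV ?gYV; first exact: Kxy1.
  by do 2!apply: KxyM => //; apply: Kxy_X.
by do 2!apply: KxyM => //; apply: Kxy_Y.
Qed.

Definition mact (a b c d : F) (z : P1) : P1 :=
  if z is Some z then cu (a * z + b) (c * z + d) else cu a c.

Lemma moact a b c d z : sl a b c d -> mo a b c d • z = mact a b c d z.
Proof. by move=> s; case: z => [z|]; rewrite /mact ?mo_Some ?mo_oo. Qed.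

Definition xact := mact 1 (-1) 1 0.
Definition yact := mact (-1) ii ii 0.

Lemma gXact z : gX • z = xact z. Proof. by rewrite gXE moact. Qed.
Lemma gYact z : gY • z = yact z. Proof. by rewrite gYE moact. Qed.

Definition wact (w : seq bool) (z : P1) : P1 :=
  foldr (fun b z => if b then xact z else yact z) z w.

Lemma wactP w : exists2 k, Kxy k & forall z, k • z = wact w z.
Proof.
elim: w => [|b w [k Kk Ek]]; first by exists 1%g; [exact: Kxy1|move=> z; rewrite gset_act1].
exists ((if b then gX else gY) * k)%g; last first.
  by move=> z; rewrite gset_actM Ek; case: b; [exact: gXact|exact: gYact].
by apply: KxyM => //; case: b; [exact: Kxy_X|exact: Kxy_Y].
Qed.

(** * Faces, edges and stabiliser of the standard octahedron, by computation *)

Definition oseq : seq P1 :=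
  [:: None; Some 0; Some 1; Some ii; Some (1 + ii); Some ((1 + ii) / 2%:R)].

Lemma mem_Oct z : (z \in verts octahedron) = (z \in oseq).
Proof. by apply/imfsetP/idP => [[y /= yO ->]|zO]; last exists z. Qed.

(** The inverse of an element of order 3 is its square, so mapping vertices to vertices already
    gives equality. *)
Lemma Oct_act g : (forall z, z \in oseq -> g • z \in oseq) -> (g * g * g = 1)%g ->
  g •• verts octahedron = verts octahedron.
Proof.
move=> H E; have E' : (g^-1 = g * g)%g by apply: (mulgI g); rewrite mulgV mulgA.
apply/fsetP => z; rewrite in_fset_act !mem_Oct E' gset_actM.
apply/idP/idP => zO; last exact: (H _ (H _ zO)).
by rewrite -[z]gset_act1 -E !gset_actM; exact: (H _ zO).
Qed.

Lemma Oct_X : gX •• verts octahedron = verts octahedron.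
Proof.
have /allP H : all (fun z => xact z \in oseq) oseq by vm_compute.
by apply: (Oct_act _ gXXX) => z /H; rewrite -gXact.
Qed.

Lemma Oct_Y : gY •• verts octahedron = verts octahedron.
Proof.
have /allP H : all (fun z => yact z \in oseq) oseq by vm_compute.
by apply: (Oct_act _ gYYY) => z /H; rewrite -gYact.
Qed.

Lemma Kxy_Oct k : Kxy k -> k •• verts octahedron = verts octahedron.
Proof.
elim=> [|k1 _ IH|k1 _ IH]; first exact: fset_act1.
  by rewrite fset_actM Oct_X.
by rewrite fset_actM Oct_Y.
Qed.

Definition wedgeb (a b : P1) : F := nume a * deno b - deno a * nume b.
Definition sideb (a b c z : P1) : rat :=
  complex.Im ((wedgeb z a * wedgeb b c) / (wedgeb z c * wedgeb b a)).

Lemma sideE a b c z : side a b c z = sideb a b c z.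
Proof. by rewrite /side !wedgeE. Qed.

Definition face_test (a b c : P1) : bool :=
  all (fun z => (z \in [:: a; b; c]) || (0 < sideb a b c z)) oseq.

Definition base_R : seq P1 := [:: Some 0; Some 1; None].
Definition base_S : seq P1 := [:: Some ii; Some 0; None].

Definition base_face (b : bool) : seq P1 := if b then base_R else base_S.

(** One word in X and Y for each of the eight faces, true being X; the last flag tells a translate
    of [F_R] from one of [F_S]. Completeness is certified by [face_enum]. *)
Definition face_words : seq (seq bool * bool) :=
  [:: ([::], true); ([:: false], true); ([:: false; false], true); ([:: true; false], true);
      ([::], false); ([:: true], false); ([:: true; true], false); ([:: false; true], false)].

Definition wface (p : seq bool * bool) : seq P1 :=
  map (wact p.1) (base_face p.2).

Lemma face_enum : let L := map wface face_words in
  all (fun a => all (fun b => all (fun c =>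
  [|| ~~ uniq [:: a; b; c], ~~ face_test a b c | has (perm_eq [:: a; b; c]) L])
  oseq) oseq) oseq.
Proof. by vm_compute. Qed.

Lemma fset_seq3 (a b c : P1) : [fset a; b; c]%fset = [fset x in [:: a; b; c]]%fset.
Proof. by apply/fsetP => z; rewrite !inE orbF orbA. Qed.

Lemma face_testP a b c : uniq [:: a; b; c] -> {subset [:: a; b; c] <= oseq} ->
  face_test a b c -> is_face (verts octahedron) [fset a; b; c]%fset.
Proof.
rewrite fset_seq3 => u sub /allP H; split.
  by apply/fsubsetP => z; rewrite in_fset mem_Oct => /sub.
exists a, b, c; split; first by rewrite fset_seq3.
  by rewrite card_fseq undup_id.
move=> z; rewrite in_fsetD in_fset mem_Oct => /andP[zT /H].
by rewrite sideE (negPf zT).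
Qed.

Lemma F_R_seq : F_R = [fset x in base_R]%fset. Proof. exact: fset_seq3. Qed.
Lemma F_S_seq : F_S = [fset x in base_S]%fset. Proof. exact: fset_seq3. Qed.

Lemma face_R : is_face (verts octahedron) F_R.
Proof.
apply: face_testP; [by vm_compute| |by vm_compute].
by apply/allP; vm_compute.
Qed.

Lemma face_S : is_face (verts octahedron) F_S.
Proof.
apply: face_testP; [by vm_compute| |by vm_compute].
by apply/allP; vm_compute.
Qed.

Lemma wface_Kxy p : exists2 k, Kxy k & [fset x in wface p]%fset = k •• (if p.2 then F_R else F_S).
Proof.
case: p => w b; have [k Kk Ek] := wactP w; exists k => //.
have -> : (if b then F_R else F_S) = [fset x in base_face b]%fset.
  by case: b; rewrite ?F_R_seq ?F_S_seq.
apply/fsetP => z; rewrite in_fset_act !inE /wface.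
rewrite -{1}(gactVK k z) Ek mem_map // => x y; rewrite -!Ek; exact: gact_inj.
Qed.

(** An exhaustive check over vertex triples. It reduces crossing any face to R or S, up to elements
    of K. *)
Lemma face_OctP A : is_face (verts octahedron) A <->
  exists2 k, Kxy k & A = k •• F_R \/ A = k •• F_S.
Proof.
split=> [[sub [a [b [c [E n H]]]]]|[k Kk [->|->]]]; last 2 first.
- by rewrite -(Kxy_Oct Kk) is_faceE; exact: face_R.
- by rewrite -(Kxy_Oct Kk) is_faceE; exact: face_S.
have inO z : z \in [:: a; b; c] -> z \in oseq.
  by move=> zT; rewrite -mem_Oct; apply: (fsubsetP sub); rewrite E fset_seq3 in_fset.
have u : uniq [:: a; b; c].
  by move: n; rewrite E fset_seq3 card_fseq -[uniq _]negbK -ltn_size_undup => ->.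
have t : face_test a b c.
  apply/allP => z zO; case: (boolP (z \in [:: a; b; c])) => //= zT.
  by rewrite -sideE; apply: H; rewrite in_fsetD mem_Oct zO E fset_seq3 in_fset zT.
have /allP/(_ a) := face_enum; rewrite inO ?inE ?eqxx // => /(_ isT).
move=> /allP/(_ b); rewrite inO ?inE ?eqxx ?orbT // => /(_ isT).
move=> /allP/(_ c); rewrite inO ?inE ?eqxx ?orbT // => /(_ isT).
rewrite u t => /hasP[l /mapP[p _ ->] pe].
have [k Kk Ek] := wface_Kxy p; exists k => //.
have -> : A = [fset x in wface p]%fset.
  by rewrite E fset_seq3; apply/fsetP => z; rewrite !in_fset (perm_mem pe).
by rewrite Ek; case: (p.2); [left|right].
Qed.

Definition e0 : {fset P1} := [fset (None : P1); Some 0]%fset.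

Lemma fset_sub_pairs (K : choiceType) (a b c : K) (E : {fset K}) :
  (E `<=` [fset a; b; c])%fset -> #|` E|%fset = 2%N ->
  [\/ E = [fset a; b]%fset, E = [fset b; c]%fset | E = [fset c; a]%fset].
Proof.
move=> sub n; have [p [q [Epq]]] : exists p q : K, E = [fset p; q]%fset /\ p != q.
  have /fset0Pn[p pE] : E != fset0 by rewrite -cardfs_gt0 n.
  have : #|` E `\ p|%fset == 1%N by move: n; rewrite (cardfsD1 p E) pE add1n => -[->].
  move=> /cardfs1P[q Eq]; exists p, q; rewrite -Eq fsetD1K //; split=> //.
  have : q \in (E `\ p)%fset by rewrite Eq inE.
  by rewrite !inE eq_sym => /andP[].
have pin : p \in [fset a; b; c]%fset by apply: (fsubsetP sub); rewrite Epq !inE eqxx.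
have qin : q \in [fset a; b; c]%fset by apply: (fsubsetP sub); rewrite Epq !inE eqxx orbT.
move: pin qin; rewrite Epq !inE => /orP[/orP[]|] /eqP -> /orP[/orP[]|] /eqP ->;
  rewrite ?eqxx // => _; by [apply: Or31|apply: Or32|apply: Or33
    |apply: Or31; rewrite fsetUC|apply: Or32; rewrite fsetUC|apply: Or33; rewrite fsetUC].
Qed.

Lemma e0_F_R : (e0 `<=` F_R)%fset.
Proof. by apply/fsubsetP => z; rewrite !inE => /orP[] /eqP ->; rewrite eqxx ?orbT. Qed.
Lemma e0_F_S : (e0 `<=` F_S)%fset.
Proof. by apply/fsubsetP => z; rewrite !inE => /orP[] /eqP ->; rewrite eqxx ?orbT. Qed.

Lemma card_e0 : #|` e0|%fset = 2%N.
Proof. by rewrite cardfs2. Qed.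

Lemma gX_oo : gX • (None : P1) = Some 1. Proof. by rewrite gXact; vmeq. Qed.
Lemma gX_0 : gX • (Some 0 : P1) = None. Proof. by rewrite gXact; vmeq. Qed.
Lemma gX_1 : gX • (Some 1 : P1) = Some 0. Proof. by rewrite gXact; vmeq. Qed.
Lemma gY_oo : gY • (None : P1) = Some ii. Proof. by rewrite gYact; vmeq. Qed.
Lemma gY_0 : gY • (Some 0 : P1) = None. Proof. by rewrite gYact; vmeq. Qed.
Lemma gY_ii : gY • (Some ii : P1) = Some 0. Proof. by rewrite gYact; vmeq. Qed.

(** X rotates [F_R] and Y rotates [F_S], so the sides of both faces are translates of the edge from
    0 to oo. *)
Lemma edge_in_face (E : {fset P1}) : (E `<=` F_R)%fset \/ (E `<=` F_S)%fset ->
  #|` E|%fset = 2%N -> exists2 k, Kxy k & E = k •• e0.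
Proof.
move=> sub n; case: sub => sub; have [->|->|->] := fset_sub_pairs sub n.
- exists (gX * gX)%g; first by apply: KxyM; exact: Kxy_X.
  by rewrite fset_actM !fset_act_pair gX_oo gX_0 gX_oo gX_1.
- exists gX; first exact: Kxy_X.
  by rewrite fset_act_pair gX_oo gX_0.
- by exists 1%g; [exact: Kxy1|rewrite fset_act1].
- exists (gY * gY)%g; first by apply: KxyM; exact: Kxy_Y.
  by rewrite fset_actM !fset_act_pair gY_oo gY_0 gY_oo gY_ii fsetUC.
- by exists 1%g; [exact: Kxy1|rewrite fset_act1 fsetUC].
- exists gY; first exact: Kxy_Y.
  by rewrite fset_act_pair gY_oo gY_0 fsetUC.
Qed.

Lemma edge_OctP A : is_edge (verts octahedron) A <-> exists2 k, Kxy k & A = k •• e0.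
Proof.
split=> [[n [T /face_OctP[k Kk ET] sub]]|[k Kk ->]]; last first.
  rewrite -(Kxy_Oct Kk) is_edgeE; split; first exact: card_e0.
  by exists F_R; [exact: face_R|exact: e0_F_R].
have [k' Kk' E] : exists2 k', Kxy k' & k^-1%g •• A = k' •• e0.
  apply: edge_in_face; last by rewrite card_fset_act.
  by case: ET sub => ->; rewrite -(fset_act_sub k^-1%g) fset_actK; [left|right].
by exists (k * k')%g; [exact: KxyM|rewrite fset_actM -E fset_actVK].
Qed.

Lemma gRact z : gR • z = mact 0 ii ii 0 z. Proof. by rewrite gRE moact. Qed.
Lemma gSact z : gS • z = mact 0 (-1) 1 0 z. Proof. by rewrite gSE moact. Qed.
Lemma gR_oo : gR • (None : P1) = Some 0. Proof. by rewrite gRact; vmeq. Qed.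
Lemma gR_0 : gR • (Some 0 : P1) = None. Proof. by rewrite gRact; vmeq. Qed.

Lemma gR_e0 : gR •• e0 = e0.
Proof. by rewrite fset_act_pair gR_oo gR_0 fsetUC. Qed.

Lemma stab_oo_0_cases g : g • (None : P1) = None -> g • (Some 0 : P1) = Some 0 ->
  g = 1%g \/ g = gd.
Proof.
move=> /stab_oo[k gk [->|->]]; rewrite ?gset_actM ?gd_Some Tr_Some ?oppr0 ?add0r // => -[->].
  by left; rewrite Tr0.
by right; rewrite Tr0 mul1g.
Qed.

Lemma stab_e0 g : g •• e0 = e0 -> [\/ g = 1%g, g = gd, g = gS | g = gR].
Proof.
move=> E; have H z : z \in e0 -> g • z \in e0 by rewrite -{2}E; exact: mem_fset_act.
have := H None; rewrite !inE eqxx => /(_ isT)/orP[]/eqP Eoo;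
  have := H (Some 0); rewrite !inE eqxx orbT => /(_ isT)/orP[]/eqP E0.
- by have := gact_inj (etrans Eoo (esym E0)).
- by have [->|->] := stab_oo_0_cases Eoo E0; [apply: Or41|apply: Or42].
- have [||E'|E'] := @stab_oo_0_cases (gS * g)%g.
  + by rewrite gset_actM Eoo gS_0.
  + by rewrite gset_actM E0 gS_oo.
  + by apply: Or43; apply: (mulgI gS); rewrite E' gSS.
  + by apply: Or44; apply: (mulgI gS); rewrite E' gSR.
- by have := gact_inj (etrans Eoo (esym E0)).
Qed.

(** Words in X and Y are transitive on the edges of the octahedron, so the element may be assumed to
    preserve [e0]. Among 1, R S, S, R only the identity keeps both 1 and i among the vertices. *)
Lemma Kgrp_Kxy g : Kgrp g <-> Kxy g.
Proof.
split=> [Kg|]; last exact: Kxy_Oct.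
have [k Kk Ek] : exists2 k, Kxy k & g •• e0 = k •• e0.
  apply/edge_OctP; rewrite -[X in is_edge X _]Kg is_edgeE; apply/edge_OctP.
  by exists 1%g; [exact: Kxy1|rewrite fset_act1].
have Kh : Kgrp (k^-1 * g)%g by rewrite /Kgrp fset_actM Kg; apply/Kxy_Oct/KxyV.
have H z : z \in oseq -> (k^-1 * g)%g • z \in oseq.
  by rewrite -!mem_Oct => zO; rewrite -[X in _ \in X]Kh; exact: mem_fset_act.
have Eh : (k^-1 * g)%g •• e0 = e0 by rewrite fset_actM Ek fset_actK.
have H1 := H (Some 1) isT; have Hi := H (Some ii) isT.
have [E|E|E|E] := stab_e0 Eh; rewrite E in H1 Hi.
- by rewrite -(mulVKg k g) E mulg1.
- by rewrite gd_Some in H1; vm_compute in H1.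
- by rewrite gSact in H1; vm_compute in H1.
- by rewrite gRact in Hi; vm_compute in Hi.
Qed.

Lemma gXR : (gX * gR = gR * (gX * gX))%g. Proof. by mocalc. Qed.
Lemma gXXR : (gX * gX * gR = gR * gX)%g. Proof. by mocalc. Qed.
Lemma gYS : (gY * gS = gS * (gY * gY))%g. Proof. by mocalc. Qed.
Lemma gYYS : (gY * gY * gS = gS * gY)%g. Proof. by mocalc. Qed.
Lemma gT1d : (Tr 1%R * gd = gX * gR)%g. Proof. by mocalc. Qed.
Lemma gTid : (Tr ii * gd = gY * gS)%g. Proof. by mocalc. Qed.

(* Up to the rotations of a face, an element carrying it to another face fixes oo. *)
Lemma face_R_rot (z : P1) : z \in F_R ->
  exists2 j, [/\ Kxy j, j •• F_R = F_R & exists j', Kxy j' /\ (j * gR = gR * j')%g] & j • (None : P1) = z.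
Proof.
have XF : gX •• F_R = F_R.
  rewrite fset_act_triple gX_oo gX_0 gX_1.
  by apply/fsetP => y; rewrite !inE; do 3!case: (_ == _).
rewrite !inE => /orP[/orP[]|] /eqP ->.
- exists (gX * gX)%g; last by rewrite gset_actM gX_oo gX_1.
  split; [by apply: KxyM; exact: Kxy_X|by rewrite fset_actM !XF|].
  by exists gX; split; [exact: Kxy_X|exact: gXXR].
- exists gX; last exact: gX_oo.
  split=> //; first exact: Kxy_X.
  by exists (gX * gX)%g; split; [apply: KxyM; exact: Kxy_X|exact: gXR].
- exists 1%g; last exact: gset_act1.
  split; [exact: Kxy1|by rewrite fset_act1|].
  by exists 1%g; rewrite mul1g mulg1; split=> //; exact: Kxy1.
Qed.

Lemma face_S_rot (z : P1) : z \in F_S ->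
  exists2 j, [/\ Kxy j, j •• F_S = F_S & exists j', Kxy j' /\ (j * gS = gS * j')%g] & j • (None : P1) = z.
Proof.
have YF : gY •• F_S = F_S.
  rewrite fset_act_triple gY_oo gY_0 gY_ii.
  by apply/fsetP => y; rewrite !inE; do 3!case: (_ == _).
rewrite !inE => /orP[/orP[]|] /eqP ->.
- exists gY; last exact: gY_oo.
  split=> //; first exact: Kxy_Y.
  by exists (gY * gY)%g; split; [apply: KxyM; exact: Kxy_Y|exact: gYS].
- exists (gY * gY)%g; last by rewrite gset_actM gY_oo gY_ii.
  split; [by apply: KxyM; exact: Kxy_Y|by rewrite fset_actM !YF|].
  by exists gY; split; [exact: Kxy_Y|exact: gYYS].
- exists 1%g; last exact: gset_act1.
  split; [exact: Kxy1|by rewrite fset_act1|].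
  by exists 1%g; rewrite mul1g mulg1; split=> //; exact: Kxy1.
Qed.

Lemma stab_oo_pairs h (u v : F) : h • (None : P1) = None ->
  h • (Some 0 : P1) \in [:: Some 0; Some v : P1] ->
  h • (Some u : P1) \in [:: Some 0; Some v : P1] ->
  exists2 k, k \in [:: 0; v] & (h = Tr k /\ u + k \in [:: 0; v]) \/
     (h = (Tr k * gd)%g /\ - u + k \in [:: 0; v]).
Proof.
have E (x : F) : ((Some x : P1) \in [:: Some 0; Some v : P1]) = (x \in [:: 0; v]).
  by rewrite !inE.
move=> /stab_oo[k gk [->|->]]; rewrite ?gset_actM ?gd_Some !Tr_Some // ?oppr0 add0r !E => h0 hu.
  by exists k => //; left.
by exists k => //; right.
Qed.

Lemma mem_F_R : [/\ (Some 0 : P1) \in F_R, (Some 1 : P1) \in F_R & (None : P1) \in F_R].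
Proof. by split; rewrite !inE eqxx ?orbT. Qed.
Lemma mem_F_S : [/\ (Some 0 : P1) \in F_S, (Some ii : P1) \in F_S & (None : P1) \in F_S].
Proof. by split; rewrite !inE eqxx ?orbT. Qed.

(** After a rotation of the face the element fixes oo, so it is z |-> +-z + k, and preserving {0, 1}
    leaves z and 1 - z. The latter is X R, which exchanges the two sides of the face. *)
Lemma stab_F_R h : h •• F_R = F_R -> exists j, Kxy j /\ (h = j \/ h = (gR * j)%g).
Proof.
move=> Eh; have hF z : z \in F_R -> h • z \in F_R by rewrite -{2}Eh; exact: mem_fset_act.
have [F0 F1 ooF] := mem_F_R.
have [j [Kj Fj [j' [Kj' jR]]] Ej] := face_R_rot (hF _ ooF).
have [h' Eh'] : exists h', h = (j * h')%g by exists (j^-1 * h)%g; rewrite mulVKg.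
have h'oo : h' • (None : P1) = None.
  by apply: (gact_inj (g := j)); rewrite -gset_actM -Eh' Ej.
have h'F (z : F) : (Some z : P1) \in F_R -> h' • (Some z : P1) \in [:: Some 0; Some 1 : P1].
  move=> zF; have : h' • (Some z : P1) \in F_R.
    by have := hF _ zF; rewrite Eh' gset_actM -{1}Fj in_fset_act gactK.
  rewrite !inE => /orP[//|/eqP E].
  by have := gact_inj (etrans E (esym h'oo)).
have [k] := stab_oo_pairs h'oo (h'F 0 F0) (h'F 1 F1).
have N1 : ((- 1 + 0 : F) \in [:: 0; 1]) = false by vm_compute.
have N2 : ((1 + 1 : F) \in [:: 0; 1]) = false by vm_compute.
rewrite inE => /orP[|]; rewrite ?inE => /eqP -> [[E W]|[E W]]; rewrite ?N1 ?N2 // in W.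
- by exists j; split=> //; left; rewrite Eh' E Tr0 mulg1.
- exists (j' * (gX * gX))%g; split; first by do 2?apply: KxyM => //; exact: Kxy_X.
  by right; rewrite Eh' E gT1d gXR !mulgA jR.
Qed.

Lemma stab_F_S h : h •• F_S = F_S -> exists j, Kxy j /\ (h = j \/ h = (gS * j)%g).
Proof.
move=> Eh; have hF z : z \in F_S -> h • z \in F_S by rewrite -{2}Eh; exact: mem_fset_act.
have [F0 F1 ooF] := mem_F_S.
have [j [Kj Fj [j' [Kj' jS]]] Ej] := face_S_rot (hF _ ooF).
have [h' Eh'] : exists h', h = (j * h')%g by exists (j^-1 * h)%g; rewrite mulVKg.
have h'oo : h' • (None : P1) = None.
  by apply: (gact_inj (g := j)); rewrite -gset_actM -Eh' Ej.
have h'F (z : F) : (Some z : P1) \in F_S -> h' • (Some z : P1) \in [:: Some 0; Some ii : P1].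
  move=> zF; have : h' • (Some z : P1) \in F_S.
    by have := hF _ zF; rewrite Eh' gset_actM -{1}Fj in_fset_act gactK.
  rewrite !inE => /orP[|/eqP E]; first by rewrite orbC.
  by have := gact_inj (etrans E (esym h'oo)).
have [k] := stab_oo_pairs h'oo (h'F 0 F0) (h'F ii F1).
have N1 : ((- ii + 0 : F) \in [:: 0; ii]) = false by vm_compute.
have N2 : ((ii + ii : F) \in [:: 0; ii]) = false by vm_compute.
rewrite inE => /orP[|]; rewrite ?inE => /eqP -> [[E W]|[E W]]; rewrite ?N1 ?N2 // in W.
- by exists j; split=> //; left; rewrite Eh' E Tr0 mulg1.
- exists (j' * (gY * gY))%g; split; first by do 2?apply: KxyM => //; exact: Kxy_Y.
  by right; rewrite Eh' E gTid gYS !mulgA jS.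
Qed.

(** After a rotation this would be a map z |-> +-z + k carrying {0, i} into {0, 1}, but such maps
    preserve differences up to sign. *)
Lemma F_S_neq_F_R h : h •• F_S = F_R -> False.
Proof.
move=> Eh; have hF z : z \in F_S -> h • z \in F_R by rewrite -Eh; exact: mem_fset_act.
have [F0 F1 ooF] := mem_F_S.
have [j [Kj Fj _] Ej] := face_R_rot (hF _ ooF).
have [h' Eh'] : exists h', h = (j * h')%g by exists (j^-1 * h)%g; rewrite mulVKg.
have h'oo : h' • (None : P1) = None.
  by apply: (gact_inj (g := j)); rewrite -gset_actM -Eh' Ej.
have h'F (z : F) : (Some z : P1) \in F_S -> h' • (Some z : P1) \in [:: Some 0; Some 1 : P1].
  move=> zF; have : h' • (Some z : P1) \in F_R.
    by have := hF _ zF; rewrite Eh' gset_actM -{1}Fj in_fset_act gactK.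
  rewrite !inE => /orP[//|/eqP E].
  by have := gact_inj (etrans E (esym h'oo)).
have [k] := stab_oo_pairs h'oo (h'F 0 F0) (h'F ii F1).
have N : all (fun k => (ii + k \notin [:: 0; 1]) && (- ii + k \notin [:: 0; 1])) [:: 0; 1 : F].
  by vm_compute.
by move=> /(allP N)/andP[n1 n2] [[_]|[_]]; apply/negP.
Qed.

(* Octahedra m Oct and n Oct joined by crossing faces that contain A. *)
Inductive link (A : {fset P1}) (m : G) : G -> Prop :=
| LinkRefl : link A m m
| LinkK n k : link A m n -> Kgrp k -> link A m (n * k)%g
| LinkR n : link A m n -> (A `<=` n •• F_R)%fset -> link A m (n * gR)%g
| LinkS n : link A m n -> (A `<=` n •• F_S)%fset -> link A m (n * gS)%g.

Lemma cancel_quot (g h : G) : h = (g * (g^-1 * h))%g.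
Proof. by rewrite mulVKg. Qed.

Lemma edge_pos g A : is_edge (g •• verts octahedron) A ->
  exists2 k, Kxy k & A = (g * k)%g •• e0.
Proof.
rewrite -{1}(fset_actVK g A) is_edgeE => /edge_OctP[k Kk E].
by exists k => //; rewrite fset_actM -E fset_actVK.
Qed.

Lemma face_pos g A : is_face (g •• verts octahedron) A ->
  exists2 k, Kxy k & A = (g * k)%g •• F_R \/ A = (g * k)%g •• F_S.
Proof.
rewrite -{1}(fset_actVK g A) is_faceE => /face_OctP[k Kk E].
by exists k => //; rewrite !fset_actM; case: E => <-; rewrite fset_actVK; [left|right].
Qed.

Lemma link_back A m n k : Kxy k -> link A m (n * k)%g -> link A m n.
Proof.
move=> Kk /LinkK/(_ (proj2 (Kgrp_Kxy _) (KxyV Kk))); by rewrite mulgK.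
Qed.

(** Four octahedra meet at an ideal edge, one for each element 1, S, R, R S of its stabiliser. The
    neighbours are one crossing away and the opposite one is two, both through faces containing the
    edge. *)
Lemma edge_link m n A : is_edge (m •• verts octahedron) A ->
  is_edge (n •• verts octahedron) A -> link A m n.
Proof.
move=> /edge_pos[k Kk Em] /edge_pos[k' Kk' En].
have L : link A m (m * k)%g by apply: LinkK (LinkRefl _ _) _; apply/Kgrp_Kxy.
apply: (link_back Kk'); rewrite (cancel_quot (m * k)%g (n * k')%g).
move: L; set p := (m * k)%g in Em *; set h := (p^-1 * _)%g => L.
have Eh : h •• e0 = e0 by rewrite /h fset_actM -En Em fset_actK.
have sR : (A `<=` p •• F_R)%fset by rewrite Em fset_act_sub e0_F_R.
have sS : (A `<=` p •• F_S)%fset by rewrite Em fset_act_sub e0_F_S.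
have [->|->|->|->] := stab_e0 Eh.
- by rewrite mulg1.
- have -> : (p * gd = p * gR * gS)%g by rewrite -gRS mulgA.
  apply: (LinkS (LinkR L sR)).
  by rewrite Em -{1}gR_e0 -fset_actM fset_act_sub e0_F_S.
- exact: (LinkS L sS).
- exact: (LinkR L sR).
Qed.

(** Translates of [F_R] and [F_S] being distinct, both octahedra see the face in the same type; the
    element between them is a rotation, or one crossing followed by an element of K. *)
Lemma face_link m n A : is_face (m •• verts octahedron) A ->
  is_face (n •• verts octahedron) A -> link A m n.
Proof.
move=> /face_pos[k Kk Em] /face_pos[k' Kk' En].
have L : link A m (m * k)%g by apply: LinkK (LinkRefl _ _) _; apply/Kgrp_Kxy.
apply: (link_back Kk'); rewrite (cancel_quot (m * k)%g (n * k')%g).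
move: L Em En; set p := (m * k)%g; set p' := (n * k')%g => L Em En.
have quot (B B' : {fset P1}) : A = p •• B -> A = p' •• B' -> (p^-1 * p')%g •• B' = B.
  by move=> E E'; rewrite fset_actM -E' E fset_actK.
have LK (j : G) : Kxy j -> link A m (p * j)%g by move=> Kj; apply: LinkK L _; apply/Kgrp_Kxy.
case: Em => Em; case: En => En; have Eh := quot _ _ Em En.
- have [j [Kj [->|->]]] := stab_F_R Eh; first exact: LK.
  rewrite mulgA; apply: LinkK; last exact/Kgrp_Kxy.
  by apply: LinkR => //; rewrite Em fsubset_refl.
- by case: (F_S_neq_F_R Eh).
- by case: (@F_S_neq_F_R (p^-1 * p')^-1%g); rewrite -{1}Eh fset_actK.
- have [j [Kj [->|->]]] := stab_F_S Eh; first exact: LK.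
  rewrite mulgA; apply: LinkK; last exact/Kgrp_Kxy.
  by apply: LinkS => //; rewrite Em fsubset_refl.
Qed.

(** * Sign characters of cells *)

(** The properties of ideal cells needed for the reconstruction, collected so that edges and
    triangles are treated at once. The essential one is [ct_link]: octahedra sharing a cell are
    joined through faces containing it. *)
Record cell_theory (T : ocells) : Prop := CellTheory {
  ct_und : forall g (s : T), oc_und (g • s) = g •• oc_und s;
  ct_sgn_act : forall g (s u : T), oc_sgn (g • s) (g • u) = oc_sgn s u;
  ct_sgn_refl : forall s : T, oc_sgn s s = 1;
  ct_sgn0 : forall s u : T, oc_und s <> oc_und u -> oc_sgn s u = 0;
  ct_sgn1 : forall s u : T, oc_und s = oc_und u -> oc_sgn s u = 1 \/ oc_sgn s u = -1;
  ct_sgnM : forall s u v : T, oc_und s = oc_und u -> oc_und u = oc_und v ->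
    oc_sgn s u * oc_sgn u v = oc_sgn s v;
  ct_of : forall g V A, oc_of T (g •• V) (g •• A) <-> oc_of T V A;
  ct_real : forall A, oc_of T Oct A -> exists s : T, oc_und s = A;
  ct_cover : forall s : T, exists g, oc_of T (g •• Oct) (oc_und s);
  ct_sub : forall V A, oc_of T V A -> (A `<=` V)%fset;
  ct_link : forall m n A, oc_of T (m •• Oct) A -> oc_of T (n •• Oct) A -> link A m n }.

Lemma ct_neq0_und (T : ocells) (cT : cell_theory T) (s u : T) :
  oc_sgn s u != 0 -> oc_und s = oc_und u.
Proof. by move=> n; apply: contrapT => /(ct_sgn0 cT) E; rewrite E eqxx in n. Qed.

Lemma ct_und_neq0 (T : ocells) (cT : cell_theory T) (s u : T) :
  oc_und s = oc_und u -> oc_sgn s u != 0.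
Proof. by move=> /(ct_sgn1 cT)[] ->. Qed.

(** * Orientation signs of ordered pairs and triples *)

Section PairSign.
Variable K : choiceType.

(** Convertible with [edge_sgn] on cusps, as [tsgn] below is with [tri_sgn]; a general type makes
    the sign calculus purely combinatorial. *)
Definition psgn (p q : K * K) : int :=
  if p == q then 1 else if p == (q.2, q.1) then -1 else 0.

Definition pset (p : K * K) : {fset K} := [fset p.1; p.2]%fset.

Lemma pset_cases p q : q.1 != q.2 -> pset p = pset q -> p = q \/ p = (q.2, q.1).
Proof.
case: p q => [a b] [c d] /= cd /fsetP E.
have := E a; have := E b; have := E c; have := E d; rewrite !inE !eqxx ?orbT /=.
have [->|_] := eqVneq a c.
  by have [->|_] := eqVneq b d => /=; [left|rewrite !orbF eq_sym (negPf cd)].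
have [->|_] //= := eqVneq a d.
by have [->|_] //= := eqVneq b c; right.
Qed.

Lemma psgn_swap q : q.1 != q.2 -> psgn (q.2, q.1) q = -1.
Proof.
by case: q => [a b] /= ab; rewrite /psgn /= xpair_eqE eq_sym (negPf ab) /= eqxx.
Qed.

Lemma psgn1 p q : q.1 != q.2 -> pset p = pset q -> psgn p q = 1 \/ psgn p q = -1.
Proof.
move=> n /(pset_cases n)[->|->]; first by left; rewrite /psgn eqxx.
by right; rewrite psgn_swap.
Qed.

Lemma psgn0 p q : pset p <> pset q -> psgn p q = 0.
Proof.
case: p q => [a b] [c d]; rewrite /psgn; case: eqP => [[-> ->]//|_].
by case: eqP => // -[-> ->] []; rewrite /pset /= fsetUC.
Qed.

Lemma psgnM p q r : r.1 != r.2 -> pset p = pset q -> pset q = pset r ->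
  psgn p q * psgn q r = psgn p r.
Proof.
move=> n E E'; have n' : (r.2, r.1).1 != (r.2, r.1).2 by rewrite eq_sym.
have refl u : psgn u u = 1 by rewrite /psgn eqxx.
case: (pset_cases n E') E => -> E.
  by rewrite refl mulr1.
have [->|->] := pset_cases n (etrans E (fsetUC _ _)).
  have := psgn_swap n'; rewrite -surjective_pairing /= => ->.
  by rewrite psgn_swap // refl.
by rewrite refl mul1r.
Qed.

End PairSign.

Section TripleSign.
Variable K : choiceType.

Definition tsgn (p q : K * K * K) : int :=
  let: (a, b, c) := q in
  if p \in [:: (a, b, c); (b, c, a); (c, a, b)] then 1
  else if p \in [:: (b, a, c); (a, c, b); (c, b, a)] then -1 else 0.

Definition tset (p : K * K * K) : {fset K} := [fset p.1.1; p.1.2; p.2]%fset.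

Definition distinct3 (p : K * K * K) := uniq [:: p.1.1; p.1.2; p.2].

Definition orders3 (p : K * K * K) : seq (K * K * K) := let: (a, b, c) := p in
  [:: (a, b, c); (b, c, a); (c, a, b); (b, a, c); (a, c, b); (c, b, a)].

Lemma tset_cases p q : distinct3 p -> tset p = tset q -> p \in orders3 q.
Proof.
case: p q => [[a b] c] [[x y] z]; rewrite /distinct3 /= !inE negb_or.
move=> /andP[/andP[ab ac] /andP[bc _]] E.
have Ha : a \in tset (x, y, z) by rewrite -E !inE eqxx.
have Hb : b \in tset (x, y, z) by rewrite -E !inE eqxx orbT.
have Hc : c \in tset (x, y, z) by rewrite -E !inE eqxx orbT.
move: Ha Hb Hc ab ac bc; rewrite !inE !xpair_eqE /=.
by move=> /orP[/orP[]|] /eqP -> /orP[/orP[]|] /eqP -> /orP[/orP[]|] /eqP ->;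
  rewrite ?eqxx //= ?orbT.
Qed.

Lemma tset_orders p q : p \in orders3 q -> tset p = tset q.
Proof.
case: q => [[a b] c]; rewrite !inE => /or4P[|||/or3P[]] /eqP -> //;
  by apply/fsetP => z; rewrite !inE /=; do 3!case: (z == _).
Qed.

Lemma tsgn0 p q : tset p <> tset q -> tsgn p q = 0.
Proof.
case: q => [[a b] c] E; rewrite /tsgn; case: ifP => [H|_].
  by case: E; apply: tset_orders; move: H; rewrite !inE => /or3P[]/eqP ->; rewrite eqxx ?orbT.
case: ifP => // H.
by case: E; apply: tset_orders; move: H; rewrite !inE => /or3P[]/eqP ->; rewrite eqxx ?orbT.
Qed.

Lemma tsgn_rot p a b c : tsgn p (b, c, a) = tsgn p (a, b, c).
Proof.
rewrite /tsgn !inE; do 6!case: (p == _) => //=.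
Qed.

Lemma tsgn_swap p a b c : distinct3 (a, b, c) -> tsgn p (b, a, c) = - tsgn p (a, b, c).
Proof.
rewrite /distinct3 /= !inE negb_or => /andP[/andP[ab ac] /andP[bc _]].
have ba : b != a by rewrite eq_sym. have ca : c != a by rewrite eq_sym.
have cb : c != b by rewrite eq_sym.
have D : p \in [:: (a, b, c); (b, c, a); (c, a, b)] ->
    p \in [:: (b, a, c); (a, c, b); (c, b, a)] = false.
  by rewrite !inE => /or3P[] /eqP ->; rewrite !xpair_eqE (negPf ab) (negPf ac) (negPf bc)
    (negPf ba) (negPf ca) (negPf cb) /= ?andbF.
move: D; rewrite /tsgn !inE.
by do 6!case: (p == _) => //=; rewrite ?oppr0 //; move/(_ isT).
Qed.

Lemma tsgn_refl p : tsgn p p = 1.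
Proof. by case: p => [[a b] c]; rewrite /tsgn !inE eqxx. Qed.

Lemma tsgn_neq0 p q : distinct3 q -> p \in orders3 q -> tsgn p q = 1 \/ tsgn p q = -1.
Proof.
case: q => [[a b] c] d; rewrite /tsgn; case: ifP => [|n1]; first by left.
case: ifP => [|n2]; first by right.
by move: n1 n2; rewrite !inE; do 6!case: (p == _).
Qed.

Lemma distinct3_orders p q : p \in orders3 q -> distinct3 q -> distinct3 p.
Proof.
case: q => [[a b] c]; rewrite /distinct3 /= !inE !negb_or => H /andP[/andP[ab ac] /andP[bc _]].
have ba : b != a by rewrite eq_sym. have ca : c != a by rewrite eq_sym.
have cb : c != b by rewrite eq_sym.
by move: H => /or4P[|||/or3P[]] /eqP -> /=; rewrite ?ab ?ac ?bc ?ba ?ca ?cb.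
Qed.

(** The sign is that of a permutation of three vertices. Rotations do not change it, which leaves a
    single transposition to check. *)
Lemma tsgnM p q r : distinct3 r -> q \in orders3 r ->
  tsgn p q * tsgn q r = tsgn p r.
Proof.
case: r => [[a b] c] d qr.
have odd x y z : distinct3 (x, y, z) ->
    tsgn p (y, x, z) * tsgn (y, x, z) (x, y, z) = tsgn p (x, y, z).
  by move=> dx; rewrite !(tsgn_swap _ dx) -[in X in _ * X](opprK (tsgn _ _))
    -(tsgn_swap (y, x, z) dx) tsgn_refl mulrN1 opprK.
have d1 : distinct3 (b, c, a) by apply: distinct3_orders d; rewrite !inE eqxx ?orbT.
have d2 : distinct3 (c, a, b) by apply: distinct3_orders d; rewrite !inE eqxx ?orbT.
move: qr; rewrite !inE => /or4P[|||/or3P[]] /eqP ->.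
- by rewrite tsgn_refl mulr1.
- by rewrite -(tsgn_rot (b, c, a) a b c) tsgn_refl mulr1 tsgn_rot.
- rewrite -(tsgn_rot (c, a, b) a b c) -(tsgn_rot (c, a, b) b c a) tsgn_refl mulr1.
  by rewrite (tsgn_rot p b c a) tsgn_rot.
- exact: odd.
- by rewrite -(tsgn_rot (a, c, b) a b c) -(tsgn_rot (a, c, b) b c a) odd // (tsgn_rot p b c a) tsgn_rot.
- by rewrite -(tsgn_rot (c, b, a) a b c) odd // tsgn_rot.
Qed.

End TripleSign.

Lemma gauss_edge_neq (a b : P1) : gauss_edge a b -> a != b.
Proof.
move=> /gauss_edge_cu[p [q [p' [q' [s -> ->]]]]]; apply/eqP => E.
have /(cuP (sl_nz1 s) (sl_nz2 s)) {}E := E.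
case/slP: s => _ _ _ _ /eqP; rewrite E mulrC subrr eq_sym.
by rewrite oner_eq0.
Qed.

Lemma oedge_neq (e : oedge) : (oe_val e).1 != (oe_val e).2.
Proof. exact/gauss_edge_neq/asboolP/oe_valP. Qed.

Lemma otri_distinct (t : otri) : distinct3 (ot_val t).
Proof.
have /asboolP/gauss_tri_edges[/gauss_edge_neq ab /gauss_edge_neq bc /gauss_edge_neq ca] := ot_valP t.
by rewrite /distinct3 /= !inE negb_or ab bc eq_sym ca.
Qed.

Lemma psgn_inj (K K' : choiceType) (h : K -> K') p q : injective h ->
  psgn (h p.1, h p.2) (h q.1, h q.2) = psgn p q.
Proof.
by case: p q => [a b] [c d] hI; rewrite /psgn !xpair_eqE /= !(inj_eq hI).
Qed.

Lemma tsgn_inj (K K' : choiceType) (h : K -> K') p q : injective h ->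
  tsgn (h p.1.1, h p.1.2, h p.2) (h q.1.1, h q.1.2, h q.2) = tsgn p q.
Proof.
by case: p q => [[a b] c] [[x y] z] hI; rewrite /tsgn !inE !xpair_eqE /= !(inj_eq hI).
Qed.

Lemma oedge_cover (e : oedge) : exists g, is_edge (g •• Oct) (edge_und e).
Proof.
have /asboolP/gauss_edge_cu[p [q [p' [q' [s E1 E2]]]]] := oe_valP e.
exists (mo p q p' q'); rewrite /edge_und E1 E2 -(mo_oo s) -(mo_0 s) -fset_act_pair.
by rewrite is_edgeE; apply/edge_OctP; exists 1%g; [exact: Kxy1|rewrite fset_act1].
Qed.

Lemma edge_real A : is_edge Oct A -> exists e : oedge, edge_und e = A.
Proof.
move=> /edge_OctP[k Kk ->].
have P : `[< gauss_edge (k • (None : P1)) (k • (Some 0 : P1)) >].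
  by apply/asboolP/gauss_edge_act; rewrite cu_oo cu_Some; apply: (@gauss_edge_sl 1 0 0 1).
by exists (@MkOedge (k • (None : P1), k • (Some 0 : P1)) P); rewrite fset_act_pair.
Qed.

Lemma edge_theory : cell_theory edges.
Proof.
split.
- by move=> g s; rewrite [RHS]fset_act_pair.
- by move=> g s u; rewrite [LHS]psgn_inj //; apply: gact_inj.
- by move=> s; rewrite [LHS](_ : _ = psgn (oe_val s) (oe_val s)) // /psgn eqxx.
- by move=> s u; apply: psgn0.
- by move=> s u; apply: psgn1; exact: oedge_neq.
- by move=> s u v; apply: psgnM; exact: oedge_neq.
- exact: is_edgeE.
- exact: edge_real.
- exact: oedge_cover.
- by move=> V A [_ [T [sT _] sA]]; apply: fsubset_trans sA sT.
- exact: edge_link.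
Qed.

Lemma tri_pos_R (g : G) : is_face (g •• Oct) (g •• F_R).
Proof. by rewrite is_faceE; exact: face_R. Qed.
Lemma tri_pos_S (g : G) : is_face (g •• Oct) (g •• F_S).
Proof. by rewrite is_faceE; exact: face_S. Qed.

(** In the frame of its first edge a triangle is (oo, 0, u) with u a unit. The half-turn [gd]
    exchanges u and -u, leaving u = 1 and u = i, that is [F_R] and [F_S]. *)
Lemma otri_cover (t : otri) : exists g, is_face (g •• Oct) (tri_und t).
Proof.
have /asboolP/gauss_triP[p [q [p' [q' [u [s uu E1 E2 E3]]]]]] := ot_valP t.
have Et : tri_und t = mo p q p' q' •• [fset (None : P1); Some 0; Some u]%fset.
  by rewrite fset_act_triple mo_oo // mo_0 // mo_Some // /tri_und E1 E2 E3.
have FR : [fset (None : P1); Some 0; Some 1]%fset = F_R.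
  by apply/fsetP => z; rewrite !inE; do 3!case: (_ == _).
have FS : [fset (None : P1); Some 0; Some ii]%fset = F_S.
  by apply/fsetP => z; rewrite !inE; do 3!case: (_ == _).
have D (z : F) : [fset (None : P1); Some 0; Some (- z)]%fset =
    gd •• [fset (None : P1); Some 0; Some z]%fset.
  by rewrite fset_act_triple gd_oo !gd_Some oppr0.
rewrite Et; move: uu; rewrite !inE => /or4P[] /eqP ->; rewrite ?D ?FR ?FS -?fset_actM.
- by exists (mo p q p' q'); exact: tri_pos_R.
- by exists (mo p q p' q' * gd)%g; exact: tri_pos_R.
- by exists (mo p q p' q'); exact: tri_pos_S.
- by exists (mo p q p' q' * gd)%g; exact: tri_pos_S.
Qed.

Lemma fset3_rot (K : choiceType) (a b c : K) : [fset a; b; c]%fset = [fset b; c; a]%fset.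
Proof. by apply/fsetP => z; rewrite !inE; do 3!case: (_ == _). Qed.

Lemma fset3_rev (K : choiceType) (a b c : K) : [fset a; b; c]%fset = [fset c; b; a]%fset.
Proof. by apply/fsetP => z; rewrite !inE; do 3!case: (_ == _). Qed.

Lemma tri_real A : is_face Oct A -> exists t : otri, tri_und t = A.
Proof.
have sl1 : sl 1 0 0 1 by [].
move=> /face_OctP[k Kk [->|->]].
- have P : `[< gauss_tri (k • (None : P1)) (k • (Some 0 : P1)) (k • (Some 1 : P1)) >].
    apply/asboolP/gauss_tri_act; have := @gauss_tri_sl 1 0 0 1 1 sl1 isT.
    by rewrite !mul1r mul0r addr0 add0r -cu_oo -!cu_Some.
  exists (@MkOtri (k • (None : P1), k • (Some 0 : P1), k • (Some 1 : P1)) P).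
  by rewrite fset_act_triple; exact: fset3_rot.
- have P : `[< gauss_tri (k • (None : P1)) (k • (Some 0 : P1)) (k • (Some ii : P1)) >].
    apply/asboolP/gauss_tri_act; have := @gauss_tri_sl 1 0 0 1 ii sl1 isT.
    by rewrite !mul1r mul0r addr0 add0r -cu_oo -!cu_Some.
  exists (@MkOtri (k • (None : P1), k • (Some 0 : P1), k • (Some ii : P1)) P).
  by rewrite fset_act_triple; exact: fset3_rev.
Qed.

Lemma tri_theory : cell_theory triangles.
Proof.
have ord (s u : otri) : tri_und s = tri_und u -> ot_val s \in orders3 (ot_val u).
  by apply: tset_cases; exact: otri_distinct.
split.
- by move=> g s; rewrite [RHS]fset_act_triple.
- by move=> g s u; rewrite [LHS]tsgn_inj //; apply: gact_inj.
- by move=> s; exact: tsgn_refl.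
- by move=> s u; apply: tsgn0.
- by move=> s u E; apply: tsgn_neq0; [exact: otri_distinct|exact: ord].
- by move=> s u v E E'; apply: tsgnM; [exact: otri_distinct|exact: ord].
- exact: is_faceE.
- exact: tri_real.
- exact: otri_cover.
- by move=> V A [].
- exact: face_link.
Qed.

(** * The developing map *)

Lemma intC (m : int) : m%:~R = Complex m%:~R 0 :> F.
Proof. by rewrite -[RHS]/(real_complex rat m%:~R) rmorph_int. Qed.

Lemma gaussint_int (m : int) : gaussint m%:~R.
Proof. by apply/gaussintP; exists m, 0; rewrite intC. Qed.

(** The elements whose right multiplication preserves P form a monoid. It contains the inverses of
    the generators, which have finite order, hence all translations and [gd], and by the Euclidean
    descent all of G. *)
Lemma gen_ind (P : G -> Prop) : P 1%g ->
  (forall g, P g -> P (g * gS)%g) -> (forall g, P g -> P (g * gR)%g) ->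
  (forall g, P g -> P (g * gX)%g) -> (forall g, P g -> P (g * gY)%g) ->
  forall g, P g.
Proof.
move=> Pone PS PR PX PY.
pose W (g : G) := forall h, P h -> P (h * g)%g.
suff WT : forall g, W g by move=> g; rewrite -[g]mul1g; apply: WT.
have W1 : W 1%g by move=> h; rewrite mulg1.
have WM g g' : W g -> W g' -> W (g * g')%g by move=> Wg Wg' h Ph; rewrite mulgA; apply/Wg'/Wg.
have WX : W gX by []. have WY : W gY by []. have WS : W gS by []. have WR : W gR by [].
have WXV : W (gX^-1)%g by rewrite gXV; apply: WM.
have WYV : W (gY^-1)%g by rewrite gYV; apply: WM.
have T1 : Tr 1 = (gX * gS)%g by rewrite -gT1S -mulgA gSS mulg1.
have Ti : Tr ii = (gY * gR)%g by rewrite -gTiR -mulgA gRR mulg1.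
have WT1 : W (Tr 1) by rewrite T1; apply: WM.
have WTi : W (Tr ii) by rewrite Ti; apply: WM.
have WT1V : W (Tr (- 1)) by rewrite -TrV // T1 invgM gSV; apply: WM.
have WTiV : W (Tr (- ii)) by rewrite -TrV // Ti invgM gRV; apply: WM.
have Wint u : gaussint u -> W (Tr u) -> W (Tr (- u)) -> forall m : int, W (Tr (u * m%:~R)).
  move=> gu Wu WuN; have gm (m : int) : gaussint (u * m%:~R).
    by apply: gaussintM => //; exact: gaussint_int.
  elim/int_rect => [|n IH|n IH]; first by rewrite mulr0 Tr0.
  - rewrite -addn1 PoszD intrD mulrDr mulr1 -TrD //; exact: WM.
  - rewrite -addn1 PoszD opprD intrD mulrDr -[(-1)%:~R]/(-1) mulrN1 -TrD ?gaussintN //.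
    exact: WM.
have WT k : gaussint k -> W (Tr k).
  move=> /gaussintP[m [n ->]].
  have -> : Complex m%:~R n%:~R = 1 * m%:~R + ii * n%:~R :> F.
    by rewrite !intC; apply: complex_eqE => /=; ring.
  rewrite -TrD ?mul1r ?gaussintM ?gaussint_int //; apply: WM; last exact: Wint.
  by rewrite -[_%:~R]mul1r; apply: Wint.
move=> g; have [||g0 Wg0 E] := cusp_gen (P := W) W1 _ _ (g • (None : P1)).
- by move=> h k Wh gk; apply: WM => //; exact: WT.
- by move=> h Wh; apply: WM.
have [k gk Eg] : exists2 k, gaussint k & (g0^-1 * g)%g = Tr k \/ (g0^-1 * g)%g = (Tr k * gd)%g.
  by apply: stab_oo; rewrite gset_actM -E gactK.
rewrite -(mulVKg g0 g); apply: (WM) => //; case: Eg => ->; first exact: WT.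
by rewrite -gRS; apply: (WM) (WT _ gk) (WM _ _ WR WS).
Qed.

Lemma word_ex (g : G) : exists w, word_val w = g.
Proof.
move: g; apply: gen_ind => [|g [w <-]|g [w <-]|g [w <-]|g [w <-]].
- by exists [::].
- by exists (w ++ [:: (genS, false)]); rewrite word_val_cat /= mulg1.
- by exists (w ++ [:: (genR, false)]); rewrite word_val_cat /= mulg1.
- by exists (w ++ [:: (genX, false)]); rewrite word_val_cat /= mulg1.
- by exists (w ++ [:: (genY, false)]); rewrite word_val_cat /= mulg1.
Qed.

(** * Local groups and Picard cells of a candidate symbol *)

Section CellAt.
Variables (D : octdata) (cD : candidate D).
Implicit Types x y : occ D.

Lemma oct_verts x : verts (oc_oct x) = oc_g x •• Oct.
Proof.
rewrite (cand_oct cD); apply/fsetP => z; rewrite in_fset_act !in_fset.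
apply/mapP/idP => [[w wO ->]|zO]; first by rewrite gactK.
by exists ((oc_g x)^-1%g • z); rewrite ?gactVK.
Qed.

Lemma Jloc1 x : Jloc x 1%g.
Proof. by rewrite /Jloc mulg1 mulgV; exact: sg_one. Qed.

Lemma JlocM x j j' : Jloc x j -> Jloc x j' -> Jloc x (j * j')%g.
Proof.
move=> J J'; rewrite /Jloc.
have -> : (oc_g x * (j * j') * (oc_g x)^-1 =
  (oc_g x * j * (oc_g x)^-1) * (oc_g x * j' * (oc_g x)^-1))%g by rewrite !mulgA mulgVK.
exact: sg_mul.
Qed.

Lemma JlocV x j : Jloc x j -> Jloc x j^-1%g.
Proof.
move=> J; rewrite /Jloc.
have -> : (oc_g x * j^-1 * (oc_g x)^-1 = (oc_g x * j * (oc_g x)^-1)^-1)%g.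
  by rewrite !invgM invgK mulgA.
exact: sg_inv.
Qed.

Lemma Jloc_Jhat x j : oc_Jhat x j <-> Jloc x ((oc_g x)^-1 * j * oc_g x)%g.
Proof. by rewrite /Jloc !mulgA mulgV mul1g mulgK. Qed.

Lemma Jloc_K x j : Jloc x j -> Kgrp j.
Proof.
move=> /(cand_Jhat cD); rewrite oct_verts /Kgrp => E.
apply: (fset_act_inj (g := oc_g x)); rewrite -[RHS]E -!fset_actM.
by rewrite mulgVK.
Qed.

Lemma KgrpM k k' : Kgrp k -> Kgrp k' -> Kgrp (k * k')%g.
Proof. by rewrite /Kgrp fset_actM => K ->. Qed.

Lemma KgrpV k : Kgrp k -> Kgrp k^-1%g.
Proof. by rewrite /Kgrp => E; rewrite -{1}E fset_actK. Qed.

Implicit Types c : picard_cell D.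

Lemma coset_J x j k : Jloc x j -> coset_pred (Jloc x) (j * k)%g = coset_pred (Jloc x) k.
Proof.
move=> J; apply/funext => g; apply/propext; split=> -[j' J' ->].
  by exists (j' * j)%g; [exact: JlocM|rewrite mulgA].
exists (j' * j^-1)%g; first by apply: JlocM => //; exact: JlocV.
by rewrite mulgA mulgVK.
Qed.

Lemma cell_at_ex x k : Kgrp k -> exists c, cell_at x k c.
Proof.
move=> Kk; have P : exists2 k0, Kgrp k0 & coset_pred (Jloc x) k = coset_pred (Jloc x) k0.
  by exists k.
by exists (exist _ (x, coset_pred (Jloc x) k) P).
Qed.

Lemma cell_ex c : exists x k, cell_at x k c.
Proof. by case: c => -[x L] [k Kk /= EL]; exists x, k; split=> //=; rewrite EL. Qed.

Lemma cell_at_fun x k c c' : cell_at x k c -> cell_at x k c' -> c = c'.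
Proof.
by case: c c' => [p Pp] [p' Pp'] [_ /= E] [_ /= E']; apply: eq_exist; rewrite E E'.
Qed.

Lemma cell_at_inj x y k k' c : cell_at x k c -> cell_at y k' c ->
  x = y /\ exists2 j, Jloc x j & k' = (j * k)%g.
Proof.
move=> [_ E] [_ E']; have := etrans (esym E) E' => -[xy]; subst y => EJ; split=> //.
have : coset_pred (Jloc x) k' k' by exists 1%g; rewrite ?mul1g //; exact: Jloc1.
by rewrite -EJ => -[j J ->]; exists j.
Qed.

Lemma cell_atJ x j k c : cell_at x k c -> Jloc x j -> cell_at x (j * k)%g c.
Proof.
move=> [Kk E] J; split; last by rewrite coset_J.
exact: KgrpM (Jloc_K J) Kk.
Qed.

End CellAt.

(** * The developing map from G to the cells *)

Section Developed.
Variables (Sg : symbol) (vS : valid Sg).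
Let D : octdata := Sg.
Let cD : candidate D := valid_cand vS.
Let c0 : picard_cell D := sym_mark Sg.

(** Totality and uniqueness make each [step l] the graph of a function, and the valid relators
    become the hypotheses of [presentation_action]; the resulting map is the orbit map of the
    mark. *)
Lemma cell_of_exists : exists dev : G -> picard_cell D,
  dev 1%g = c0 /\ forall l g, step l (dev g) (dev (g * gen_val l)%g).
Proof.
have [st stP] : exists st : gen -> picard_cell D -> picard_cell D,
    forall l c, step l c (st l c) /\ forall d, step l c d -> d = st l c.
  have [f Hf] := choice (fun p : gen * picard_cell D =>
    let: ex_intro d Hd := valid_total vS p.1 p.2 in
    ex_intro (fun d => step p.1 p.2 d /\ forall d', step p.1 p.2 d' -> d' = d) d
      (conj (proj1 Hd) (fun d' Hd' => esym (proj2 Hd d' Hd')))).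
  by exists (fun l c => f (l, c)) => l c; apply: (Hf (l, c)).
have st_eq l c d : step l c d -> d = st l c by case: (stP l c) => _; apply.
have rel n : (n < 8)%N -> forall c : picard_cell D, word_act (nth [::] relators n) c c.
  by move=> n8; apply: valid_rel.
have st_inv l c d : step l d c -> c = st l d by exact: st_eq.
have [dev [dev1 devP]] : exists dev : G -> picard_cell D, dev 1%g = c0 /\ forall g,
    [/\ dev (g * gS)%g = st genS (dev g), dev (g * gR)%g = st genR (dev g),
        dev (g * gX)%g = st genX (dev g) & dev (g * gY)%g = st genY (dev g)].
  have xxx c : st genX (st genX (st genX c)) = c.
    by have [d /st_eq -> [e /st_eq -> [f /st_eq -> /= ->]]] := rel 3 isT c.
  apply: presentation_action => // c.
  - by have [d /st_eq -> [e /st_eq -> /= ->]] := rel 0 isT c.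
  - by have [d /st_eq -> [e /st_eq -> /= ->]] := rel 1 isT c.
  - by have [d /st_eq -> [e /st_eq -> [f /st_eq -> [h /st_eq -> /= ->]]]] := rel 2 isT c.
  - by have [d /st_eq -> [e /st_eq -> [f /st_eq -> [h /st_eq -> /= ->]]]] := rel 4 isT c.
  - by have [d /st_eq -> [e /st_eq -> [f /st_eq -> /= ->]]] := rel 5 isT c.
  - have [d /st_eq Ed [e /st_eq -> [f /st_eq Ef [h /st_eq -> /= Eh]]]] := rel 6 isT c.
    by rewrite [in LHS]Ed xxx Ef xxx.
  - by have [d /st_eq -> [e /st_eq -> [f /st_eq -> [h /st_eq -> /= ->]]]] := rel 7 isT c.
exists dev; split=> // l g; have [pS pR pX pY] := devP g.
have -> : dev (g * gen_val l)%g = st l (dev g) by case: l.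
by case: (stP l (dev g)).
Qed.

Definition dev : G -> picard_cell D := sval (cid cell_of_exists).
Lemma dev1 : dev 1%g = c0.
Proof. by case: (svalP (cid cell_of_exists)). Qed.
Lemma dev_step l g : step l (dev g) (dev (g * gen_val l)%g).
Proof. by case: (svalP (cid cell_of_exists)). Qed.

Lemma step_fun l (c d d' : picard_cell D) : step l c d -> step l c d' -> d = d'.
Proof. by have [e [_ U]] := valid_total vS l c; move=> /U <- /U <-. Qed.

Lemma step_inj l (c c' d : picard_cell D) : step l c d -> step l c' d -> c = c'.
Proof. by have [e [_ U]] := valid_bij vS l d; move=> /U <- /U <-. Qed.

Lemma word_dev w g d : word_act w (dev g) d <-> d = dev (g * word_val w)%g.
Proof.
have let_dev a h e : letter_act a (dev h) e <-> e = dev (h * letter_val a)%g.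
  rewrite /letter_act /letter_val; case: a => l [] /=; split=> [st|->].
  - by apply: step_inj st _; have := dev_step l (h * (gen_val l)^-1)%g; rewrite mulgVK.
  - by have := dev_step l (h * (gen_val l)^-1)%g; rewrite mulgVK.
  - exact: step_fun st (dev_step l h).
  - exact: dev_step.
elim: w g d => [|a w IH] g d /=; first by rewrite mulg1; split=> ->.
split=> [[e /let_dev -> /IH ->]|->]; first by rewrite mulgA.
by exists (dev (g * letter_val a)%g); [exact/let_dev|apply/IH; rewrite mulgA].
Qed.

(** Membership in [Hsym] asks for one suitable word. Since [dev] depends only on the group element,
    every word representing h gives the same answer. *)
Lemma HsymP h : Hsym Sg h <-> dev h = c0.
Proof.
split=> [[w <- Hw]|E].
  have /word_dev : word_act w (dev 1%g) c0 by rewrite dev1.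
  by rewrite mul1g.
have [w Ew] := word_ex h; exists w => //.
have : word_act w (dev 1%g) c0 by apply/word_dev; rewrite mul1g Ew.
by rewrite dev1.
Qed.

Lemma dev_eqM g g' u : dev g = dev g' -> dev (g * u)%g = dev (g' * u)%g.
Proof.
move=> E; have [w <-] := word_ex u; apply/esym/word_dev; rewrite E; exact/word_dev.
Qed.

Lemma dev_H h g : Hsym Sg h <-> dev (h * g)%g = dev g.
Proof.
rewrite HsymP -dev1; split=> [/(dev_eqM g)|/(dev_eqM g^-1%g)]; rewrite ?mul1g //.
by rewrite mulgK mulgV.
Qed.

(** Steps by X and Y stay in one occurrence, and K consists of words in X and Y. *)
Lemma kmove x k g m : cell_at x k (dev g) -> Kgrp m -> cell_at x (k * m)%g (dev (g * m)%g).
Proof.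
move=> ck /Kgrp_Kxy; elim=> [|k1 Kk1 IH|k1 Kk1 IH]; first by rewrite !mulg1.
  have Kk : Kgrp (k * k1 * gX)%g.
    by apply: KgrpM; [case: IH|apply/Kgrp_Kxy/Kxy_X].
  rewrite !mulgA; have [d cd] := cell_at_ex x Kk.
  suff -> : dev (g * k1 * gX)%g = d by [].
  by apply: step_fun (dev_step genX _) _; exists x, (k * k1)%g.
have Kk : Kgrp (k * k1 * gY)%g.
  by apply: KgrpM; [case: IH|apply/Kgrp_Kxy/Kxy_Y].
rewrite !mulgA; have [d cd] := cell_at_ex x Kk.
suff -> : dev (g * k1 * gY)%g = d by [].
by apply: step_fun (dev_step genY _) _; exists x, (k * k1)%g.
Qed.

(* The stored representative may differ from k by an element of J_x fixing the
   face; the transport conjugates it into J_y. *)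
Lemma across_indep x k g t (f : {fset P1}) : is_face Oct f ->
  cell_at x k (dev g) -> k •• f \in oc_stored x ->
  step_across t f (dev g) (dev (g * t)%g) ->
  cell_at (oc_tgt x (k •• f)) (oc_q x (k •• f) * k * t^-1)%g (dev (g * t)%g).
Proof.
move=> ff ck st [x' [k' [ck' st' c2]]].
have [xx [j J Ek]] := cell_at_inj ck ck'; subst x'.
have Kk' : Kgrp k' by case: ck'.
have fk' : is_face Oct (k' •• f) by rewrite -Kk' is_faceE.
have [f1 [_ U]] := cand_orbits cD x fk'.
have E1 : f1 = k •• f.
  apply: U; split; [exact: st|exists j; first exact: J].
  by rewrite -fset_actM -Ek.
have E2 : f1 = k' •• f.
  apply: U; split; first exact: st'.
  by exists 1%g; [exact: Jloc1|rewrite fset_act1].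
have Ef : k' •• f = k •• f by rewrite -E1 -E2.
rewrite {}Ef in c2; clear st'.
have [Jq _] : Jloc (oc_tgt x (k •• f)) (oc_q x (k •• f) * j * (oc_q x (k •• f))^-1)%g /\
   (oc_q x (k •• f) * j * (oc_q x (k •• f))^-1)%g •• oc_face x (k •• f) = oc_face x (k •• f).
  apply/(cand_stab cD st); split=> //.
  by rewrite -fset_actM -Ek -E2 E1.
have := cell_atJ cD c2 (JlocV Jq); congr cell_at.
by rewrite Ek !invgM invgK !mulgA mulgVK mulgVK.
Qed.

End Developed.

Lemma grp_across (Gam : groupType) (g k q x y t : Gam) : (t * t = 1)%g ->
  (g * k^-1 * x^-1 * (y * q * x^-1)^-1 = (g * t) * (q * k * t^-1)^-1 * y^-1)%g.
Proof.
by move=> tt; rewrite !invgM !invgK !mulgA mulgVK -(mulgA g t t) tt mulg1.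
Qed.

Lemma grp_local (Gam : groupType) (g k x j : Gam) :
  (g * k^-1 * x^-1 * j = g * ((x^-1 * j * x)^-1 * k)^-1 * x^-1)%g.
Proof. by rewrite !invgM !invgK !mulgA mulgK. Qed.

Lemma grp_unique (Gam : groupType) (g k m k' x : Gam) :
  ((g * (k^-1 * (m * k')) * k'^-1 * x^-1)^-1 * (g * k^-1 * x^-1) = x * m^-1 * x^-1)%g.
Proof.
apply: (mulgI (g * (k^-1 * (m * k')) * k'^-1 * x^-1)%g); rewrite mulVKg.
by rewrite !mulgA mulgK mulgVK mulgK.
Qed.

(** * Positions of the occurrences in the tessellation *)

Section Placed.
Variables (Sg : symbol) (vS : valid Sg).
Let D : octdata := Sg.
Let cD : candidate D := valid_cand vS.
Let dev := dev vS.
Let base := @base_position Sg.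

(** If dev g = J_x k, this is the a with a O_x = g O and a g_x = g k^-1; another k in the coset
    changes it by an element of Jhat. *)
Definition pos (x : occ D) (g k : G) : G := (g * k^-1 * (oc_g x)^-1)%g.

Lemma across_R x k g : cell_at x k (dev g) -> k •• F_R \in oc_stored x ->
  cell_at (oc_tgt x (k •• F_R)) (oc_q x (k •• F_R) * k * gR^-1)%g (dev (g * gR)%g).
Proof.
move=> ck st; apply: (across_indep face_R ck st).
exact: (dev_step vS genR g).
Qed.

Lemma across_S x k g : cell_at x k (dev g) -> k •• F_S \in oc_stored x ->
  cell_at (oc_tgt x (k •• F_S)) (oc_q x (k •• F_S) * k * gS^-1)%g (dev (g * gS)%g).
Proof.
move=> ck st; apply: (across_indep face_S ck st).
exact: (dev_step vS genS g).
Qed.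

Lemma cell_at_pos x g k k' : cell_at x k (dev g) -> Kgrp k' ->
  exists g', cell_at x k' (dev g') /\ pos x g' k' = pos x g k.
Proof.
move=> ck Kk'; have Kk : Kgrp k by case: ck.
exists (g * (k^-1 * k'))%g; split; last by rewrite /pos !mulgA mulgK.
by have := kmove ck (KgrpM (KgrpV Kk) Kk'); rewrite mulVKg.
Qed.

(** Each rule of [placed] matches a move of [dev]: a local element changes k within its coset, and a
    face transport is a step by R or S, after moving within the octahedron to a cell whose k carries
    [F_R] or [F_S] to the stored face. *)
Lemma placed_pos x a : placed base x a -> exists g k, cell_at x k (dev g) /\ a = pos x g k.
Proof.
elim=> {x a} [x a [k ck ->]|x a j _ [g [k [ck ->]]] Jj|x a f _ [g [k [ck ->]]] st].
- by exists 1%g, k; rewrite /dev dev1 /pos mul1g.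
- exists g, (((oc_g x)^-1 * j * oc_g x)^-1 * k)%g; split.
    exact: (cell_atJ cD ck (JlocV (proj1 (Jloc_Jhat _ _) Jj))).
  by rewrite /pos; exact: grp_local.
- have [k0 Kk0 Ef] := proj1 (face_OctP _) (cand_stored cD st).
  have [g' [ck' <-]] := cell_at_pos ck (proj2 (Kgrp_Kxy _) Kk0).
  case: Ef => Ef; rewrite Ef in st *.
    exists (g' * gR)%g, (oc_q x (k0 •• F_R) * k0 * gR^-1)%g.
    by split; [exact: across_R|rewrite /pos /transport; exact: (grp_across _ _ _ _ _ gRR)].
  exists (g' * gS)%g, (oc_q x (k0 •• F_S) * k0 * gS^-1)%g.
  by split; [exact: across_S|rewrite /pos /transport; exact: (grp_across _ _ _ _ _ gSS)].
Qed.

Lemma pos_cell x g k k' : cell_at x k (dev g) -> cell_at x k' (dev g) ->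
  exists2 j, oc_Jhat x j & pos x g k' = (pos x g k * j)%g.
Proof.
move=> ck ck'; have [_ [j J ->]] := cell_at_inj ck ck'.
exists (oc_g x * j^-1 * (oc_g x)^-1)%g; first exact: JlocV J.
by rewrite /pos invgM !mulgA mulgVK.
Qed.

(** Conversely, g is reached from 1 by generators: X and Y do not change the position, while R and S
    change it by one recorded transport, up to a local element. *)
Lemma pos_placed g : forall x k, cell_at x k (dev g) -> placed base x (pos x g k).
Proof.
have across g0 t f : (t * t = 1)%g -> step_across t f (dev g0) (dev (g0 * t)%g) ->
    (forall x k, cell_at x k (dev g0) -> placed base x (pos x g0 k)) ->
    forall x k, cell_at x k (dev (g0 * t)%g) -> placed base x (pos x (g0 * t)%g k).
  move=> tt [x [k [ck st c2]]] IH y k' ck'.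
  have [xy _] := cell_at_inj c2 ck'; subst y.
  have [j Jj ->] := pos_cell c2 ck'; apply: PlacedLocal => //.
  have -> : pos (oc_tgt x (k •• f)) (g0 * t)%g (oc_q x (k •• f) * k / t)%g =
      (pos x g0 k * (transport x (k •• f))^-1)%g.
    by rewrite /pos /transport; apply/esym; exact: (grp_across _ _ _ _ _ tt).
  by apply: PlacedFace => //; exact: IH.
have inner g0 t : Kxy t ->
    (forall x k, cell_at x k (dev g0) -> placed base x (pos x g0 k)) ->
    forall x k, cell_at x k (dev (g0 * t)%g) -> placed base x (pos x (g0 * t)%g k).
  move=> Kt IH x k ck.
  have := kmove ck (KgrpV (proj2 (Kgrp_Kxy t) Kt)); rewrite mulgK => /IH.
  by rewrite /pos invgM invgK !mulgA.
move: g; apply: gen_ind => [x k|g IH|g IH|g IH|g IH].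
- rewrite /dev dev1 => ck; apply: PlacedBase; exists k => //.
  by rewrite /pos mul1g.
- by apply: (across _ _ _ gSS (dev_step vS genS g)).
- by apply: (across _ _ _ gRR (dev_step vS genR g)).
- by apply: inner Kxy_X IH.
- by apply: inner Kxy_Y IH.
Qed.

(** The equation says that a O_x and b O_y are the same octahedron. As [dev] is single-valued, it
    carries one occurrence, with position unique up to the local group. *)
Lemma placed_unique x y a b m : placed base x a -> placed base y b -> Kgrp m ->
  (a * oc_g x * m = b * oc_g y)%g -> x = y /\ oc_Jhat y (b^-1 * a)%g.
Proof.
move=> /placed_pos[g [k [ck ->]]] /placed_pos[g' [k' [ck' ->]]] Km E.
have Kk : Kgrp k by case: ck.
have Kk' : Kgrp k' by case: ck'.
have Eg : g' = (g * (k^-1 * (m * k')))%g.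
  by move: E; rewrite /pos !mulgVK => /(congr1 (fun z => z * k')%g); rewrite mulgVK !mulgA => <-.
have := kmove ck (KgrpM (KgrpV Kk) (KgrpM Km Kk')).
rewrite -Eg mulVKg => ck2.
have [xy [j J Ej]] := cell_at_inj ck2 ck'; subst y; split=> //.
have -> : ((pos x g' k')^-1 * pos x g k = oc_g x * m^-1 * (oc_g x)^-1)%g.
  by rewrite /pos Eg; exact: grp_unique.
apply: JlocV; have -> : m = j^-1%g.
  by apply: (mulgI j); rewrite mulgV; apply: (mulIg k'); rewrite -mulgA -Ej mul1g.
exact: JlocV.
Qed.

Lemma group_determined : determines_group Sg.
Proof.
split=> [x|x a h px].
  have [c cx] := cell_at_ex x (fset_act1 Oct : Kgrp 1%g).
  have [w Hw] := valid_trans vS (sym_mark Sg) c; exists (pos x (1 * word_val w)%g 1%g).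
  apply: pos_placed; have /word_dev Ew : word_act w (dev 1%g) c by rewrite /dev dev1.
  by rewrite /dev -Ew.
have [g [k [ck Ea]]] := placed_pos px; split=> [/(dev_H vS _ g) E|pxh].
  have -> : (h * a = pos x (h * g)%g k)%g by rewrite Ea /pos !mulgA.
  by apply: pos_placed; rewrite /dev E.
have [g' [k' [ck' Ea']]] := placed_pos pxh.
have Kk : Kgrp k by case: ck. have Kk' : Kgrp k' by case: ck'.
(* The element g k^-1 k' lies in the octahedron of g but has label k', and h carries it to g'. *)
apply/(dev_H vS _ (g * (k^-1 * k'))%g).
have Eg : g' = (h * (g * (k^-1 * k')))%g.
  move: Ea'; rewrite Ea /pos => /(congr1 (fun z => z * oc_g x * k')%g).
  by rewrite !mulgA !mulgVK => <-.
have c2 := kmove ck (KgrpM (KgrpV Kk) Kk'); rewrite mulVKg in c2.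
rewrite -Eg; exact: cell_at_fun ck' c2.
Qed.

(** In developed position a transport does not move the cell, a t^-1 u = a s; only the octahedron
    through which it is seen changes. *)
Lemma transp_sound (x : occ D) s t (y : occ D) u : transp x s t y u -> t •• s = u /\
  forall a, placed base x a -> placed base y (a * t^-1)%g.
Proof.
elim=> [|{}t {}y {}u j _ [<- IH] Jj|{}t {}y {}u f _ [<- IH] st _].
- by split=> [|a pa]; rewrite ?fset_act1 ?invg1 ?mulg1.
- split=> [|a /IH pa]; first exact: fset_actM.
  rewrite invgM mulgA; apply: PlacedLocal => //; exact: sg_inv.
- split=> [|a /IH pa]; first exact: fset_actM.
  by rewrite invgM mulgA; apply: PlacedFace.
Qed.

Lemma grp_chain (Gam : groupType) (a t j x k : Gam) :
  (a * t^-1 * x * k = a * ((x * j^-1 * x^-1) * t)^-1 * x * (j^-1 * k))%g.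
Proof. by rewrite !invgM !invgK !mulgA !mulgVK mulgK. Qed.

Lemma grp_chain2 (Gam : groupType) (a t q x y k r : Gam) : (r * r = 1)%g ->
  (a * t^-1 * x * k * r = a * ((y * q * x^-1) * t)^-1 * y * (q * k * r^-1))%g.
Proof.
move=> rr; have -> : (r^-1 = r)%g by apply: (mulgI r); rewrite mulgV rr.
by rewrite !invgM !invgK !mulgA !mulgVK.
Qed.

Lemma Kgrp_across (x : occ D) (f : {fset P1}) k t : is_face Oct f -> (t * t = 1)%g ->
  (forall g, step_across t f (dev g) (dev (g * t)%g)) -> Kgrp k -> k •• f \in oc_stored x ->
  Kgrp (oc_q x (k •• f) * k * t^-1)%g.
Proof.
move=> ff tt H Kk st; have [a pa] : exists a, placed base x a by have [H1 _] := group_determined; exact: (H1 x).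
have [g [k1 [ck1 _]]] := placed_pos pa.
have [g' [ck _]] := cell_at_pos ck1 Kk.
by have [] := across_indep ff ck st (H g').
Qed.

(** Lifts a chain of octahedra around the cell to a composite of recorded transports. Before each
    crossing a local element moves the face to its stored representative, and the inclusion of the
    cell in the face is carried along. *)
Lemma transp_link (x : occ D) a s n : placed base x a ->
  link (a •• s) (a * oc_g x)%g n ->
  exists y t k, [/\ transp x s t y (t •• s), Kgrp k & n = (a * t^-1 * oc_g y * k)%g].
Proof.
move=> pa.
have step_t (f : {fset P1}) r (y : occ D) t k : is_face Oct f -> (r * r = 1)%g ->
    (forall g, step_across r f (dev g) (dev (g * r)%g)) ->
    transp x s t y (t •• s) -> Kgrp k ->
    (a •• s `<=` (a * t^-1 * oc_g y * k)%g •• f)%fset ->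
    exists y' t' k', [/\ transp x s t' y' (t' •• s), Kgrp k' &
      (a * t^-1 * oc_g y * k * r = a * t'^-1 * oc_g y' * k')%g].
  move=> ff rr H tr Kk sub.
  have fk : is_face Oct (k •• f) by rewrite -Kk is_faceE.
  have [f1 [[st [j Jj Ej]] _]] := cand_orbits cD y fk.
  have Jj' : oc_Jhat y (oc_g y * j^-1 * (oc_g y)^-1)%g by exact: JlocV.
  set t1 := ((oc_g y * j^-1 * (oc_g y)^-1) * t)%g.
  have tr1 : transp x s t1 y (t1 •• s).
    by rewrite /t1 fset_actM; apply: TranspLocal.
  have Ef1 : f1 = (j^-1 * k)%g •• f by rewrite fset_actM -Ej fset_actK.
  have Kk1 : Kgrp (j^-1 * k)%g := KgrpM (KgrpV (Jloc_K cD Jj)) Kk.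
  have En := grp_chain a t j (oc_g y) k; rewrite -/t1 in En.
  rewrite En in sub *.
  have sub1 : (t1 •• s `<=` oc_g y •• f1)%fset.
    rewrite -(fset_act_sub (a * t1^-1)%g) -!fset_actM mulgVK.
    by rewrite Ef1 -fset_actM.
  exists (oc_tgt y f1), (transport y f1 * t1)%g, (oc_q y f1 * (j^-1 * k) * r^-1)%g.
  split; last exact: grp_chain2.
    by rewrite fset_actM; apply: TranspFace.
  rewrite Ef1; apply: (Kgrp_across ff rr H Kk1).
  by rewrite -Ef1.
elim=> [|m k _ [y [t [k' [tr Kk' ->]]]] Kk|m _ [y [t [k' [tr Kk' ->]]]] sub|m _ [y [t [k' [tr Kk' ->]]]] sub].
- exists x, 1%g, 1%g; split; last by rewrite invg1 !mulg1.
    by rewrite fset_act1; exact: TranspId.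
  exact: fset_act1.
- by exists y, t, (k' * k)%g; split; [|exact: KgrpM|rewrite !mulgA].
- by apply: (step_t F_R gR) => //; [exact: face_R|exact: gRR|exact: (dev_step vS genR)].
- by apply: (step_t F_S gS) => //; [exact: face_S|exact: gSS|exact: (dev_step vS genS)].
Qed.

(** Two placed octahedra sharing a cell are linked around it. The chain lifts to a transport ending
    in the second octahedron, where [placed_unique] leaves only a local element to correct. *)
Lemma transp_complete (T : ocells) (cT : cell_theory T) (x y : occ D) a b s u :
  placed base x a -> placed base y b ->
  oc_of T (verts (oc_oct x)) s -> oc_of T (verts (oc_oct y)) u ->
  a •• s = b •• u -> transp x s (b^-1 * a)%g y u.
Proof.
move=> pa pb; rewrite !oct_verts // => os ou E.
have L : link (a •• s) (a * oc_g x)%g (b * oc_g y)%g.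
  apply: (ct_link cT); rewrite fset_actM; first exact/(ct_of cT).
  by rewrite E; exact/(ct_of cT).
have [z [t [k [tr Kk Ek]]]] := transp_link pa L.
have [_ /(_ a pa) pz] := transp_sound tr.
have [zy Jj] := placed_unique pz pb Kk (esym Ek); subst z.
have := TranspLocal tr Jj; have -> : (b^-1 * (a * t^-1) * t = b^-1 * a)%g by rewrite !mulgA mulgVK.
by congr transp; rewrite -fset_actM !mulgA mulgVK fset_actM E fset_actK.
Qed.

End Placed.

(** * Orbits, transports and stabilisers read off the symbol *)

Section Orbits.
Variables (Sg : symbol) (vS : valid Sg) (T : ocells) (cT : cell_theory T).
Let D : octdata := Sg.
Let cD : candidate D := valid_cand vS.
Let base := @base_position Sg.
Let H := Hsym Sg.
Implicit Types (x y : occ D) (s u : T).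

Lemma placed_H x a h : placed base x a -> H h -> placed base x (h * a)%g.
Proof. by have [_ h2] := group_determined vS; move=> pa /(h2 _ _ _ pa). Qed.

Lemma H_placed x a b : placed base x a -> placed base x b -> H (b * a^-1)%g.
Proof.
have [_ h2] := group_determined vS; move=> pa pb; apply/(h2 _ _ _ pa).
by rewrite mulgVK.
Qed.

Lemma placed_ex x : exists a, placed base x a.
Proof. by have [h1 _] := group_determined vS; exact: (h1 x). Qed.

(** With a, also h a is a position of x. Thus h carries one developed cell onto the other exactly
    when the octahedra at h a and b share that cell, and the transport is b^-1 h a. *)
Lemma transports_determined : determines_transports Sg T.
Proof.
move=> x y a b s u pa os pb ou h; split=> [[Hh E]|[t tr ->]].
  exists (b^-1 * (h * a))%g; last by rewrite !mulgA mulgV mul1g mulgK.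
  apply: (transp_complete vS cT (placed_H pa Hh) pb os ou).
  by rewrite fset_actM.
have [Et /(_ a pa) pt] := transp_sound tr; split.
  by have := H_placed pt pb; rewrite invgM invgK mulgA.
by rewrite !fset_actM fset_actK Et.
Qed.

Lemma sgn_eq1_und s u : oc_sgn s u = 1 -> oc_und s = oc_und u.
Proof. by move=> E; apply: (ct_neq0_und cT); rewrite E. Qed.

(** The cell lies on some octahedron g O, and [dev g] names the occurrence found there. *)
Lemma recorded (tau : T) : exists x a s,
  [/\ placed base x a, oc_of T (verts (oc_oct x)) (oc_und s) & tau = a • s].
Proof.
have [g og] := ct_cover cT tau.
have [x [k ck]] := cell_ex (dev vS g).
exists x, (pos x g k), ((pos x g k)^-1%g • tau); split; last by rewrite gactVK.
  exact: pos_placed.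
have Kk : Kgrp k by case: ck.
apply/(ct_of cT (pos x g k)); rewrite -(ct_und cT) gactVK oct_verts // -fset_actM.
by rewrite /pos mulgVK fset_actM (KgrpV Kk).
Qed.

Lemma orbit_transp x y a b s u :
  placed base x a -> oc_of T (verts (oc_oct x)) (oc_und s) ->
  placed base y b -> oc_of T (verts (oc_oct y)) (oc_und u) ->
  (exists2 h, H h & h •• oc_und (a • s) = oc_und (b • u)) <->
  (exists t, transp x (oc_und s) t y (oc_und u)).
Proof.
move=> pa os pb ou; split=> [[h Hh E]|[t tr]].
  have [|t tr _] := proj1 (transports_determined pa os pb ou h); last by exists t.
  by split=> //; move: E; rewrite !(ct_und cT).
have [Hh E] : H (b * t * a^-1)%g /\ (b * t * a^-1)%g •• a •• oc_und s = b •• oc_und u.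
  by apply/(transports_determined pa os pb ou); exists t.
by exists (b * t * a^-1)%g; rewrite ?(ct_und cT).
Qed.

Lemma local_orbit_reps (I : finType) (E : local_reps base T I) : orbit_reps H (lr_rep E).
Proof.
move=> tau; have [y [b [u [pb ou ->]]]] := recorded tau.
have [i [ti U]] := lr_unique E ou; exists i; split.
  by apply/(orbit_transp (lr_placed E i) (lr_of E i) pb ou).
by move=> j hj; apply: U; apply/(orbit_transp (lr_placed E j) (lr_of E j) pb ou).
Qed.

Lemma reps_local (I : finType) (sigma : I -> T) : orbit_reps H sigma ->
  exists E : local_reps base T I, lr_rep E = sigma.
Proof.
move=> os; have [f Hf] := choice (fun i => recorded (sigma i)).
have [g Hg] := choice Hf; have [c Hc] := choice Hg.
have P1 i : oc_of T (verts (oc_oct (f i))) (oc_und (c i)) by case: (Hc i).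
have P2 i : placed base (f i) (g i) by case: (Hc i).
have P3 y u (ou : oc_of T (verts (oc_oct y)) (oc_und u)) :
    exists! i, exists t, transp (f i) (oc_und (c i)) t y (oc_und u).
  have [b pb] := placed_ex y; have [i [hi U]] := os (b • u).
  have E3 j : sigma j = g j • c j by case: (Hc j).
  exists i; split; first by rewrite E3 in hi; apply/(orbit_transp (P2 i) (P1 i) pb ou).
  by move=> j /(orbit_transp (P2 j) (P1 j) pb ou); rewrite -E3 => /U.
exists (LocalReps P1 P2 P3); apply/funext => i; rewrite /lr_rep /=.
by case: (Hc i).
Qed.

Lemma real_at x A : oc_of T (verts (oc_oct x)) A -> exists s : T, oc_und s = A.
Proof.
rewrite oct_verts // -{1}(fset_actVK (oc_g x) A) => /(ct_of cT)/(ct_real cT)[s Es].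
by exists (oc_g x • s); rewrite (ct_und cT) Es fset_actVK.
Qed.

(* Choosing in a finite list of recorded cells the first one of each class. *)
Lemma local_reps_exist : exists I : finType, inhabited (local_reps base T I).
Proof.
pose C := (occ D * {fset P1})%type.
pose rcd (p : C) := oc_of T (verts (oc_oct p.1)) p.2.
pose R (p q : C) := exists t, transp p.1 p.2 t q.1 q.2.
have R_orb p q : rcd p -> rcd q -> forall a b, placed base p.1 a -> placed base q.1 b ->
    (R p q <-> exists2 h, H h & h •• a •• p.2 = b •• q.2).
  move=> rp rq a b pa pb; have [s Es] := real_at rp; have [u Eu] := real_at rq.
  rewrite /R -Es -Eu -!(ct_und cT); apply: iff_sym; apply: orbit_transp => //.
  - by rewrite Es. - by rewrite Eu.
have R_refl p : R p p by exists 1%g; exact: TranspId.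
have R_sym p q : rcd p -> rcd q -> R p q -> R q p.
  move=> rp rq; have [a pa] := placed_ex p.1; have [b pb] := placed_ex q.1.
  move=> /(R_orb _ _ rp rq _ _ pa pb)[h Hh E]; apply/(R_orb _ _ rq rp _ _ pb pa).
  by exists h^-1%g; [exact: sg_inv|rewrite -E fset_actK].
have R_trans p q r : rcd p -> rcd q -> rcd r -> R p q -> R q r -> R p r.
  move=> rp rq rr; have [a pa] := placed_ex p.1; have [b pb] := placed_ex q.1.
  have [c pc] := placed_ex r.1.
  move=> /(R_orb _ _ rp rq _ _ pa pb)[h Hh E] /(R_orb _ _ rq rr _ _ pb pc)[h' Hh' E'].
  apply/(R_orb _ _ rp rr _ _ pa pc); exists (h' * h)%g; first exact: sg_mul.
  by rewrite fset_actM E.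
pose L : seq C := [seq (x, A) | x <- enum (occ D), A <- enum_fset (fpowerset (verts (oc_oct x)))].
have inL p : rcd p -> p \in L.
  case: p => x A rp; apply/allpairsPdep; exists x, A; split; rewrite ?mem_enum //.
  by rewrite fpowersetE; apply: (ct_sub cT).
(* The default p varies with the cell, but the search always succeeds on recorded cells, so
   equivalent ones get the same [rep]. *)
pose rep (p : C) := nth p L (find (fun q => `[< rcd q /\ R q p >]) L).
have repP p : rcd p -> rcd (rep p) /\ R (rep p) p.
  move=> rp; apply/asboolP; apply: (@nth_find _ p (fun q => `[< rcd q /\ R q p >]) L).
  by apply/hasP; exists p; [exact: inL|apply/asboolP].
have rep_eq p q : rcd p -> rcd q -> R p q -> rep p = rep q.
  move=> rp rq Rpq; rewrite /rep.
  have -> : (fun r => `[< rcd r /\ R r p >]) = (fun r => `[< rcd r /\ R r q >]).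
    apply/funext => r; apply/asbool_equiv_eq; split=> -[rr Rr]; split=> //.
      exact: R_trans rr rp rq Rr Rpq.
    exact: R_trans rr rq rp Rr (R_sym _ _ rp rq Rpq).
  apply: set_nth_default; rewrite -has_find; apply/hasP; exists q; first exact: inL.
  by apply/asboolP.
pose l := [seq rep p | p <- L & `[< rcd p >]].
have lP p : p \in l -> rcd p /\ rep p = p.
  move=> /mapP[q]; rewrite mem_filter => /andP[/asboolP rq _] ->.
  have [r1 r2] := repP q rq; split=> //; exact: rep_eq.
exists (seq_sub l : finType); constructor.
have [c Hc] := choice (fun i : seq_sub l => real_at (proj1 (lP _ (ssvalP i)))).
have [g Hg] := choice (fun i : seq_sub l => placed_ex (ssval i).1).
apply: (@LocalReps D base T _ (fun i => (ssval i).1) g c) => //.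
- by move=> i; rewrite Hc; case: (lP _ (ssvalP i)).
move=> y u ou; have rp : rcd (y, oc_und u) by [].
have inl : rep (y, oc_und u) \in l.
  by apply: map_f; rewrite mem_filter inL // andbT; apply/asboolP.
exists (SeqSub inl); split.
  by rewrite Hc /=; case: (repP _ rp).
move=> i; rewrite Hc => Ri; apply/val_inj => /=.
have [r1 r2] := lP _ (ssvalP i); rewrite -r2; exact/esym/rep_eq.
Qed.

Lemma orbits_determined : determines_orbits Sg T.
Proof.
split.
- exact: recorded.
- move=> x y a b s u pa os pb ou; split=> [[h Hh E]|[t tr E]].
    have Eu : h •• a •• oc_und s = b •• oc_und u.
      by rewrite -!(ct_und cT); exact: sgn_eq1_und.
    have [t tr Et] := proj1 (transports_determined pa os pb ou h) (conj Hh Eu).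
    by exists t => //; rewrite -(ct_sgn_act cT b) -E Et !gset_actM gactK.
  have [Hh _] := proj2 (transports_determined pa os pb ou (b * t * a^-1)%g) (ex_intro2 _ _ t tr erefl).
  by exists (b * t * a^-1)%g => //; rewrite !gset_actM gactK (ct_sgn_act cT).
- exact: local_reps_exist.
- exact: local_orbit_reps.
- exact: reps_local.
Qed.

Lemma stabilizers_determined : determines_stabilizers Sg T.
Proof.
move=> I E i h; have Hh : H (val h) by apply/sg_predP; exact: valP.
have pi := lr_placed E i; have oi := lr_of E i.
have := transports_determined pi oi pi oi (val h) => tP; split; last first.
  move=> t tr Eh; rewrite /ceps Eh /lr_rep !gset_actM gactK; exact: (ct_sgn_act cT).
rewrite /cstab /lr_rep (ct_und cT); split=> [E1|[t tr Eh]].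
  by have [t tr Et] := proj1 tP (conj Hh E1); exists t.
by have [] := proj2 tP (ex_intro2 _ _ t tr Eh).
Qed.

End Orbits.

(** * Modules over a group *)

Section AdditiveMaps.
Variables U V : zmodType.

(** Additivity of bare functions, matching the unbundled [is_ghom]. *)
Definition addm (f : U -> V) := forall u v, f (u + v) = f u + f v.

Variables (f : U -> V) (fD : addm f).

Lemma addm0 : f 0 = 0.
Proof. by apply: (addrI (f 0)); rewrite -fD !addr0. Qed.

Lemma addmN u : f (- u) = - f u.
Proof. by apply: (addrI (f u)); rewrite -fD !subrr addm0. Qed.

Lemma addmB u v : f (u - v) = f u - f v.
Proof. by rewrite fD addmN. Qed.

Lemma addm_sum (I : Type) (r : seq I) (F : I -> U) :
  f (\sum_(i <- r) F i) = \sum_(i <- r) f (F i).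
Proof. exact: (big_morph f fD addm0). Qed.

Lemma addmMn u n : f (u *+ n) = f u *+ n.
Proof. by elim: n => [|n IH]; rewrite ?mulr0n ?addm0 // !mulrS fD IH. Qed.

Lemma addmMz u n : f (u *~ n) = f u *~ n.
Proof. by case: n => n; rewrite ?NegzE -?pmulrn ?mulrNz ?addmN -?pmulrn addmMn. Qed.

End AdditiveMaps.

Lemma addm_int (V : zmodType) (f : int -> V) : addm f -> forall n, f n = f 1 *~ n.
Proof. by move=> fD n; rewrite -addmMz // intz. Qed.

Section Free.
Variables (T : choiceType) (V : zmodType).

Definition flift (f : T -> V) (v : {freeg T / int}) : V :=
  fglift (f : T -> zmodule V) v.

Lemma fliftD f : addm (flift f).
Proof.
have B u v : flift f (u - v) = flift f u - flift f v.
  exact: (lift_is_additive (f : T -> zmodule V)).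
have f0 : flift f 0 = 0 by rewrite -[0]subr0 B subrr.
have N v : flift f (- v) = - flift f v by rewrite -[- v]sub0r B f0 sub0r.
by move=> u v; rewrite -[v in LHS]opprK B N opprK.
Qed.

Lemma fliftE f t : flift f << t >> = f t.
Proof. by rewrite /flift liftU scale1r. Qed.

Lemma freeg_ext (f g : {freeg T / int} -> V) : addm f -> addm g ->
  (forall t, f << t >> = g << t >>) -> forall v, f v = g v.
Proof.
move=> fD gD E v; rewrite -(freeg_sumE v) !addm_sum //; apply: eq_bigr => x _.
by rewrite -[coeff _ _]intz -freegU_mulz !addmMz // E.
Qed.

End Free.

Section GModules.
Variables (Gam : groupType).

Lemma gmodD (M : gmodule Gam) g : addm (gmod_act g : M -> M).
Proof. by move=> u v; exact: gmod_actD. Qed.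

Lemma gmod0 (M : gmodule Gam) g : g ⊙ (0 : M) = 0.
Proof. exact: addm0 (@gmodD M g). Qed.

Lemma gmodB (M : gmodule Gam) g (u v : M) : g ⊙ (u - v) = g ⊙ u - g ⊙ v.
Proof. exact: addmB (@gmodD M g) u v. Qed.

Lemma gmodMz (M : gmodule Gam) g (u : M) n : g ⊙ (u *~ n) = (g ⊙ u) *~ n.
Proof. exact: addmMz (@gmodD M g) u n. Qed.

Lemma gmod_sum (M : gmodule Gam) g (I : Type) (r : seq I) (F : I -> M) :
  g ⊙ (\sum_(i <- r) F i) = \sum_(i <- r) g ⊙ F i.
Proof. exact: (addm_sum (@gmodD M g)). Qed.

Lemma gmodVK (M : gmodule Gam) g (u : M) : g ⊙ g^-1%g ⊙ u = u.
Proof. by rewrite -gmod_actM mulgV gmod_act1. Qed.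

Lemma fgen_act (T : gset Gam) g (t : T) : g ⊙ fgen t = fgen (g • t).
Proof. exact: fg_actU. Qed.

Section QuoLift.
Variables (M : gmodule Gam) (S : M -> Prop) (V : zmodType) (L : M -> V).
Hypotheses (LD : addm L) (LS : forall g s, S s -> L (g ⊙ s) = 0).

Let ker_0 : forall g, L (g ⊙ (0 : M)) = 0.
Proof. by move=> g; rewrite gmod0 addm0. Qed.
Let ker_B u v : (forall g, L (g ⊙ u) = 0) -> (forall g, L (g ⊙ v) = 0) ->
  forall g, L (g ⊙ (u - v)) = 0.
Proof. by move=> Hu Hv g; rewrite gmodB addmB // Hu Hv subrr. Qed.
Let ker_act h v : (forall g, L (g ⊙ v) = 0) -> forall g, L (g ⊙ h ⊙ v) = 0.
Proof. by move=> Hv g; rewrite -gmod_actM. Qed.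

(** L is only additive, so it has to kill all translates of the relations. The submodule tested is
    the largest one contained in its kernel. *)
Lemma quo_lift : exists L' : quo_gmod (gspan S) -> V,
  addm L' /\ forall v, L' (quo_pi (gspan S) v) = L v.
Proof.
pose N := @Submodule _ M (fun v => forall g, L (g ⊙ v) = 0) ker_0 ker_B ker_act.
pose L' (q : quo_gmod (gspan S)) := L (repr q).
have E v : L' (quo_pi (gspan S) v) = L v.
  apply/eqP; rewrite -subr_eq0 -(addmB LD); apply/eqP.
  have : gspan S (repr (quo_pi (gspan S) v) - v) by apply/quo_piP; rewrite quo_reprK.
  by move=> /(_ N) /= /(_ (fun s Ss g => LS g Ss) 1%g); rewrite gmod_act1.
exists L'; split=> // p q.
by rewrite -(quo_reprK p) -(quo_reprK q) -quo_piD !E LD.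
Qed.

End QuoLift.

Lemma quo_ext (M : gmodule Gam) (N : submodule M) (V : zmodType)
  (f g : quo_gmod N -> V) : (forall v, f (quo_pi N v) = g (quo_pi N v)) ->
  forall q, f q = g q.
Proof. by move=> E q; rewrite -(quo_reprK q) E. Qed.

Lemma quo_pi_addm (M : gmodule Gam) (N : submodule M) :
  addm (quo_pi N : M -> quo_gmod N).
Proof. by move=> u v; exact: quo_piD. Qed.

Lemma gspan_gen (M : gmodule Gam) (S : M -> Prop) s : S s -> gspan S s.
Proof. by move=> Ss N; apply. Qed.

Section DSum.
Variables (I : finType) (M : I -> gmodule Gam).
Implicit Types (i : I) (u : dsum M).

Lemma dsum_inD i : addm (@dsum_in _ _ M i).
Proof.
move=> v w; apply/ffunP => j; rewrite [RHS]ffunE.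
have [ij|ij] := eqVneq i j; last by rewrite !dsum_in_neq // addr0.
by subst j; rewrite !dsum_in_eq.
Qed.

Lemma dsum_in_act i g v : g ⊙ @dsum_in _ _ M i v = dsum_in (g ⊙ v).
Proof.
apply/ffunP => j; rewrite [LHS]ffunE.
have [ij|ij] := eqVneq i j; last by rewrite !dsum_in_neq // gmod0.
by subst j; rewrite !dsum_in_eq.
Qed.

Lemma dsum_sum u : u = \sum_i dsum_in ((u : dsum_type M) i) :> dsum M.
Proof.
have E (r : seq I) (F : I -> dsum M) j :
    (\sum_(i <- r) F i : dsum_type M) j = \sum_(i <- r) (F i : dsum_type M) j.
  by elim: r => [|i r IH]; rewrite ?big_nil ?big_cons [LHS]ffunE // IH.
apply/ffunP => j; rewrite E (bigD1 j) //= dsum_in_eq big1 ?addr0 // => i ij.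
by rewrite dsum_in_neq.
Qed.

Lemma dsum_ext (V : zmodType) (f g : dsum M -> V) : addm f -> addm g ->
  (forall i v, f (@dsum_in _ _ M i v) = g (dsum_in v)) -> forall u, f u = g u.
Proof.
move=> fD gD E u; rewrite (dsum_sum u) !addm_sum //.
by apply: eq_bigr => i _.
Qed.

Lemma dsum_lift (V : zmodType) (F : forall i, M i -> V) : (forall i, addm (F i)) ->
  exists L : dsum M -> V, addm L /\ forall i v, L (@dsum_in _ _ M i v) = F i v.
Proof.
move=> FD; exists (fun u => \sum_i F i ((u : dsum_type M) i)); split=> [u v|i v].
  by rewrite -big_split /=; apply: eq_bigr => i _; rewrite ffunE FD.
rewrite (bigD1 i) //= dsum_in_eq big1 ?addr0 // => j ji.
by rewrite dsum_in_neq 1?eq_sym // addm0.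
Qed.

End DSum.

Section Tensor.
Variables (L : Gam -> Prop) (eps : Gam -> int).
Local Notation ind := (induced L eps).
Local Notation ten := (@tensor Gam L eps).

Lemma zg_act (g h : Gam) : g ⊙ zg h = zg (g * h)%g.
Proof. exact: fgen_act. Qed.

Lemma rmulZD k : addm (@rmulZ Gam k).
Proof.
have B u v : rmulZ k (u - v) = rmulZ k u - rmulZ k v.
  exact: (lift_is_additive (fun h : Gam => << (h * k)%g >> : {freeg Gam / int})).
have f0 : rmulZ k 0 = 0 by rewrite -[0 in LHS](subrr 0) B subrr.
have N v : rmulZ k (- v) = - rmulZ k v by rewrite -[- v]sub0r B f0 sub0r.
by move=> u v; rewrite -[v in LHS]opprK B N opprK.
Qed.

Lemma rmulZ_zg (k h : Gam) : rmulZ k (zg h) = zg (h * k)%g.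
Proof.
rewrite /rmulZ /zg /fgen liftU; apply/eqP/freeg_eqP => z.
by rewrite coeffZ !coeffU mul1r.
Qed.

Lemma tensorDl a b n : ten (a + b) n = ten a n + ten b n.
Proof.
rewrite /tensor -quo_piD; apply/quo_piP; apply: gspan_gen.
by rewrite opprD addrA; exact: tensor_addl.
Qed.

Lemma tensorDr a m n : ten a (m + n) = ten a m + ten a n.
Proof.
rewrite /tensor -quo_piD; apply/quo_piP; apply: gspan_gen.
by rewrite opprD addrA; exact: tensor_addr.
Qed.

Lemma tensor_balance a n k : L k -> ten (rmulZ k a) n = ten a (eps k * n).
Proof. by move=> Lk; apply/quo_piP; apply: gspan_gen; exact: tensor_bal. Qed.

Lemma tensor_Mz a n : ten a n = ten a 1 *~ n.
Proof. by apply: (addm_int (f := ten a)) => m m'; exact: tensorDr. Qed.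

Lemma tensor_act_l g a n : g ⊙ ten a n = ten (g ⊙ a) n.
Proof. by rewrite [LHS]quo_act_pi; congr quo_pi; exact: fgen_act. Qed.

Lemma induced_ext (V : zmodType) (f g : ind -> V) : addm f -> addm g ->
  (forall h, f (ten (zg h) 1) = g (ten (zg h) 1)) -> forall u, f u = g u.
Proof.
move=> fD gD E; apply: quo_ext.
apply: freeg_ext => [u v|u v|[a n]]; rewrite ?quo_piD ?fD ?gD //.
rewrite -[quo_pi _ _]/(ten a n) tensor_Mz !addmMz //; congr (_ *~ _).
move: a; apply: freeg_ext => [u v|u v|h]; rewrite ?tensorDl ?fD ?gD //.
exact: E.
Qed.

(** The universal property of the induced module, expressed by values on the generators g (x) 1. *)
Lemma induced_lift (V : zmodType) (m : Gam -> V) :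
  (forall g k, L k -> m (g * k)%g = m g *~ eps k) ->
  exists f : ind -> V, addm f /\ forall g, f (ten (zg g) 1) = m g.
Proof.
move=> Hm; pose M1 : group_ring Gam -> V := flift m.
have M1D : addm M1 by exact: fliftD.
have M1E h : M1 (zg h) = m h by exact: fliftE.
pose B : tensor_gens Gam -> V := fun p => M1 p.1 *~ p.2.
pose F : free_gmod (tensor_gens Gam) -> V := flift B.
have FD : addm F by exact: fliftD.
have FE g a n : F (g ⊙ tgen a n) = M1 (g ⊙ a) *~ n by rewrite fgen_act [LHS]fliftE.
have [f [fD fE]] : exists f : ind -> V, addm f /\ forall v, f (quo_pi _ v) = F v.
  apply: quo_lift => // g s [a b n|a n n'|a n k Lk];
    rewrite !gmodB !addmB // !FE ?gmod_actD ?M1D.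
  - by rewrite mulrzDl -addrA -opprD subrr.
  - by rewrite mulrzDr -addrA -opprD subrr.
  - rewrite mulrzA; apply/eqP; rewrite subr_eq0; apply/eqP; congr (_ *~ _).
    move: a; apply: freeg_ext => [u v|u v|h].
    + by rewrite rmulZD gmod_actD M1D.
    + by rewrite gmod_actD M1D mulrzDl.
    + by rewrite -[<< h >>]/(zg h) rmulZ_zg !zg_act !M1E mulgA (Hm _ k Lk).
exists f; split=> // g; rewrite [LHS]fE -[tgen _ _]gmod_act1 FE gmod_act1 M1E.
by rewrite mulr1z.
Qed.

End Tensor.
End GModules.

(** * Chain groups as sums of induced modules *)

Section Chains.
Variables (T : ocells) (cT : cell_theory T).

Lemma chain_act g (t : T) : g ⊙ chain t = chain (g • t).
Proof. by rewrite [LHS]quo_act_pi fgen_act. Qed.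

Lemma chain_sgn (t t' : T) : oc_und t = oc_und t' -> chain t = chain t' *~ oc_sgn t t'.
Proof.
move=> /(ct_und_neq0 cT) n; rewrite -(addmMz (@quo_pi_addm _ _ _)).
by apply/quo_piP; apply: gspan_gen; exact: OrientRel.
Qed.

Lemma chains_ext (V : zmodType) (f g : chains T -> V) : addm f -> addm g ->
  (forall t, f (chain t) = g (chain t)) -> forall c, f c = g c.
Proof.
move=> fD gD E; apply: quo_ext.
by apply: freeg_ext => [u v|u v|t]; rewrite ?quo_piD ?fD ?gD //; exact: E.
Qed.

Lemma chains_lift (V : zmodType) (f : T -> V) :
  (forall t t', oc_und t = oc_und t' -> f t = f t' *~ oc_sgn t t') ->
  exists L : chains T -> V, addm L /\ forall t, L (chain t) = f t.
Proof.
move=> Hf; pose F : free_gmod T -> V := flift f.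
have FD : addm F by exact: fliftD.
have FE t : F (fgen t) = f t by exact: fliftE.
have [L [LD LE]] : exists L : chains T -> V, addm L /\ forall v, L (quo_pi _ v) = F v.
  apply: quo_lift => // g s [t t' n].
  rewrite gmodB gmodMz !fgen_act (addmB FD) (addmMz FD) !FE.
  rewrite (Hf (g • t) (g • t')) ?(ct_sgn_act cT) ?subrr //.
  by rewrite !(ct_und cT) (ct_neq0_und cT n).
by exists L; split=> // t; rewrite [LHS]LE.
Qed.

End Chains.

Section OrbitModule.
Variables (T : ocells) (cT : cell_theory T) (H : subgroup G).
Variables (I : finType) (sigma : I -> T) (os : orbit_reps H sigma).

Let sgn_act h (s u : T) : oc_sgn (h • s) (h • u) = oc_sgn s u := ct_sgn_act cT h s u.

Lemma HsgP (g : G) : H g -> exists h : sg_type H, val h = g.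
Proof. by move=> Hg; exists (Sub g (introT (sg_predP H g) Hg)); rewrite SubK. Qed.

Lemma sgP (h : sg_type H) : H (val h).
Proof. by apply/sg_predP; exact: valP. Qed.

Lemma valM (g h : sg_type H) : val (g * h)%g = (val g * val h)%g.
Proof. by []. Qed.

Lemma orbit_ex (t : T) : exists i (h : sg_type H), oc_und t = oc_und (val h • sigma i).
Proof.
have [i [[g Hg E] _]] := os t; have [h Eh] := HsgP Hg.
by exists i, h; rewrite (ct_und cT) Eh E.
Qed.

Lemma orbit_unique (i j : I) (h k : sg_type H) :
  oc_und (val h • sigma i) = oc_und (val k • sigma j) -> i = j.
Proof.
move=> E; have [l [_ U]] := os (val k • sigma j).
have <- : l = i by apply: U; exists (val h); [exact: sgP|rewrite -E (ct_und cT)].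
by apply: U; exists (val k); [exact: sgP|rewrite (ct_und cT)].
Qed.

(** Frobenius reciprocity over all orbits. Twisted invariance makes the value at a cell t
    independent of the way t is written as +-h sigma_i. *)
Lemma ext_from_reps (V : gmodule (sg_type H)) (v : I -> V) :
  (forall i, twisted_inv (sigma i) (v i)) ->
  exists L : chains T -> V, [/\ addm L,
    forall (h : sg_type H) c, L (val h ⊙ c) = h ⊙ L c &
    forall i, L (chain (sigma i)) = v i].
Proof.
move=> tv; have [p Hp] := choice orbit_ex; have [q Hq] := choice Hp.
pose f (t : T) : V := (q t ⊙ v (p t)) *~ oc_sgn t (val (q t) • sigma (p t)).
have fE t i h : oc_und t = oc_und (val h • sigma i) ->
    f t = (h ⊙ v i) *~ oc_sgn t (val h • sigma i).
  move=> Et; have Eu := etrans (esym (Hq t)) Et; have Ei := orbit_unique Eu.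
  rewrite /f; move: (Hq t) Eu; rewrite Ei => Ht Eu.
  have ck : cstab (sigma i) (h^-1 * q t)%g.
    by rewrite /cstab /= fset_actM -(ct_und cT) Eu (ct_und cT) fset_actK.
  have -> : q t ⊙ v i = (h ⊙ v i) *~ oc_sgn (val (q t) • sigma i) (val h • sigma i).
    have E1 := tv i _ ck; rewrite gmod_actM in E1.
    rewrite -(gmodVK h (q t ⊙ _)) E1 gmodMz; congr (_ *~ _).
    rewrite /ceps -(sgn_act (val h)) -gset_actM; congr oc_sgn.
    by rewrite /= mulVKg.
  by rewrite -mulrzA mulrC (ct_sgnM cT).
have [L [LD LE]] : exists L : chains T -> V, addm L /\ forall t, L (chain t) = f t.
  apply: (chains_lift cT) => t t' E.
  have [i [h Et']] := orbit_ex t'.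
  rewrite (fE t i h (etrans E Et')) (fE t' i h Et') -mulrzA; congr (_ *~ _).
  by rewrite mulrC (ct_sgnM cT).
exists L; split=> // [h c|i]; last first.
  rewrite LE (fE _ i 1%g); last by rewrite gset_act1.
  by rewrite gset_act1 (ct_sgn_refl cT) gmod_act1.
move: c; apply: chains_ext => [u w|u w|t]; rewrite ?gmod_actD ?LD ?gmod_actD //.
rewrite chain_act !LE; have [i [k Et]] := orbit_ex t.
rewrite (fE t i k Et) (fE _ i (h * k)%g).
  by rewrite gmodMz gmod_actM /= gset_actM sgn_act.
by rewrite /= gset_actM !(ct_und cT) Et (ct_und cT).
Qed.

Definition ind_gen (i : I) (h : sg_type H) : ind_sum H sigma :=
  ind_in sigma i (tensor (zg h) 1).

Lemma ind_gen_act i (g h : sg_type H) : g ⊙ ind_gen i h = ind_gen i (g * h)%g.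
Proof. by rewrite /ind_gen [LHS]dsum_in_act tensor_act_l zg_act. Qed.

Lemma ind_sum_ext (V : zmodType) (f g : ind_sum H sigma -> V) : addm f -> addm g ->
  (forall i h, f (ind_gen i h) = g (ind_gen i h)) -> forall u, f u = g u.
Proof.
move=> fD gD E; apply: dsum_ext => // i; apply: induced_ext => [u v|u v|h].
- by rewrite (dsum_inD (M := fun i => Ind H (sigma i))) fD.
- by rewrite (dsum_inD (M := fun i => Ind H (sigma i))) gD.
- exact: E.
Qed.

Lemma ind_sum_ghom (V : gmodule (sg_type H)) (f : ind_sum H sigma -> V) : addm f ->
  (forall i g h, f (ind_gen i (g * h)%g) = g ⊙ f (ind_gen i h)) -> is_ghom f.
Proof.
move=> fD E; split=> // g; apply: ind_sum_ext => [u v|u v|i h].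
- by rewrite gmod_actD fD.
- by rewrite fD gmod_actD.
- by rewrite ind_gen_act E.
Qed.

Lemma cstab_chain i (k : sg_type H) : cstab (sigma i) k ->
  val k ⊙ chain (sigma i) = chain (sigma i) *~ ceps (sigma i) k.
Proof.
by move=> ck; rewrite chain_act; apply: chain_sgn => //; rewrite (ct_und cT).
Qed.

(** The inverse map comes from [ext_from_reps] with the values 1 (x) 1, which are twisted invariant
    by the balancing relation. *)
Lemma orbit_module : exists (Psi : ind_sum H sigma -> gres H (chains T))
    (Th : gres H (chains T) -> ind_sum H sigma),
  [/\ is_ghom Psi, is_ghom Th, cancel Psi Th, cancel Th Psi &
      forall i h, Psi (ind_gen i h) = val h ⊙ chain (sigma i)].
Proof.
have [Psi [PD PE]] : exists Psi : ind_sum H sigma -> chains T, addm Psi /\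
    forall i h, Psi (ind_gen i h) = val h ⊙ chain (sigma i).
  have F i : exists f : Ind H (sigma i) -> chains T, addm f /\
      forall h, f (tensor (zg h) 1) = val h ⊙ chain (sigma i).
    apply: (induced_lift (m := fun h : sg_type H => val h ⊙ chain (sigma i))) => g k ck.
    by rewrite valM gmod_actM cstab_chain // gmodMz.
  pose f i := sval (cid (F i)).
  have fD i : addm (f i) by case: (svalP (cid (F i))).
  have fE i h : f i (tensor (zg h) 1) = val h ⊙ chain (sigma i).
    by case: (svalP (cid (F i))) => _; apply.
  have [L [LD LE]] := dsum_lift fD; exists L; split=> // i h.
  by rewrite [LHS]LE fE.
have tw i : twisted_inv (V := ind_sum H sigma) (sigma i) (ind_gen i 1%g).
  move=> k ck; rewrite ind_gen_act mulg1 /ind_gen -[X in zg X]mul1g -rmulZ_zg.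
  rewrite tensor_balance // mulr1 tensor_Mz.
  exact: (addmMz (@dsum_inD _ _ (fun i => Ind H (sigma i)) i)).
have [Th [TD TE TG]] := ext_from_reps tw.
exists Psi, Th; split=> //.
- by apply: ind_sum_ghom => // i g h; rewrite !PE valM gmod_actM.
- apply: ind_sum_ext => [u v|//|i h]; first by rewrite PD TD.
  by rewrite PE TE TG ind_gen_act mulg1.
- apply: chains_ext => [u v|//|t]; first by rewrite TD PD.
  have [i [h Et]] := orbit_ex t.
  rewrite (chain_sgn cT Et) -chain_act (addmMz TD) (addmMz PD) TE TG ind_gen_act.
  by rewrite mulg1 PE.
Qed.

End OrbitModule.

(** * Exactness *)

Section SubGmod.
Variables (Gam : groupType) (M : gmodule Gam) (N : submodule M).

Definition sval_sub (v : sub_gmod N) : M := sub_val v.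

Lemma sval_subD : addm sval_sub. Proof. by move=> u v; exact: (raddfD val). Qed.

Lemma sval_sub_inj : injective sval_sub. Proof. exact: val_inj. Qed.

Lemma sval_sub_act g v : sval_sub (g ⊙ v) = g ⊙ sval_sub v. Proof. by []. Qed.

End SubGmod.

Lemma st_class_ghom : is_ghom st_class.
Proof. by split=> [u v|g v]; [exact: quo_piD|rewrite [RHS]quo_act_pi]. Qed.

(** There are no 1-simplices, so the relations lie in the zero submodule. *)
Lemma st_class_inj : injective st_class.
Proof.
move=> u v /quo_piP H.
have N0B (x y : Delta0) : x = 0 -> y = 0 -> x - y = 0 by move=> -> ->; rewrite subrr.
have N0a g (x : Delta0) : x = 0 -> g ⊙ x = 0 by move=> ->; exact: gmod0.
have := H (@Submodule _ Delta0 (fun x => x = 0) erefl N0B N0a).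
by move=> E; apply/eqP; rewrite -subr_eq0; apply/eqP; apply: E => s [a [b [[]]]].
Qed.

Lemma st_class_bij : bijective st_class.
Proof.
exists (fun q : St_F => repr q : Delta0) => [v|q]; last exact: quo_reprK.
by apply: st_class_inj; exact: quo_reprK.
Qed.

Lemma dcuspE a b : sval_sub (dcusp a b) = fgen b - fgen a. Proof. by []. Qed.

Lemma dcuspN a b : dcusp b a = - dcusp a b.
Proof. by apply: sval_sub_inj; rewrite (addmN (@sval_subD _ _ _)) !dcuspE opprB. Qed.

Lemma dcuspD a b c : dcusp a b + dcusp b c = dcusp a c.
Proof. by apply: sval_sub_inj; rewrite sval_subD !dcuspE addrC addrA subrK. Qed.

Lemma dcusp0 a : dcusp a a = 0.
Proof. by apply: sval_sub_inj; rewrite (addm0 (@sval_subD _ _ _)) dcuspE subrr. Qed.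

Lemma dcusp_act g a b : g ⊙ dcusp a b = dcusp (g • a) (g • b).
Proof. by apply: sval_sub_inj; rewrite sval_sub_act !dcuspE gmodB !fgen_act. Qed.

(** Total in the pair of cusps, as the transport in [flat_section] has to be; 0 is a default off the
    edges. *)
Definition che (p : P1 * P1) : chains edges :=
  if pselect (gauss_edge p.1 p.2) is left e then chain (@MkOedge p (asboolT e) : edges)
  else 0.

Lemma cheE (e : edges) : che (oe_val e) = chain e.
Proof.
rewrite /che; case: pselect => [h|[]]; last exact/asboolP/oe_valP.
by congr chain; apply: val_inj.
Qed.

Lemma che_swap a b : che (b, a) = - che (a, b).
Proof.
rewrite /che /=; case: pselect => [h|h]; case: pselect => [h'|h']; rewrite ?oppr0 //.
- rewrite (chain_sgn edge_theory (t' := @MkOedge (a, b) (asboolT h') : edges)).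
    have -> : oc_sgn (@MkOedge (b, a) (asboolT h) : edges) (@MkOedge (a, b) (asboolT h') : edges) = -1.
      by apply: (@psgn_swap _ (a, b)); exact: gauss_edge_neq h'.
    by rewrite mulrN1z.
  by rewrite [LHS]fsetUC.
- by case: h'; exact: gauss_edge_sym.
- by case: h; exact: gauss_edge_sym.
Qed.

Definition tche (p : P1 * P1 * P1) : chains edges :=
  che (p.1.1, p.1.2) + che (p.1.2, p.2) + che (p.2, p.1.1).

Lemma tche_orders p q : distinct3 q -> p \in orders3 q -> tche p = tche q *~ tsgn p q.
Proof.
case: q => [[a b] c] d.
have d1 : distinct3 (b, c, a) by apply: distinct3_orders d; rewrite !inE eqxx ?orbT.
have d2 : distinct3 (c, a, b) by apply: distinct3_orders d; rewrite !inE eqxx ?orbT.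
have rot x y z : tche (y, z, x) = tche (x, y, z).
  by rewrite /tche /= addrC addrA.
have odd x y z : distinct3 (x, y, z) -> tche (y, x, z) = tche (x, y, z) *~ tsgn (y, x, z) (x, y, z).
  move=> dx; rewrite -[tsgn _ _]opprK -(tsgn_swap (y, x, z) dx) tsgn_refl mulrN1z.
  by rewrite /tche /= !opprD -!che_swap -addrA [X in _ + X]addrC addrA.
have even p0 q0 : tche p0 = tche q0 -> tsgn p0 q0 = 1 -> tche p0 = tche q0 *~ tsgn p0 q0.
  by move=> -> ->.
rewrite !inE => /or4P[|||/or3P[]] /eqP ->.
- by apply: even; rewrite ?tsgn_refl.
- by apply: even; [exact: rot|rewrite -(tsgn_rot (b, c, a) a b c) tsgn_refl].
- apply: even; first by rewrite (rot b c a) rot.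
  by rewrite -(tsgn_rot (c, a, b) a b c) -(tsgn_rot (c, a, b) b c a) tsgn_refl.
- exact: odd.
- by rewrite odd // (rot b c a) (rot a b c) (tsgn_rot _ b c a) tsgn_rot.
- by rewrite odd // (rot a b c) tsgn_rot.
Qed.

Lemma bedge_sum (t : triangles) :
  \sum_(r < 3) chain (bedge t r : edges) = tche (ot_val t).
Proof.
by rewrite !big_ord_recl big_ord0 /= addr0 addrA -!cheE.
Qed.

Lemma boundary_maps : exists (d2 : chains triangles -> chains edges)
    (d1 : chains edges -> Delta0),
  [/\ is_ghom d2, is_ghom d1,
    (forall e : edges, d1 (chain e) = dcusp (oe_val e).1 (oe_val e).2) &
    (forall t : triangles, d2 (chain t) = \sum_(r < 3) chain (bedge t r : edges))].
Proof.
have [|d1 [d1D d1E]] := @chains_lift edges edge_theory Delta0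
  (fun e : edges => dcusp (oe_val e).1 (oe_val e).2).
  move=> e e' E; have n' := oedge_neq e'.
  have S : oc_sgn e e' = psgn (oe_val e) (oe_val e') by [].
  have [Ee|Ee] := pset_cases n' E; rewrite {}S Ee.
    by rewrite /psgn eqxx.
  by rewrite (psgn_swap n') mulrN1z -dcuspN.
have [|d2 [d2D d2E]] := @chains_lift triangles tri_theory (chains edges)
  (fun t : triangles => \sum_(r < 3) chain (bedge t r : edges)).
  move=> t t' E; rewrite !bedge_sum; apply: tche_orders; first exact: otri_distinct.
  by apply: tset_cases; [exact: otri_distinct|exact: E].
exists d2, d1; split=> //; split=> // g.
- apply: chains_ext => [u v|u v|t]; rewrite ?gmod_actD ?d2D ?gmod_actD //.
  rewrite (chain_act (T := triangles)) !d2E gmod_sum; apply: eq_bigr => r _.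
  rewrite (chain_act (T := edges)); congr chain; apply: val_inj.
  by case: r => -[|[|[|[]]]].
- apply: chains_ext => [u v|u v|e]; rewrite ?gmod_actD ?d1D ?gmod_actD //.
  by rewrite (chain_act (T := edges)) !d1E dcusp_act.
Qed.

Section Exactness.
Variables (d2 : chains triangles -> chains edges) (d1 : chains edges -> Delta0).
Hypotheses (d2h : is_ghom d2) (d1h : is_ghom d1).
Hypothesis d1E : forall e : edges, d1 (chain e) = dcusp (oe_val e).1 (oe_val e).2.
Hypothesis d2E : forall t : triangles, d2 (chain t) = \sum_(r < 3) chain (bedge t r : edges).

Let d1D : addm d1 := proj1 d1h.
Let d2D : addm d2 := proj1 d2h.

Lemma d1_che a b : gauss_edge a b -> d1 (che (a, b)) = dcusp a b.
Proof.
by move=> e; have := cheE (@MkOedge (a, b) (asboolT e)) => /= ->; rewrite d1E.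
Qed.

Lemma d2_tche a b c : gauss_tri a b c -> exists u, d2 u = tche (a, b, c).
Proof.
move=> t; exists (chain (@MkOtri (a, b, c) (asboolT t) : triangles)).
by rewrite d2E bedge_sum.
Qed.

Lemma d1_d2 u : d1 (d2 u) = 0.
Proof.
have D : addm (fun u => d1 (d2 u)) by move=> x y; rewrite d2D d1D.
apply: (chains_ext (f := fun u => d1 (d2 u)) (g := fun=> 0) D) => [x y|t].
  by rewrite addr0.
have /asboolP/gauss_tri_edges[e1 e2 e3] := ot_valP t.
rewrite d2E bedge_sum /tche !d1D !d1_che // !dcuspD.
exact: dcusp0.
Qed.

Lemma d1_surj : Defs.surjective d1.
Proof.
have H al : exists u, d1 u = dcusp None al.
  move: al; apply: cusp_connected.
    by exists 0; rewrite (addm0 d1D) dcusp0.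
  move=> al be e [u Eu]; exists (u + che (al, be)).
  by rewrite d1D Eu d1_che // dcuspD.
have [w Hw] := choice H.
move=> v; pose c := sval_sub v : {freeg P1 / int}.
(* A divisor of degree 0 is the sum of its multiples n_x ([x] - [oo]), each the image of a path from
   oo to x. *)
exists (\sum_(x <- dom c) w x *~ coeff x c).
apply: sval_sub_inj; rewrite (addm_sum d1D) (addm_sum (@sval_subD _ _ _)).
transitivity (\sum_(x <- dom c) (fgen x - fgen (None : P1)) *~ coeff x c).
  apply: eq_bigr => x _.
  by rewrite (addmMz d1D) (addmMz (@sval_subD _ _ _)) Hw dcuspE.
have Ec : \sum_(x <- dom c) fgen x *~ coeff x c = c :> free_gmod P1.
  rewrite -[RHS]freeg_sumE; apply: eq_bigr => x _.
  by rewrite -[in RHS](intz (coeff x c)) -freegU_mulz.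
have Ed : \sum_(x <- dom c) coeff x c = 0.
  have /sm_predP/= := sub_valP v; rewrite -/(sval_sub v) -/c => E0.
  transitivity (deg c) => //; rewrite -{3}(freeg_sumE c) raddf_sum.
  by apply: eq_bigr => x _ /=; rewrite degU.
under eq_bigr do rewrite mulrzBl.
rewrite sumrB Ec; have -> : \sum_(x <- dom c) fgen (None : P1) *~ coeff x c = 0.
  rewrite -(addm_sum (f := fun n => (fgen (None : P1) : free_gmod P1) *~ n)).
    by rewrite Ed.
  by move=> m n; rewrite mulrzDr.
by rewrite subr0.
Qed.

Let im0 : exists u, d2 u = 0. Proof. by exists 0; exact: addm0. Qed.
Let imB x y : (exists u, d2 u = x) -> (exists u, d2 u = y) -> exists u, d2 u = x - y.
Proof. by move=> [u <-] [v <-]; exists (u - v); exact: addmB. Qed.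
Let im_act g x : (exists u, d2 u = x) -> exists u, d2 u = g ⊙ x.
Proof. by move=> [u <-]; exists (g ⊙ u); case: d2h => _ ->. Qed.

(* The classes of the edges in C_1 / im d_2 form a flat cocycle, so they are
   the differences of a function on the cusps. *)
Lemma exact_d2_d1 : exact_at d2 d1.
Proof.
move=> v; split=> [E|[u <-]]; last exact: d1_d2.
pose N := @Submodule _ (chains edges) (fun x => exists u, d2 u = x) im0 imB im_act.
pose cl : chains edges -> quo_gmod N := quo_pi N.
have clD : addm cl by exact: quo_pi_addm.
suff : cl v = 0.
  by rewrite -(addm0 clD) => /quo_piP; rewrite subr0.
have [|al be ga x /d2_tche Im|s [_ sE]] :=
  @flat_section (quo_gmod N) (fun al be x => x + cl (che (al, be))) 0.
- by move=> al be x _; rewrite -addrA -clD (che_swap al be) subrr (addm0 clD) addr0.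
- rewrite -!addrA -!clD; have -> : cl (che (al, be) + (che (be, ga) + che (ga, al))) = cl 0.
    by apply/quo_piP; rewrite subr0 addrA.
  by rewrite (addm0 clD) addr0.
(* The linear extension of the potential s recovers the class of a chain from its image under d1. *)
pose La (w : Delta0) : quo_gmod N := flift s (sval_sub w).
have LaD : addm La by move=> x y; rewrite /La sval_subD fliftD.
suff H : forall c, La (d1 c) = cl c by rewrite -H E (addm0 LaD).
have D : addm (fun c => La (d1 c)) by move=> x y; rewrite d1D LaD.
apply: (chains_ext D clD) => e.
have eP : gauss_edge (oe_val e).1 (oe_val e).2 by exact/asboolP/oe_valP.
rewrite d1E /La dcuspE (addmB (fliftD s)) !fliftE (sE _ _ eP) addrC addKr.
by rewrite -cheE -surjective_pairing.
Qed.

End Exactness.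

(** * Induced presentations *)

Section ChangeIso.
Variables (T : ocells) (cT : cell_theory T) (H : subgroup G).
Implicit Types (h k g : sg_type H).

Lemma valV h : val (h^-1)%g = (val h)^-1%g.
Proof. by []. Qed.

Section TwoCells.
Variables s s' : T.

Definition moves h := val h •• oc_und s = oc_und s'.
Let sg h : int := oc_sgn (val h • s) s'.

Lemma moves_und h : moves h -> oc_und (val h • s) = oc_und s'.
Proof. by move=> E; rewrite (ct_und cT). Qed.

Let ten (g : sg_type H) n : Ind H s' := tensor (zg g) n.

(** Two elements moving s to s' differ by an element of the stabiliser of s', which crosses the
    tensor sign as its orientation character. *)
Lemma tensor_change g h h' : moves h -> moves h' ->
  ten (g * h'^-1)%g (sg h') = ten (g * h^-1)%g (sg h).
Proof.
move=> mh mh'; pose k := (h * h'^-1)%g.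
have ck : cstab s' k.
  by rewrite /cstab /k valM valV fset_actM -{1}mh' fset_actK.
have -> : (g * h'^-1 = g * h^-1 * k)%g by rewrite /k mulgA mulgVK.
rewrite /ten -rmulZ_zg tensor_balance //; congr tensor.
have Eh : val h • s = val k • val h' • s by rewrite -gset_actM -valM /k mulgVK.
have E1 : oc_sgn (val h • s) (val k • s') = sg h' by rewrite Eh (ct_sgn_act cT).
rewrite -E1 mulrC; apply: (ct_sgnM cT); rewrite !(ct_und cT); last exact: ck.
by rewrite mh ck.
Qed.

Lemma change_iso_exists : (exists h, moves h) ->
  exists phi : Ind H s -> Ind H s', is_ghom phi /\
  forall h, moves h -> forall a n, phi (tensor a n) = tensor (rmulZ h^-1%g a) (sg h * n).
Proof.
move=> [h mh]; pose m g := ten (g * h^-1)%g (sg h).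
have [g k ck|phi [pD pE]] := @induced_lift _ (@cstab H T s) (@ceps H T s) (Ind H s') m.
  have mk : moves (h * k^-1)%g.
    have ckV : (val k)^-1%g •• oc_und s = oc_und s by rewrite -[in LHS]ck fset_actK.
    by rewrite /moves valM valV fset_actM ckV.
  have := tensor_change g mh mk; rewrite invgM invgK mulgA /m => <-.
  rewrite /ten tensor_Mz [in RHS]tensor_Mz -mulrzA; congr (_ *~ _).
  rewrite /sg valM gset_actM.
  have Ek : oc_und (val h • val k^-1%g • s) = oc_und (val h • s).
    by rewrite !(ct_und cT) valV -[in LHS]ck fset_actK.
  rewrite -(ct_sgnM cT Ek (moves_und mh)) (ct_sgn_act cT) mulrAC.
  have -> : oc_sgn (val k^-1%g • s) s = oc_sgn s (val k • s).
    by rewrite -(ct_sgn_act cT (val k)) valV gactVK.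
  by rewrite (ct_sgnM cT) ?(ct_sgn_refl cT) ?mul1r // (ct_und cT) ck.
have fE : forall h', moves h' -> forall a n,
    phi (tensor a n) = tensor (rmulZ h'^-1%g a) (sg h' * n).
  move=> h' mh' a n; rewrite tensor_Mz (addmMz pD) [RHS]tensor_Mz mulrzA; congr (_ *~ _).
  rewrite -tensor_Mz; move: a; apply: freeg_ext => [u v|u v|g].
  - by rewrite tensorDl pD.
  - by rewrite rmulZD tensorDl.
  by rewrite -[<< g >>]/(zg g) pE rmulZ_zg; exact/esym/tensor_change.
exists phi; split=> //; split=> // g; apply: induced_ext => [u v|u v|k].
- by rewrite gmod_actD pD.
- by rewrite pD gmod_actD.
by rewrite tensor_act_l zg_act !pE /m /ten tensor_act_l zg_act mulgA.
Qed.

End TwoCells.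

Lemma moves_inv s s' h : moves s s' h -> moves s' s h^-1%g.
Proof. by rewrite /moves => <-; exact: fset_actK. Qed.

Lemma change_iso_bij s s' : (exists h, moves s s' h) ->
  exists phi : Ind H s -> Ind H s', [/\ is_ghom phi, bijective phi &
  forall h, moves s s' h -> forall a n,
    phi (tensor a n) = tensor (rmulZ h^-1%g a) (oc_sgn (val h • s) s' * n)].
Proof.
move=> ex; have [phi [ph pE]] := change_iso_exists ex.
have [h mh] := ex; have mV := moves_inv mh.
have [psi [qh qE]] := change_iso_exists (ex_intro _ _ mV).
have S : oc_sgn (val h^-1%g • s') s * oc_sgn (val h • s) s' = 1.
  rewrite -(ct_sgn_act cT (val h)) valV gactVK.
  by rewrite (ct_sgnM cT) ?(ct_sgn_refl cT) // (moves_und mh).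
exists phi; split=> //; exists psi.
- apply: induced_ext => [u v|//|g]; first by rewrite (proj1 ph) (proj1 qh).
  by rewrite (pE h mh) (qE _ mV) !rmulZ_zg invgK mulgVK mulr1 S.
- apply: induced_ext => [u v|//|g]; first by rewrite (proj1 qh) (proj1 ph).
  by rewrite (qE _ mV) (pE h mh) !rmulZ_zg invgK mulgK mulr1 mulrC S.
Qed.

Variables (I I' : finType) (sigma : I -> T) (sigma' : I' -> T).
Hypotheses (os : orbit_reps H sigma) (os' : orbit_reps H sigma').

Lemma canonical_iso_exists : exists pi phi, @canonical_iso H T I I' sigma sigma' pi phi.
Proof.
have P i : exists i', exists h, moves (sigma i) (sigma' i') h.
  have [i' [[g Hg E] _]] := os' (sigma i); have [h Eh] := HsgP Hg.
  by exists i', h^-1%g; apply: moves_inv; rewrite /moves Eh.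
have P' i' : exists i, exists h, moves (sigma i) (sigma' i') h.
  have [i [[g Hg E] _]] := os (sigma' i'); have [h Eh] := HsgP Hg.
  by exists i, h; rewrite /moves Eh.
have [pi Hpi] := choice P; have [pj Hpj] := choice P'.
pose phi i := sval (cid (change_iso_bij (Hpi i))).
have Hphi i := svalP (cid (change_iso_bij (Hpi i))).
have und_sg i i' h : moves (sigma i) (sigma' i') h ->
    oc_und (val h • sigma i) = oc_und (val (1%g : sg_type H) • sigma' i').
  by move=> mh; rewrite (moves_und mh) gset_act1.
exists pi, phi; split; last by move=> i; case: (Hphi i) => *; split=> //; exact: Hpi.
exists pj => [i|i'].
  have [h1 m1] := Hpi i; have [h2 m2] := Hpj (pi i).
  have := etrans (und_sg _ _ _ m2) (esym (und_sg _ _ _ m1)).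
  exact: orbit_unique.
have [h1 m1] := Hpj i'; have [h2 m2] := Hpi (pj i').
have := orbit_unique cT os' (i := pi (pj i')) (j := i') (h := h2^-1%g) (k := h1^-1%g); apply.
by rewrite !(ct_und cT) (moves_inv m1) (moves_inv m2).
Qed.

Variables (Psi : ind_sum H sigma -> gres H (chains T)) (Psi' : ind_sum H sigma' -> gres H (chains T)).
Hypotheses (Ph : is_ghom Psi) (Ph' : is_ghom Psi').
Hypothesis PE : forall i h, Psi (ind_gen sigma i h) = val h ⊙ chain (sigma i).
Hypothesis PE' : forall i h, Psi' (ind_gen sigma' i h) = val h ⊙ chain (sigma' i).

Lemma sum_isoD (pi : I -> I') (phi : forall i, Ind H (sigma i) -> Ind H (sigma' (pi i))) :
  (forall i, addm (phi i)) -> addm (sum_iso phi).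
Proof.
move=> pD u v; rewrite /sum_iso -big_split /=; apply: eq_bigr => i _.
rewrite ffunE pD; exact: (@dsum_inD _ _ (fun i => Ind H (sigma' i)) (pi i)).
Qed.

(** Once both induced sums are identified with the same chain module, the canonical isomorphism is
    the identity; this gives compatibility with the boundary maps at once. *)
Lemma sum_iso_Psi pi phi : @canonical_iso H T I I' sigma sigma' pi phi ->
  forall u, Psi' (sum_iso phi u) = Psi u.
Proof.
move=> [bpi Hphi]; have pD i : addm (phi i) by case: (Hphi i) => [[]].
have sD := sum_isoD pD; have PD := proj1 Ph; have PD' := proj1 Ph'.
apply: (ind_sum_ext (f := fun u => Psi' (sum_iso phi u)) (g := Psi)) => // [u v|i g].
  by rewrite sD PD'.
have [_ _ [h mh] fE] := Hphi i.
have -> : sum_iso phi (ind_gen sigma i g) = ind_in sigma' (pi i) (phi i (tensor (zg g) 1)).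
  have E0 j : j != i -> ind_in sigma' (pi j) (phi j ((ind_gen sigma i g : dsum_type _) j)) = 0.
    move=> ji; rewrite (_ : (ind_gen sigma i g : dsum_type _) j = 0).
      by rewrite (addm0 (pD j)); exact: (addm0 (@dsum_inD _ _ (fun i => Ind H (sigma' i)) (pi j))).
    by apply: (@dsum_in_neq _ _ (fun i => Ind H (sigma i))); rewrite eq_sym.
  rewrite /sum_iso (bigD1 i) //= big1 ?addr0 //.
  rewrite (_ : (ind_gen sigma i g : dsum_type _) i = tensor (zg g) 1) //.
  exact: (@dsum_in_eq _ _ (fun i => Ind H (sigma i))).
rewrite (fE h mh) rmulZ_zg mulr1 tensor_Mz.
rewrite /ind_in (addmMz (@dsum_inD _ _ (fun i => Ind H (sigma' i)) (pi i))) (addmMz PD').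
rewrite -[dsum_in _]/(ind_gen sigma' (pi i) (g * h^-1)%g) PE' PE.
rewrite -gmodMz -(chain_sgn cT (moves_und mh)) -chain_act.
have E := mulgVK h g; rewrite -[in RHS]E; exact/esym/gmod_actM.
Qed.

End ChangeIso.

Lemma bedge_act g (t : triangles) r : (bedge (g • t) r : edges) = g • (bedge t r : edges).
Proof. by apply: val_inj; case: r => [[|[|[|]]]] // ?. Qed.

Lemma bedge_sub (t : otri) r : (edge_und (bedge t r) `<=` tri_und t)%fset.
Proof.
apply/fsubsetP => z; rewrite /edge_und /tri_und !inE.
by case: r => [[|[|[|]]]] //= ?; rewrite /bedge_val /=; do 2?[case/orP]; move=> ->; rewrite ?orbT.
Qed.

Lemma bedge_of V (t : otri) r : is_face V (tri_und t) -> is_edge V (edge_und (bedge t r)).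
Proof.
move=> ft; split; last by exists (tri_und t); [|exact: bedge_sub].
by rewrite /edge_und cardfs2 oedge_neq.
Qed.

Section RepsExt.
Variables (T : ocells) (cT : cell_theory T) (H : subgroup G).
Variables (I : finType) (sigma : I -> T) (os : orbit_reps H sigma).

Lemma reps_ext (V : gmodule (sg_type H)) (f g : gres H (chains T) -> V) :
  is_ghom f -> is_ghom g -> (forall i, f (chain (sigma i)) = g (chain (sigma i))) -> forall c, f c = g c.
Proof.
move=> [fD fA] [gD gA] E; apply: (chains_ext fD gD) => t.
have [i [h Et]] := orbit_ex cT os t.
rewrite (chain_sgn cT Et) -chain_act (addmMz fD) (addmMz gD); congr (_ *~ _).
by rewrite [LHS](fA h) [RHS](gA h) E.
Qed.

Lemma ghom_twisted (V : gmodule (sg_type H)) (f : gres H (chains T) -> V) :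
  is_ghom f -> forall i, twisted_inv (sigma i) (f (chain (sigma i))).
Proof.
move=> [fD fA] i h ch; rewrite -(addmMz fD) -(cstab_chain cT ch); exact/esym/fA.
Qed.

Lemma Psi_sum (Psi : ind_sum H sigma -> gres H (chains T)) (n : nat) (i : 'I_n -> I) h (s : 'I_n -> int) :
  is_ghom Psi -> (forall i h, Psi (ind_gen sigma i h) = val h ⊙ chain (sigma i)) ->
  Psi (\sum_r ind_gen sigma (i r) (h r) *~ s r) =
    \sum_r (val (h r) ⊙ chain (sigma (i r))) *~ s r :> chains T.
Proof.
move=> [PD _] PE; rewrite (addm_sum PD); apply: eq_bigr => r _.
by rewrite (addmMz PD) PE.
Qed.

End RepsExt.

(** * Incidence data, induced presentation and modular symbols *)

Section SymbolData.
Variables (Sg : symbol) (vS : valid Sg).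
Variables (d2 : chains triangles -> chains edges) (d1 : chains edges -> Delta0).
Hypotheses (d2h : is_ghom d2) (d1h : is_ghom d1)
  (d1E : forall e : edges, d1 (chain e) = dcusp (oe_val e).1 (oe_val e).2)
  (d2E : forall t : triangles, d2 (chain t) = \sum_(r < 3) chain (bedge t r : edges)).
Let base := @base_position Sg.
Let H := Hsym Sg.

Section Inc.
Variables (I J : finType) (E : local_reps base edges I) (Fc : local_reps base triangles J).

Let bed j r : edges := bedge (lr_cell Fc j) r.

Lemma bed_of j r : is_edge (verts (oc_oct (lr_occ Fc j))) (edge_und (bed j r)).
Proof. exact/bedge_of/(lr_of Fc j). Qed.

Lemma incidence_exists : inhabited (incidence H E Fc).
Proof.
have P (p : J * 'I_3) : exists q : I * sg_type H * G,
  [/\ transp (lr_occ E q.1.1) (edge_und (lr_cell E q.1.1)) q.2 (lr_occ Fc p.1) (edge_und (bed p.1 p.2)) &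
      val q.1.2 = (lr_pos Fc p.1 * q.2 * (lr_pos E q.1.1)^-1)%g].
  case: p => j r; have oj := bed_of j r.
  have [i [[t tr] _]] := lr_unique E (y := lr_occ Fc j) (u := bed j r) oj.
  have [Hh _] := proj2 (transports_determined vS edge_theory (lr_placed E i) (lr_of E i)
    (lr_placed Fc j) oj (lr_pos Fc j * t * (lr_pos E i)^-1)%g) (ex_intro2 _ _ t tr erefl).
  by have [h Eh] := HsgP Hh; exists (i, h, t).
have [q Hq] := choice P.
constructor; apply: (@Incidence _ _ _ _ _ _ _ (fun j r => (q (j, r)).1.1) (fun j r => (q (j, r)).1.2)
  (fun j r => edge_sgn (bed j r) (oe_act (q (j, r)).2 (lr_cell E (q (j, r)).1.1)))) => j r.
by case: (Hq (j, r)) => tr Eh; exists (q (j, r)).2.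
Qed.

Variable inc : incidence H E Fc.

Lemma inc_chain j r :
  (inc_sgn inc j r = 1 \/ inc_sgn inc j r = -1) /\
  chain (bedge (lr_rep Fc j) r : edges) =
    (val (inc_h inc j r) ⊙ chain (lr_rep E (inc_edge inc j r))) *~ inc_sgn inc j r.
Proof.
have [t [tr -> ->]] := inc_ok inc j r; set i := inc_edge inc j r in tr *.
have [Et _] := transp_sound tr.
have Eu : oc_und (bed j r) = oc_und (t • (lr_cell E i : edges)).
  by rewrite (ct_und edge_theory) [RHS]Et.
split; first exact: (ct_sgn1 edge_theory Eu).
rewrite /lr_rep bedge_act -/(bed j r) -chain_act (chain_sgn edge_theory Eu) gmodMz; congr (_ *~ _).
by rewrite !chain_act -!gset_actM mulgVK.
Qed.

Lemma d2_rep j : d2 (chain (lr_rep Fc j)) =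
  \sum_(r < 3) (val (inc_h inc j r) ⊙ chain (lr_rep E (inc_edge inc j r))) *~ inc_sgn inc j r.
Proof. by rewrite d2E; apply: eq_bigr => r _; case: (inc_chain j r). Qed.

Lemma d2_rep_act j (h : sg_type H) : d2 (val h ⊙ chain (lr_rep Fc j)) =
  \sum_(r < 3) (val (h * inc_h inc j r)%g ⊙ chain (lr_rep E (inc_edge inc j r))) *~ inc_sgn inc j r.
Proof.
rewrite (proj2 d2h) d2_rep gmod_sum; apply: eq_bigr => r _.
by rewrite gmodMz valM gmod_actM.
Qed.

Variables (PsiE : ind_sum H (lr_rep E) -> gres H (chains edges))
  (PsiF : ind_sum H (lr_rep Fc) -> gres H (chains triangles)).
Hypotheses (PEh : is_ghom PsiE) (PFh : is_ghom PsiF)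
  (PEE : forall i h, PsiE (ind_gen (lr_rep E) i h) = val h ⊙ chain (lr_rep E i))
  (PFE : forall j h, PsiF (ind_gen (lr_rep Fc) j h) = val h ⊙ chain (lr_rep Fc j)).

(** The prescribed values on generators force D2 and D1 to be d2 and d1 carried through the
    identifications with chains. *)
Lemma presentation_mapsE D2 D1 : presentation_maps inc D2 D1 ->
  (forall u, PsiE (D2 u) = d2 (PsiF u)) /\ (forall u, D1 u = st_class (d1 (PsiE u))).
Proof.
move=> [[D2D _] [D1D _] D2E D1E]; have PD := proj1 PEh; have PFD := proj1 PFh.
have d2D := proj1 d2h; have d1D := proj1 d1h; have sD := proj1 st_class_ghom.
split.
  apply: (ind_sum_ext (f := fun u => PsiE (D2 u)) (g := fun u => d2 (PsiF u))) => [u v|u v|j h].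
  - by rewrite D2D PD.
  - by rewrite PFD d2D.
  by rewrite [D2 _]D2E PFE d2_rep_act (Psi_sum _ _ _ PEh PEE).
apply: (ind_sum_ext (f := D1) (g := fun u => st_class (d1 (PsiE u)))) => [//|u v|i h].
  by rewrite PD d1D sD.
rewrite [D1 _]D1E PEE (proj2 d1h) (proj2 st_class_ghom) d1E //.
Qed.

End Inc.

Lemma incidence_determined : determines_incidence Sg d2.
Proof.
move=> I J E Fc; split; first exact: incidence_exists.
move=> inc; split=> [j r|]; last exact: d2_rep.
have [s1 s2] := inc_chain inc j r; split=> // i ti.
have [i0 [_ U]] := lr_unique E (y := lr_occ Fc j) (u := bedge (lr_cell Fc j) r) (bed_of Fc j r).
have [t [tr _ _]] := inc_ok inc j r.
by rewrite -(U _ ti) -(U _ (ex_intro _ t tr)).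
Qed.

Lemma presentation_determined : determines_presentation Sg.
Proof.
move=> I J E Fc inc.
have [PE [TE [PEh TEh PEK TEK PEE]]] := orbit_module edge_theory (local_orbit_reps vS edge_theory E).
have [PF [TF [PFh TFh PFK TFK PFE]]] := orbit_module tri_theory (local_orbit_reps vS tri_theory Fc).
have [[d2D d2A] [d1D d1A] [sD sA]] := And3 d2h d1h st_class_ghom.
have stK w : st_class w = 0 -> w = 0.
  by move=> E0; apply: st_class_inj; rewrite (addm0 sD).
exists (fun u => TE (d2 (PF u))), (fun u => st_class (d1 (PE u))); split.
- split.
  + split=> [u v|h u]; first by rewrite (proj1 PFh) d2D (proj1 TEh).
    by rewrite (proj2 PFh) [d2 _]d2A (proj2 TEh).
  + split=> [u v|h u]; first by rewrite (proj1 PEh) d1D sD.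
    by rewrite (proj2 PEh) [d1 _]d1A [LHS]sA.
  + move=> j h; apply: (can_inj PEK); rewrite TEK PFE (d2_rep_act inc).
    by rewrite (Psi_sum _ _ _ PEh PEE).
  + by move=> i h; rewrite PEE d1A d1E [LHS]sA.
- move=> v; split=> [/stK/(exact_d2_d1 d2h d1h d1E d2E)[u Eu]|[u <-]].
    by exists (TF u); rewrite TFK Eu PEK.
  by rewrite TEK (d1_d2 d2h d1h d1E d2E) (addm0 sD).
move=> w; have [st _ stK'] := st_class_bij.
have [u Eu] := d1_surj d1h d1E (st w); exists (TE u).
by rewrite TEK Eu stK'.
Qed.

Lemma symbols_determined : determines_symbols Sg.
Proof.
move=> I J E Fc inc V d1e.
have oE := local_orbit_reps vS edge_theory E; have oF := local_orbit_reps vS tri_theory Fc.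
have [[d2D d2A] [d1D d1A]] := conj d2h d1h.
(* The relation map at v is L o d2 on the face representatives, for any equivariant L extending v;
   invariance and vanishing are then statements about d2. *)
have rmE (L : gres H (chains edges) -> V) (v : I -> V) : is_ghom L ->
    (forall i, L (chain (lr_rep E i)) = v i) ->
    forall j, relation_map inc v j = L (d2 (chain (lr_rep Fc j))).
  move=> [LD LA] LE j; rewrite (d2_rep inc) (addm_sum LD); apply: eq_bigr => r _.
  by rewrite (addmMz LD) [L _](LA (inc_h inc j r)) LE.
have lift v : (forall i, twisted_inv (lr_rep E i) (v i)) ->
    exists2 L : gres H (chains edges) -> V, is_ghom L & forall i, L (chain (lr_rep E i)) = v i.
  by move=> /(ext_from_reps edge_theory oE)[L [LD LA LE]]; exists L.
have comp2 (L : gres H (chains edges) -> V) : is_ghom L ->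
    @is_ghom _ (gres H (chains triangles)) V (fun c => L (d2 c)).
  by move=> [LD LA]; split=> [u v|h u]; [rewrite d2D LD|rewrite [d2 _]d2A; exact: LA].
have comp1 (Phi : gres H Delta0 -> V) : is_ghom Phi ->
    @is_ghom _ (gres H (chains edges)) V (fun c => Phi (d1 c)).
  by move=> [LD LA]; split=> [u v|h u]; [rewrite d1D LD|rewrite [d1 _]d1A; exact: LA].
split.
- move=> v /lift[L Lh LE] j; rewrite (rmE L v Lh LE).
  exact:  (ghom_twisted (sigma := lr_rep Fc) tri_theory (comp2 L Lh)).
- move=> Phi Ph; split=> [i|j].
    rewrite /d1e -d1E; exact: (ghom_twisted (sigma := lr_rep E) edge_theory (comp1 Phi Ph)).
  rewrite (rmE _ _ (comp1 Phi Ph)) => [|i]; last by rewrite d1E.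
  by rewrite (d1_d2 d2h d1h d1E d2E) (addm0 (proj1 Ph)).
move=> v /lift[L Lh LE] v0; have [LD LA] := Lh.
have Ld2 c : L (d2 c) = 0.
  move: c; apply: (reps_ext tri_theory oF (g := fun=> 0) (comp2 L Lh)) => [|j].
    by split=> [u w|h u]; rewrite ?addr0 // (addm0 (gmod_actD h)).
  by rewrite -(rmE L v Lh LE).
have Ld1 u w : d1 u = d1 w -> L u = L w.
  move=> E1; have [c Ec] : exists c, d2 c = u - w.
    by apply/(exact_d2_d1 d2h d1h d1E d2E); rewrite (addmB d1D) E1 subrr.
  by apply/eqP; rewrite -subr_eq0 -(addmB LD) -Ec Ld2.
have [s sK] := choice (d1_surj d1h d1E).
have PE u : L (s (d1 u)) = L u by apply: Ld1; rewrite sK.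
(* L vanishes on the image of d2, which is the kernel of d1, so it does not see the choice of
   preimages made by s. *)
exists (fun w => L (s w)); split.
  split=> [|i]; last by rewrite /d1e -d1E PE.
  split=> [x y|h x]; first by rewrite -LD; apply: Ld1; rewrite d1D !sK.
  by rewrite -LA; apply: Ld1; rewrite sK [RHS]d1A sK.
move=> Phi [Ph PhE]; apply/funext => w; rewrite -(sK w) PE.
move: (s w); apply: (reps_ext edge_theory oE Lh (comp1 Phi Ph)) => i.
by rewrite LE d1E PhE.
Qed.

Lemma cells_canonical (T : ocells) : cell_theory T -> canonical_cells Sg T.
Proof. by move=> cT I I' sigma sigma' os os'; exact: canonical_iso_exists. Qed.

Lemma presentation_canonical : canonical_presentation Sg.
Proof.
move=> I J I' J' E Fc E' Fc' inc inc' D2 D1 D2' D1' pi phi rho psi P P' cE cF.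
have [PE [_ [PEh _ _ _ PEE]]] := orbit_module edge_theory (local_orbit_reps vS edge_theory E).
have [PF [_ [PFh _ _ _ PFE]]] := orbit_module tri_theory (local_orbit_reps vS tri_theory Fc).
have [PE' [TE' [PEh' _ PEK' _ PEE']]] :=
  orbit_module edge_theory (local_orbit_reps vS edge_theory E').
have [PF' [_ [PFh' _ _ _ PFE']]] := orbit_module tri_theory (local_orbit_reps vS tri_theory Fc').
have [e2 e1] := presentation_mapsE PEh PFh PEE PFE P.
have [e2' e1'] := presentation_mapsE PEh' PFh' PEE' PFE' P'.
have sE := sum_iso_Psi edge_theory PEh PEh' PEE PEE' cE.
have sF := sum_iso_Psi tri_theory PFh PFh' PFE PFE' cF.
split=> u; first by rewrite e1' sE e1.
by apply: (can_inj PEK'); rewrite e2' sF sE e2.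
Qed.

End SymbolData.

Lemma cell_octahedron (T : ocells) (A : {fset P1}) : cell_theory T ->
  (exists s : T, oc_und s = A) <-> (exists g, oc_of T (g •• Oct) A).
Proof.
move=> cT; split=> [[s <-]|[g]]; first exact: ct_cover.
rewrite -{1}(fset_actVK g A) => /(ct_of cT)/(ct_real cT)[s Es].
by exists (g • s); rewrite (ct_und cT) Es fset_actVK.
Qed.

Theorem theoremC :
  (is_ghom st_class /\ bijective st_class) /\
  (exists (d2 : chains triangles -> chains edges) (d1 : chains edges -> Delta0),
    [/\ [/\ is_ghom d2, is_ghom d1,
          (forall e : edges, d1 (chain e) = dcusp (oe_val e).1 (oe_val e).2) &
          (forall t : triangles,
            d2 (chain t) = \sum_(r < 3) chain (bedge t r : edges))],
        exact_at d2 d1 /\ Defs.surjective d1,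
        (forall A : {fset P1},
          (exists e : edges, oc_und e = A) <->
          (exists g : PSL2, is_edge (g •• verts octahedron) A)),
        (forall A : {fset P1},
          (exists t : triangles, oc_und t = A) <->
          (exists g : PSL2, is_face (g •• verts octahedron) A)) &
        (forall Sg : symbol, valid Sg ->
          [/\ determines_group Sg,
              [/\ determines_orbits Sg edges, determines_orbits Sg triangles,
                  determines_transports Sg edges &
                  determines_transports Sg triangles],
              determines_stabilizers Sg edges /\
              determines_stabilizers Sg triangles,
              [/\ determines_incidence Sg d2, determines_presentation Sg &
                  determines_symbols Sg] &
              [/\ canonical_cells Sg edges, canonical_cells Sg triangles &
                  canonical_presentation Sg]])]).
Proof.
split; first by split; [exact: st_class_ghom|exact: st_class_bij].
have [d2 [d1 [d2h d1h d1E d2E]]] := boundary_maps.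
have [eT tT] := (edge_theory, tri_theory).
exists d2, d1; split=> //.
- split; [exact: exact_d2_d1|exact: d1_surj].
- by move=> A; exact: (cell_octahedron A eT).
- by move=> A; exact: (cell_octahedron A tT).
move=> Sg vS; split.
- exact: group_determined.
- by split; [exact: (orbits_determined vS eT)|exact: (orbits_determined vS tT)|
    exact: (transports_determined vS eT)|exact: (transports_determined vS tT)].
- by split; [exact: (stabilizers_determined vS eT)|exact: (stabilizers_determined vS tT)].
- split; [exact: incidence_determined|exact: (presentation_determined vS d2h d1h)|].
  exact: (symbols_determined vS d2h d1h).
by split; [exact: cells_canonical|exact: cells_canonical|exact: (presentation_canonical vS d2h d1h)].
Qed.
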